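(* Let $\nu:\mathbb{C}\to\hat{\mathbb{S}}^{2,4}$ be the almost-complex curve associated to a nonzero polynomial sextic differential $q$ on $\mathbb{C}$, with Toda frame lift $\hat{\mathcal{F}}_\nu:\mathbb{C}\to\mathsf{G}_2'$, projections $F_T=\pi_T\circ\hat{\mathcal{F}}_\nu:\mathbb{C}\to\mathsf{G}_2'/T$ and $F_K=\pi_K\circ\hat{\mathcal{F}}_\nu:\mathbb{C}\to\mathsf{G}_2'/K$, geometric lift $G_\nu:\mathbb{C}\to\mathscr{Y}$, and geometric map $f:\mathbb{C}\to\mathscr{X}$. Then $F_T$ and $F_K$ are harmonic, and the diagram formed by these maps together with $\beta_{\mathscr{X}},\beta_{\mathscr{Y}},\pi_{\mathscr{X}},\pi_{\hat{\mathbb{S}}^{2,4}},\iota,m_{(3,0)}$ commutes, i.e. $$\beta_{\mathscr{Y}}\circ F_T=G_\nu,\quad \beta_{\mathscr{X}}\circ F_K=f,\quad \pi_{\mathscr{X}}\circ G_\nu=f,\quad \pi_{\hat{\mathbb{S}}^{2,4}}\circ G_\nu=\nu,\quad m_{(3,0)}\circ\iota\circ F_K=\beta_{\mathscr{X}}\circ F_K.$$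
   Context: Split octonions: $\mathbb{O}'=\mathbb{H}\oplus\mathbb{H}$ with product $(a,b)\odot(c,d)=(ac+db^*,\,a^*d+cb)$, $l=(0,1)$, $(a,b)=a+lb$, $\mathbb{H}=(\mathbb{H},0)$ with units $i,j,k$; bilinear form $(a+lb)\cdot(c+ld)=\langle a,c\rangle_{\mathbb{H}}-\langle b,d\rangle_{\mathbb{H}}$; $\mathrm{Im}\,\mathbb{O}'=1^\perp$; $x\times y$ is the component of $x\odot y$ in $\mathrm{Im}\,\mathbb{O}'$; $\mathcal{C}_x(y)=x\times y$. $\mathsf{G}_2'=\mathrm{Aut}_{\mathbb{R}\text{-alg}}(\mathbb{O}')$. $\hat{\mathbb{S}}^{2,4}=\{x\in\mathrm{Im}\,\mathbb{O}':x\cdot x=1\}$. All structures are extended $\mathbb{C}$-linearly to $(\mathrm{Im}\,\mathbb{O}')^{\mathbb{C}}$ (scalar unit $\sqrt{-1}$). Standard multiplication basis: $\mathcal{M}=(m_1,\dots,m_7)=(i,j,k,l,li,lj,lk)$; a multiplication frame of $\mathrm{Im}\,\mathbb{O}'$ is a basis of the form $g(\mathcal{M})$ with $g\in\mathsf{G}_2'$. Data from $q$: let $(u_1,u_2)$ be the unique complete real solution of $2\partial_z\partial_{\bar z}u_1=5e^{u_1-3u_2}-2e^{-2u_1}|q|^2$, $2\partial_z\partial_{\bar z}u_2=6e^{2u_2}-5e^{u_1-3u_2}$ (complete: $e^{u_1-3u_2}|dz|^2$, $e^{2u_2}|dz|^2$ are complete and $|q|^2e^{-2u_1}|dz|^2$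 is complete away from the zeros of $q$); $r=e^{u_1-u_2}$, $s=e^{2u_2}$. Use the ordered basis $(e_3,\dots,e_{-3})$ of $(\mathrm{Im}\,\mathbb{O}')^{\mathbb{C}}$: $e_{\pm3}=\tfrac1{\sqrt2}(jl\pm\sqrt{-1}\,kl)$, $e_{\pm2}=\tfrac1{\sqrt2}(j\pm\sqrt{-1}\,k)$, $e_{\pm1}=\tfrac1{\sqrt2}(l\pm\sqrt{-1}\,il)$, $e_0=i$. Let $H=\mathrm{diag}(\tfrac1{rs},\tfrac1r,\tfrac1s,1,s,r,rs)$, so $H=e^{-2\Omega}$ with $\Omega$ real diagonal; $\varphi e_3=\sqrt3e_2$, $\varphi e_2=\sqrt5e_1$, $\varphi e_1=-\sqrt{-6}e_0$, $\varphi e_0=-\sqrt{-6}e_{-1}$, $\varphi e_{-1}=\sqrt5e_{-2}$, $\varphi e_{-2}=q\,e_3+\sqrt3e_{-3}$, $\varphi e_{-3}=q\,e_2$; $\varphi^{*h}=H^{-1}\overline{\varphi}^TH$. Let $\psi:\mathbb{C}\to GL_7(\mathbb{C})$ be the unique solution of $\psi^{-1}\partial_z\psi=\varphi+H^{-1}\partial_zH$, $\psi^{-1}\partial_{\bar z}\psi=\varphi^{*h}$, $\psi(0)=\mathrm{Id}$ (parallel translation to the fiber over $0$ for the flat connection). The fiber over $0$ is identified with $(\mathrm{Im}\,\mathbb{O}')^{\mathbb{C}}$, compatibly with its real structure, by $H(0)^{1/2}$. Then: - $\nu(z)=H(0)^{1/2}\psi(z)e_0\in\hat{\mathbb{S}}^{2,4}$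 (well defined up to $\mathsf{G}_2'$); - $\hat{\mathcal{F}}_\nu(z)=H(0)^{1/2}\psi(z)e^{\Omega(z)}$, which lies in $\mathsf{G}_2'$; - $f(z)=H(0)^{1/2}\psi(z)\,\mathrm{span}_{\mathbb{R}}\langle w_1,w_2,w_3\rangle$, where $w_a=w_a(z)=H(z)^{-1/2}m_a$ is a real multiplication frame unitary for the hermitian metric $h(x,y)=\overline{x}^TH(z)y$. Homogeneous spaces: $K=\{g\in\mathsf{G}_2':g(\mathrm{Im}\,\mathbb{H})=\mathrm{Im}\,\mathbb{H}\}$ is a maximal compact subgroup; $p_0=(i,\mathrm{span}\langle j,k\rangle,\mathrm{span}\langle l,li\rangle,\mathrm{span}\langle lj,lk\rangle)$ and $T=\mathrm{Stab}_{\mathsf{G}_2'}(p_0)<K$ is a maximal torus of $K$. $\pi_T,\pi_K$ are the projections of $\mathsf{G}_2'$ to $\mathsf{G}_2'/T,\mathsf{G}_2'/K$; harmonicity is with respect to the conformal structure of $\mathbb{C}$ and the (pseudo-)Riemannian metrics on $\mathsf{G}_2'/T,\mathsf{G}_2'/K$ induced by the Killing form. $\mathscr{X}$ is the set of positive definite 3-planes $P\subset\mathrm{Im}\,\mathbb{O}'$ with $P\times P=P$; $\beta_{\mathscr{X}}(gK)=g\cdot\mathrm{Im}\,\mathbb{H}$. $\mathscr{Y}$ is the set of tuples $(x,P,Q,R)$ with $x\in\hat{\mathbb{S}}^{2,4}$ and $P,Q,R$ 2-planes of signatures $(2,0),(0,2),(0,2)$, each preserved by $\mathcal{C}_x$,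 with $\mathrm{Im}\,\mathbb{O}'=\mathbb{R}x\oplus P\oplus Q\oplus R$ orthogonal; $\beta_{\mathscr{Y}}(gT)=g\cdot p_0$. $\pi_{\mathscr{X}}(x,P,Q,R)=\mathbb{R}x\oplus P$, $\pi_{\hat{\mathbb{S}}^{2,4}}(x,P,Q,R)=x$. Lift $G_\nu$: let $\tilde\nu_1=\nu_z$ and $\tilde\nu_2=\nu_{zz}-\frac{\nu_{zz}\cdot\overline{\nu_z}}{\nu_z\cdot\overline{\nu_z}}\nu_z$ (harmonic map sequence); $P=\mathrm{span}_{\mathbb{R}}\langle\mathrm{Re}\,\tilde\nu_2,\mathrm{Im}\,\tilde\nu_2\rangle$, $Q=\mathrm{span}_{\mathbb{R}}\langle\mathrm{Re}\,\tilde\nu_1,\mathrm{Im}\,\tilde\nu_1\rangle$, and $G_\nu=(\nu,P,Q,P\times Q)$. $\iota(gK)$ is the Euclidean inner product with matrix $(g^{-1})^Tg^{-1}$ in the basis $\mathcal{M}$; for a Euclidean inner product $A$ on $\mathrm{Im}\,\mathbb{O}'$ admitting an $A$-orthonormal multiplication frame $(f_a)_{a=1}^7$, $m_{(3,0)}(A)=\mathrm{span}_{\mathbb{R}}\langle f_1,f_2,f_3\rangle$ (independent of the frame). *)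

(* Defs.v *)
From HB Require Import structures.
From mathcomp Require Import all_boot all_order all_algebra.
From mathcomp Require Import complex ring.
From mathcomp Require Import all_classical all_reals all_analysis.

Set Implicit Arguments.
Unset Strict Implicit.
Unset Printing Implicit Defensive.

Import Order.TTheory GRing.Theory Num.Theory.
Import numFieldNormedType.Exports.

Local Open Scope classical_set_scope.
Local Open Scope complex_scope.
Local Open Scope ring_scope.

(** * Split octonions

Everything is generic in the scalar ring [K]: [K = R] gives the split octonions
and [K = R[i]] their complexification.  A quaternion is its column of
coordinates on (1, i, j, k); the octonion (a, b) = a + l b is [col_mx a b], so
that octonions have coordinates on (1, i, j, k, l, li, lj, lk). Since 4 + 4 and
1 + 7 are convertible, imaginary octonions are the columns of size 7 of
coordinates on the standard multiplication basis M = (i,j,k,l,li,lj,lk). *)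

Notation octo K := 'cV[K]_8.
Notation imo K := 'cV[K]_7.

Section Octonions.
Variable K : comNzRingType.

Definition qmul (a b : 'cV[K]_4) : 'cV[K]_4 :=
  let a0 := a 0 0 in let a1 := a 1 0 in let a2 := a 2%:R 0 in let a3 := a 3%:R 0 in
  let b0 := b 0 0 in let b1 := b 1 0 in let b2 := b 2%:R 0 in let b3 := b 3%:R 0 in
  \col_(n < 4) nth 0
    [:: a0 * b0 - a1 * b1 - a2 * b2 - a3 * b3;
        a0 * b1 + a1 * b0 + a2 * b3 - a3 * b2;
        a0 * b2 - a1 * b3 + a2 * b0 + a3 * b1;
        a0 * b3 + a1 * b2 - a2 * b1 + a3 * b0] n.

Definition qconj (a : 'cV[K]_4) : 'cV[K]_4 :=
  \col_(n < 4) (if n == 0 then a n 0 else - a n 0).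


Definition omul (x y : octo K) : octo K :=
  let a := @usubmx K 4 4 1 x in let b := @dsubmx K 4 4 1 x in
  let c := @usubmx K 4 4 1 y in let d := @dsubmx K 4 4 1 y in
  col_mx (qmul a c + qmul d (qconj b)) (qmul (qconj a) d + qmul c b).

Definition odot (x y : octo K) : K :=
  ((@usubmx K 4 4 1 x)^T *m @usubmx K 4 4 1 y) 0 0
  - ((@dsubmx K 4 4 1 x)^T *m @dsubmx K 4 4 1 y) 0 0.

Definition im_inj (x : imo K) : octo K := @col_mx K 1 7 1 0 x.
Definition im_part (x : octo K) : imo K := @dsubmx K 1 7 1 x.

Definition dot (x y : imo K) : K := odot (im_inj x) (im_inj y).
Definition cross (x y : imo K) : imo K := im_part (omul (im_inj x) (im_inj y)).

Definition mbasis (a : 'I_7) : imo K := delta_mx a 0.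

(** The block of an endomorphism of the octonions acting on the imaginary ones. *)
Definition im_mx (g : 'M[K]_8) : 'M[K]_7 := @drsubmx K 1 7 1 7 g.

Lemma qmul_linl a x y z : qmul (a *: x + y) z = a *: qmul x z + qmul y z.
Proof.
apply/colP => n; rewrite !mxE /=.
by case: n => -[|[|[|[|//]]]] ? /=; ring.
Qed.

Lemma qmul_linr a x y z : qmul z (a *: x + y) = a *: qmul z x + qmul z y.
Proof.
apply/colP => n; rewrite !mxE /=.
by case: n => -[|[|[|[|//]]]] ? /=; ring.
Qed.

Lemma qconj_lin a x y : qconj (a *: x + y) = a *: qconj x + qconj y.
Proof.
by apply/colP => n; rewrite !mxE; case: ifP => _; ring.
Qed.

Let col_mx_lin a (u v u' v' : 'cV[K]_4) :
  a *: (col_mx u v : octo K) + (col_mx u' v' : octo K) =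
  col_mx (a *: u + u') (a *: v + v').
Proof. by rewrite -[RHS]add_col_mx -scale_col_mx. Qed.

Lemma omul_linl a x y z : omul (a *: x + y) z = a *: omul x z + omul y z.
Proof.
rewrite /omul col_mx_lin.
have -> : @usubmx K 4 4 1 (a *: x + y) = a *: @usubmx K 4 4 1 x + @usubmx K 4 4 1 y.
  exact: linearP.
have -> : @dsubmx K 4 4 1 (a *: x + y) = a *: @dsubmx K 4 4 1 x + @dsubmx K 4 4 1 y.
  exact: linearP.
rewrite !qconj_lin !(qmul_linl, qmul_linr) !scalerDr.
by apply: (congr2 (@col_mx K 4 4 1)); rewrite !addrA; congr (_ + _); rewrite addrAC.
Qed.

Lemma omul_linr a x y z : omul z (a *: x + y) = a *: omul z x + omul z y.
Proof.
rewrite /omul col_mx_lin.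
have -> : @usubmx K 4 4 1 (a *: x + y) = a *: @usubmx K 4 4 1 x + @usubmx K 4 4 1 y.
  exact: linearP.
have -> : @dsubmx K 4 4 1 (a *: x + y) = a *: @dsubmx K 4 4 1 x + @dsubmx K 4 4 1 y.
  exact: linearP.
rewrite !(qmul_linl, qmul_linr) !scalerDr.
by apply: (congr2 (@col_mx K 4 4 1)); rewrite !addrA; congr (_ + _); rewrite addrAC.
Qed.

End Octonions.

(** * The group G2', its Lie algebra and its homogeneous spaces *)

Section G2.
Variable R : realType.

Definition oct_aut (g : 'M[R]_8) : Prop :=
  g \in unitmx /\
  forall x y : octo R, g *m omul x y = omul (g *m x) (g *m y).

Definition G2 := {g : 'M[R]_8 | oct_aut g}.
Definition G2mx (g : G2) : 'M[R]_8 := proj1_sig g.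

Definition actv (g : G2) (x : imo R) : imo R := im_mx (G2mx g) *m x.
Definition actV (g : G2) (V : {vspace imo R}) : {vspace imo R} :=
  (linfun (mulmx (im_mx (G2mx g)) : imo R -> imo R) @: V)%VS.

Definition mspan (s : seq 'I_7) : {vspace imo R} :=
  (<< [seq mbasis R a | a <- s] >>)%VS.

Definition ImH : {vspace imo R} := mspan [:: 0; 1; 2%:R].

Definition quad : Type :=
  (imo R * {vspace imo R} * {vspace imo R} * {vspace imo R})%type.

Definition actq (g : G2) (p : quad) : quad :=
  let: (x, P, Q, N) := p in (actv g x, actV g P, actV g Q, actV g N).

Definition p0 : quad :=
  (mbasis R 0, mspan [:: 1; 2%:R], mspan [:: 3%:R; 4%:R], mspan [:: 5%:R; 6%:R]).

Definition groupK : set G2 := [set g | actV g ImH = ImH].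
Definition groupT : set G2 := [set g | actq g p0 = p0].

(** Left cosets [gH], and the homogeneous space [G2'/H]. *)
Definition lcoset (H : set G2) (g : G2) : set G2 :=
  [set g' | exists2 h, H h & G2mx g' = G2mx g *m G2mx h].

Definition quot (H : set G2) := {c : set G2 | exists g, c = lcoset H g}.

Definition qproj (H : set G2) (g : G2) : quot H :=
  exist _ (lcoset H g) (ex_intro _ g erefl).

Definition qrepr (H : set G2) (c : quot H) : G2 := projT1 (cid (proj2_sig c)).

(** The subspace with a given membership predicate; meaningful for predicates
closed under linear combinations ([mem_vspace_of]). *)
Definition vspace_of (V : vectType R) (P : set V) : {vspace V} :=
  xget 0%VS [set U : {vspace V} | forall x, x \in U <-> P x].

Lemma mem_vspace_of (V : vectType R) (P : set V) :
  P 0 -> (forall (a : R) x y, P x -> P y -> P (a *: x + y)) ->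
  forall x, x \in vspace_of P <-> P x.
Proof.
move=> P0 Plin.
suff [U UP] : exists U : {vspace V}, forall x, x \in U <-> P x.
  by rewrite /vspace_of; case: xgetP => [W _ //|/(_ U)].
have step n : (exists U : {vspace V}, forall x, x \in U <-> P x) \/
    exists U : {vspace V}, (n <= \dim U)%N /\ forall x, x \in U -> P x.
  elim: n => [|n [|[U [nU UP]]]]; [right|by left|].
    by exists 0%VS; split => // x; rewrite memv0 => /eqP ->.
  have [UP'|] := pselect (forall x, P x -> x \in U).
    by left; exists U => x; split => [/UP|/UP'].
  move=> /existsNP[x /not_implyP[Px /negP xU]]; right.
  exists (U + <[x]>)%VS; split.
    rewrite (leq_ltn_trans nU)// ltn_neqAle dimvS ?addvSl// andbT.
    apply/negP => /eqP dimE.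
    have /eqP UE : U == (U + <[x]>)%VS by rewrite eqEdim addvSl dimE /=.
    by move: xU; rewrite UE (subvP (addvSr _ _))// memv_line.
  move=> y /memv_addP[u uU [w /vlineP[a ->] ->]].
  by rewrite addrC; apply: Plin => //; exact: UP.
have [//|[U [dimU _]]] := step (\dim {: V}).+1.
by have := leq_trans dimU (dimvS (subvf U)); rewrite ltnn.
Qed.

(** The Lie algebra of [G2' = Aut] is the algebra of derivations; those of the
stabilizers K and T are the corresponding infinitesimal stabilizers. *)
Definition is_der (X : 'M[R]_8) : Prop :=
  forall x y : octo R, X *m omul x y = omul (X *m x) y + omul x (X *m y).

Definition stabilizes (X : 'M[R]_8) (V : {vspace imo R}) : Prop :=
  forall v, v \in V -> im_mx X *m v \in V.

Definition is_lieK (X : 'M[R]_8) : Prop := is_der X /\ stabilizes X ImH.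

Definition is_lieT (X : 'M[R]_8) : Prop :=
  let: (x, P, Q, N) := p0 in
  [/\ is_der X, im_mx X *m x = 0, stabilizes X P, stabilizes X Q
    & stabilizes X N].

Definition lieG : {vspace 'M[R]_8} := vspace_of is_der.
Definition lieK : {vspace 'M[R]_8} := vspace_of is_lieK.
Definition lieT : {vspace 'M[R]_8} := vspace_of is_lieT.

Lemma is_der_lin (a : R) X Y : is_der X -> is_der Y -> is_der (a *: X + Y).
Proof.
move=> dX dY x y; rewrite !mulmxDl -!scalemxAl dX dY omul_linl omul_linr.
by rewrite scalerDr !addrA; congr (_ + _); rewrite addrAC.
Qed.

Lemma is_der0 : is_der 0.
Proof.
move=> x y; rewrite !mul0mx.
have := omul_linl (-1) 0 0 y; rewrite scaler0 addr0 scaleN1r addNr => ->.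
have := omul_linr (-1) 0 0 x; rewrite scaler0 addr0 scaleN1r addNr => ->.
by rewrite addr0.
Qed.

Lemma im_mx_lin (a : R) X Y : im_mx (a *: X + Y) = a *: im_mx X + im_mx Y.
Proof. by apply/matrixP => i j; rewrite !mxE. Qed.

Lemma im_mx0 : im_mx (0 : 'M[R]_8) = 0.
Proof. by apply/matrixP => i j; rewrite !mxE. Qed.

Lemma stabilizes_lin (a : R) X Y V :
  stabilizes X V -> stabilizes Y V -> stabilizes (a *: X + Y) V.
Proof.
move=> sX sY v vV; rewrite im_mx_lin mulmxDl -scalemxAl.
by rewrite memvD ?memvZ //; [exact: sX|exact: sY].
Qed.

Lemma stabilizes0 V : stabilizes 0 V.
Proof. by move=> v _; rewrite im_mx0 mul0mx mem0v. Qed.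

Lemma mem_lieG X : X \in lieG <-> is_der X.
Proof. by apply: mem_vspace_of; [exact: is_der0|exact: is_der_lin]. Qed.

Lemma mem_lieK X : X \in lieK <-> is_lieK X.
Proof.
apply: mem_vspace_of; first by split; [exact: is_der0|exact: stabilizes0].
move=> a Y Z [dY sY] [dZ sZ].
by split; [exact: is_der_lin|exact: stabilizes_lin].
Qed.

Lemma mem_lieT X : X \in lieT <-> is_lieT X.
Proof.
apply: mem_vspace_of; first split; try exact: stabilizes0; first exact: is_der0.
  by rewrite im_mx0 mul0mx.
move=> a Y Z [dY xY sY1 sY2 sY3] [dZ xZ sZ1 sZ2 sZ3].
split; try exact: stabilizes_lin; first exact: is_der_lin.
by rewrite im_mx_lin mulmxDl -scalemxAl xY xZ scaler0 addr0.
Qed.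

(** The Killing form [tr (ad X \o ad Y)], the trace being taken in a basis of
the Lie algebra. *)
Definition bracket (X Y : 'M[R]_8) : 'M[R]_8 := X *m Y - Y *m X.

Definition killing (X Y : 'M[R]_8) : R :=
  let b := vbasis lieG in
  \sum_(i < \dim lieG) coord b i (bracket X (bracket Y b`_i)).

Lemma bracket_linl (a : R) X Y Z :
  bracket (a *: X + Y) Z = a *: bracket X Z + bracket Y Z.
Proof.
by rewrite /bracket mulmxDr mulmxDl -scalemxAl -scalemxAr scalerBr opprD addrACA.
Qed.

Lemma killing_linl (a : R) X Y Z :
  killing (a *: X + Y) Z = a * killing X Z + killing Y Z.
Proof.
rewrite /killing mulr_sumr -big_split; apply: eq_bigr => i _ /=.
by rewrite bracket_linl linearP.
Qed.

(** The tangent space of [G2'/H] at [gH] is identified by left translation with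
the Killing-orthogonal complement [orth h] of the Lie algebra [h] of [H], and
the metric is the restriction of the Killing form: [metric h X] is the square
norm of the tangent vector represented by [X] modulo [h]. *)
Definition orth (h : {vspace 'M[R]_8}) : {vspace 'M[R]_8} :=
  vspace_of [set X | X \in lieG /\ forall Y, Y \in h -> killing X Y = 0].

Lemma mem_orth h X :
  X \in orth h <-> X \in lieG /\ forall Y, Y \in h -> killing X Y = 0.
Proof.
apply: mem_vspace_of => /= [|a Y Z [gY hY] [gZ hZ]]; split.
- exact: mem0v.
- move=> Y _; have := killing_linl (-1) 0 0 Y.
  by rewrite scaler0 addr0 mulN1r addNr.
- by rewrite memvD ?memvZ.
- by move=> W hW; rewrite killing_linl hY ?hZ// mulr0 addr0.
Qed.

Definition metric (h : {vspace 'M[R]_8}) (X : 'M[R]_8) : R :=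
  let Xm := daddv_pi (orth h) h X in killing Xm Xm.

End G2.

(** * Harmonic maps from the plane to G2'/H *)

(** The complex plane, with real coordinates; its point [(x, y)] is the complex
number [x + sqrt(-1) y]. *)
Notation plane R := (R * R)%type.

Section Harmonic.
Variable R : realType.

Definition zcoord (p : plane R) : R[i] := p.1 +i* p.2.
Definition dirx : plane R := (1, 0).
Definition diry : plane R := (0, 1).

Fixpoint Ck (V : normedModType R) (U : set V) (k : nat) (f : V -> R) : Prop :=
  {in U, continuous f} /\
  if k is k'.+1 then
    forall v : V, (forall x, U x -> derivable f x v) /\
                  Ck U k' (fun x => 'D_v f x)
  else True.

Definition smooth_on (V : normedModType R) (U : set V) (f : V -> R) : Prop :=
  forall k, Ck U k f.

Definition smooth_lift (V : normedModType R) (H : set (G2 R)) (F : V -> quot H)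
    (U : set V) (g : V -> G2 R) : Prop :=
  [/\ open U,
      forall i j, smooth_on U (fun p => G2mx (g p) i j)
    & forall p, U p -> qproj H (g p) = F p].

(** As [G2' -> G2'/H] has smooth local sections, smoothness of a map into
[G2'/H] is the existence of smooth local lifts to [G2']. *)
Definition smooth_quot (V : normedModType R) (H : set (G2 R)) (F : V -> quot H)
    : Prop :=
  forall p, exists U g, U p /\ smooth_lift F U g.

(** Left-translated velocity of [g] at [p] in the direction [v]. *)
Definition maurer_cartan (g : plane R -> G2 R) (v p : plane R) : 'M[R]_8 :=
  invmx (G2mx (g p)) *m
  \matrix_(i, j) 'D_v (fun p' => G2mx (g p') i j : R^o) p.

(** [|dF(d/dx)|^2 + |dF(d/dy)|^2] at [p]; it does not depend on the lift. *)
Definition energy_density (H : set (G2 R)) (h : {vspace 'M[R]_8})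
    (F : plane R -> quot H) (p : plane R) : R :=
  xget 0 [set c | exists U g, [/\ U p, smooth_lift F U g &
    c = metric h (maurer_cartan g dirx p) + metric h (maurer_cartan g diry p)]].

Definition square (M : R) : set (plane R) :=
  [set` `[- M, M]] `*` [set` `[- M, M]].

Definition energy (H : set (G2 R)) (h : {vspace 'M[R]_8}) (M : R)
    (F : plane R -> quot H) : R :=
  2^-1 * \int[(lebesgue_measure \x lebesgue_measure)%E]_(p in square M)
            energy_density h F p.

(** Critical points of the energy for compactly supported smooth variations;
[h] is the Lie algebra of [H]. In the plane this depends only on the conformal
structure. *)
Definition harmonic_map (H : set (G2 R)) (h : {vspace 'M[R]_8})
    (F : plane R -> quot H) : Prop :=
  smooth_quot F /\
  forall (Phi : R -> plane R -> quot H) (M : R),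
    smooth_quot (fun p : R * plane R => Phi p.1 p.2) ->
    (forall z, Phi 0 z = F z) ->
    (forall t z, ~ square M z -> Phi t z = F z) ->
    is_derive (0 : R) (1 : R) (fun t : R => energy h M (Phi t) : R^o) (0 : R).

End Harmonic.

(** * Data attached to the sextic differential *)

Section Toda.
Variable R : realType.
Local Notation C := R[i].

Definition cderive (v : plane R) (f : plane R -> C) (p : plane R) : C :=
  ('D_v (fun p' => complex.Re (f p') : R^o) p)
  +i* ('D_v (fun p' => complex.Im (f p') : R^o) p).
Definition dz (f : plane R -> C) (p : plane R) : C :=
  (cderive (dirx R) f p - 'i * cderive (diry R) f p) / 2.
Definition dzbar (f : plane R -> C) (p : plane R) : C :=
  (cderive (dirx R) f p + 'i * cderive (diry R) f p) / 2.
Definition mx_dz m n (F : plane R -> 'M[C]_(m, n)) (p : plane R) : 'M[C]_(m, n) :=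
  \matrix_(i, j) dz (fun p' => F p' i j) p.
Definition mx_dzbar m n (F : plane R -> 'M[C]_(m, n)) (p : plane R) : 'M[C]_(m, n) :=
  \matrix_(i, j) dzbar (fun p' => F p' i j) p.

Definition smooth (f : plane R -> R) : Prop := smooth_on setT f.
Definition csmooth (f : plane R -> C) : Prop :=
  smooth (fun p => complex.Re (f p)) /\ smooth (fun p => complex.Im (f p)).

(** Completeness of the length distance of the conformal metric [lam |dz|^2]:
[dist_lt lam p p' e] says that this distance is less than [e].  When [lam]
vanishes at finitely many points (these being then at finite distance), this is
the meaning of "complete away from the zeros". *)
Definition C1 (x : R -> R) : Prop :=
  (forall t, derivable (x : R -> R^o) t 1) /\ continuous (derive1 (x : R -> R^o)).

Definition path_length (lam : plane R -> R) (x y : R -> R) : R :=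
  \int[lebesgue_measure]_(t in [set` `[0, 1]])
    (Num.sqrt (lam (x t, y t)) * Num.sqrt (derive1 (x : R -> R^o) t ^+ 2
                 + derive1 (y : R -> R^o) t ^+ 2)).

Definition dist_lt (lam : plane R -> R) (p p' : plane R) (e : R) : Prop :=
  exists x y : R -> R, [/\ C1 x, C1 y, (x 0, y 0) = p, (x 1, y 1) = p'
    & path_length lam x y < e].

Definition complete_metric (lam : plane R -> R) : Prop :=
  forall s : nat -> plane R,
    (forall e : R, 0 < e -> exists N : nat,
       forall m n, (N <= m)%N -> (N <= n)%N -> dist_lt lam (s m) (s n) e) ->
    exists p : plane R, forall e : R, 0 < e -> exists N : nat,
       forall n, (N <= n)%N -> dist_lt lam (s n) p e.

Variable q : {poly C}.

Definition qval (p : plane R) : C := q.[zcoord p].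
Definition qnorm2 (p : plane R) : R :=
  complex.Re (qval p) ^+ 2 + complex.Im (qval p) ^+ 2.

Variables u1 u2 : plane R -> R.

Definition toda_solution : Prop :=
  [/\ smooth u1, smooth u2,
      forall p, 2 * dz (dzbar (fun p' => (u1 p')%:C)) p =
        (5 * expR (u1 p - 3 * u2 p) - 2 * expR (- 2 * u1 p) * qnorm2 p)%:C
    & forall p, 2 * dz (dzbar (fun p' => (u2 p')%:C)) p =
        (6 * expR (2 * u2 p) - 5 * expR (u1 p - 3 * u2 p))%:C].

Definition complete_solution : Prop :=
  [/\ complete_metric (fun p => expR (u1 p - 3 * u2 p)),
      complete_metric (fun p => expR (2 * u2 p))
    & complete_metric (fun p => qnorm2 p * expR (- 2 * u1 p))].

Definition cplx m n (A : 'M[R]_(m, n)) : 'M[C]_(m, n) := map_mx (fun x => x%:C) A.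

(** The basis [(e_3, e_2, e_1, e_0, e_{-1}, e_{-2}, e_{-3})]: [e_k] has index
[3 - k], and is the corresponding column of [ebasis], in the basis M. *)
Definition evec (n : 'I_7) : imo C :=
  let mi := mbasis C 0 in let mj := mbasis C 1 in
  let mk := mbasis C 2%:R in let ml := mbasis C 3%:R in
  let c : C := ((Num.sqrt 2)^-1)%:C in
  nth 0 [:: c *: (cross mj ml + 'i *: cross mk ml);
            c *: (mj + 'i *: mk);
            c *: (ml + 'i *: cross mi ml);
            mi;
            c *: (ml - 'i *: cross mi ml);
            c *: (mj - 'i *: mk);
            c *: (cross mj ml - 'i *: cross mk ml)] n.
Definition ebasis : 'M[C]_7 := \matrix_(m, n) evec n m 0.

(** Endomorphism with matrix [A] in the basis [e], in coordinates on M. *)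
Definition from_e (A : 'M[C]_7) : 'M[C]_7 := ebasis *m A *m invmx ebasis.

Definition rfun (p : plane R) : R := expR (u1 p - u2 p).
Definition sfun (p : plane R) : R := expR (2 * u2 p).

Definition Hcoef (p : plane R) (n : 'I_7) : R :=
  let r := rfun p in let s := sfun p in
  nth 0 [:: (r * s)^-1; r^-1; s^-1; 1; s; r; r * s] n.

Definition diagC (d : 'I_7 -> R) : 'M[C]_7 := diag_mx (\row_n (d n)%:C).

Definition Hmx (p : plane R) : 'M[C]_7 := diagC (Hcoef p).
Definition Hsqrt (p : plane R) : 'M[C]_7 := diagC (fun n => Num.sqrt (Hcoef p n)).
(** [H = exp (-2 Omega)] *)
Definition Omega (p : plane R) (n : 'I_7) : R := - ln (Hcoef p n) / 2.
Definition expOmega (p : plane R) : 'M[C]_7 := diagC (fun n => expR (Omega p n)).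

Definition phi (p : plane R) : 'M[C]_7 :=
  let r3 : C := (Num.sqrt 3)%:C in let r5 : C := (Num.sqrt 5)%:C in
  let r6 : C := 'i * (Num.sqrt 6)%:C in let q := qval p in
  \matrix_(m, n) nth 0 (nth [::]
    [:: [:: 0 ; 0 ; 0   ; 0   ; 0 ; q ; 0];
        [:: r3; 0 ; 0   ; 0   ; 0 ; 0 ; q];
        [:: 0 ; r5; 0   ; 0   ; 0 ; 0 ; 0];
        [:: 0 ; 0 ; - r6; 0   ; 0 ; 0 ; 0];
        [:: 0 ; 0 ; 0   ; - r6; 0 ; 0 ; 0];
        [:: 0 ; 0 ; 0   ; 0   ; r5; 0 ; 0];
        [:: 0 ; 0 ; 0   ; 0   ; 0 ; r3; 0]] m) n.

Definition phi_adj (p : plane R) : 'M[C]_7 :=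
  invmx (Hmx p) *m (map_mx (@conjc R) (phi p))^T *m Hmx p.

Definition parallel_translation (psi : plane R -> 'M[C]_7) : Prop :=
  [/\ forall m n, csmooth (fun p => psi p m n),
      forall p, psi p \in unitmx,
      forall p, invmx (psi p) *m mx_dz psi p =
                phi p + invmx (Hmx p) *m mx_dz Hmx p,
      forall p, invmx (psi p) *m mx_dzbar psi p = phi_adj p
    & psi (0, 0) = 1%:M].

Variable psi : plane R -> 'M[C]_7.

Definition origin : plane R := (0, 0).

(** Parallel translation to the fiber over 0, followed by the identification of
that fiber with the complexified imaginary octonions. *)
Definition transl (p : plane R) : 'M[C]_7 := Hsqrt origin *m psi p.

Definition is_nu (nu : plane R -> imo R) : Prop :=
  forall p, cplx (nu p) = ebasis *m transl p *m delta_mx 3%:R 0.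

Definition is_toda_frame (Fhat : plane R -> G2 R) : Prop :=
  forall p, cplx (im_mx (G2mx (Fhat p))) = from_e (transl p *m expOmega p).

Definition wvec (p : plane R) (a : 'I_7) : imo C :=
  from_e (invmx (Hsqrt p)) *m mbasis C a.

(** The real subspace [f p], embedded in the complexification, is
[H(0)^{1/2} psi(p) span_R <w_1, w_2, w_3>]. *)
Definition is_geometric_map (f : plane R -> {vspace imo R}) : Prop :=
  forall p (x : imo C),
    (exists2 v, v \in f p & x = cplx v) <->
    (exists c1 c2 c3 : R, x = from_e (transl p) *m
       (c1%:C *: wvec p 0 + c2%:C *: wvec p 1 + c3%:C *: wvec p 2%:R)).

End Toda.

(** * The model spaces and the maps of the diagram *)

Section Diagram.
Variable R : realType.

Definition pos_def (V : {vspace imo R}) : Prop :=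
  forall v, v \in V -> v != 0 -> 0 < dot v v.
Definition neg_def (V : {vspace imo R}) : Prop :=
  forall v, v \in V -> v != 0 -> dot v v < 0.
Definition orthogonal_spaces (V W : {vspace imo R}) : Prop :=
  forall v w, v \in V -> w \in W -> dot v w = 0.
Definition cross_stable (x : imo R) (V : {vspace imo R}) : Prop :=
  forall v, v \in V -> cross x v \in V.

Definition S24 : set (imo R) := [set x | dot x x = 1].

Definition spaceX : set {vspace imo R} :=
  [set P | [/\ \dim P = 3%N, pos_def P
    & forall z, z \in P <-> exists x y, [/\ x \in P, y \in P & z = cross x y]]].

Definition spaceY : set (quad R) :=
  [set p | let: (x, P, Q, N) := p in
    S24 x /\
    [/\ \dim P = 2%N, \dim Q = 2%N, \dim N = 2%N
      & [/\ pos_def P, neg_def Q & neg_def N]] /\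
    [/\ cross_stable x P, cross_stable x Q & cross_stable x N] /\
    [/\ orthogonal_spaces <[x]> P, orthogonal_spaces <[x]> Q
      & orthogonal_spaces <[x]> N] /\
    [/\ orthogonal_spaces P Q, orthogonal_spaces P N & orthogonal_spaces Q N] /\
    (<[x]> + P + Q + N = fullv)%VS /\ directv (<[x]> + P + Q + N)].

(** These maps do not depend on the chosen representative. *)
Definition betaX (c : quot (@groupK R)) : {vspace imo R} :=
  actV (qrepr c) (ImH R).
Definition betaY (c : quot (@groupT R)) : quad R := actq (qrepr c) (p0 R).
Definition iotaK (c : quot (@groupK R)) : 'M[R]_7 :=
  (invmx (im_mx (G2mx (qrepr c))))^T *m invmx (im_mx (G2mx (qrepr c))).

Definition piX (p : quad R) : {vspace imo R} :=
  let: (x, P, _, _) := p in (<[x]> + P)%VS.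
Definition piS (p : quad R) : imo R := let: (x, _, _, _) := p in x.

(** [A] is the Gram matrix of a Euclidean inner product in the basis M, and the
multiplication frames are the [g(M)], with [g] in [G2']. *)
Definition m30 (A : 'M[R]_7) : {vspace imo R} :=
  xget 0%VS [set V : {vspace imo R} | exists g : G2 R,
    let f a := actv g (mbasis R a) in
    (forall a b, ((f a)^T *m A *m f b) 0 0 = (a == b)%:R) /\
    V = span [:: f 0; f 1; f 2%:R]].

Definition Re_mx m n (A : 'M[R[i]]_(m, n)) : 'M[R]_(m, n) := map_mx (@complex.Re R) A.
Definition Im_mx m n (A : 'M[R[i]]_(m, n)) : 'M[R]_(m, n) := map_mx (@complex.Im R) A.

(** The harmonic map sequence of [nu] and its geometric lift. *)
Definition nu1 (nu : plane R -> imo R) : plane R -> imo R[i] :=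
  mx_dz (fun p => cplx (nu p)).
Definition nu2 (nu : plane R -> imo R) (p : plane R) : imo R[i] :=
  let nz := nu1 nu p in let nzz := mx_dz (nu1 nu) p in
  let nzb := map_mx (@conjc R) nz in
  nzz - (dot nzz nzb / dot nz nzb) *: nz.

Definition cross_span (P Q : {vspace imo R}) : {vspace imo R} :=
  (<< [seq cross x y | x <- vbasis P, y <- vbasis Q] >>)%VS.

Definition geometric_lift (nu : plane R -> imo R) (p : plane R) : quad R :=
  let P := (<< [:: Re_mx (nu2 nu p); Im_mx (nu2 nu p)] >>)%VS in
  let Q := (<< [:: Re_mx (nu1 nu p); Im_mx (nu1 nu p)] >>)%VS in
  (nu p, P, Q, cross_span P Q).

End Diagram.

(* Main.v *)
Require Import Defs.
From HB Require Import structures.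
From mathcomp Require Import all_boot all_order all_algebra.
From mathcomp Require Import complex ring lra zify.
From mathcomp Require Import all_classical all_reals all_analysis.
From mathcomp Require Import measurable_realfun.

(** Why the theorem holds.

The Toda frame is a moving frame whose connection takes values in the Lie algebra
of derivations of the split octonions. In the unitary weight basis the structure
equations of the parallel translation become those of a connection whose value is
the sum of a Higgs field with its adjoint and of a purely imaginary diagonal part,
and in the multiplication basis these two summands are the real matrices [pmx] and
[tmx], which are derivations ([mxcD_Gmx_x], [mxcD_Gmx_y], [pmx_der], [tmx_der]).
So the frame solves a linear differential system with real coefficients, starting
at the identity. Its imaginary part, and then its defect of multiplicativity, solve
homogeneous linear systems and vanish at the origin, hence everywhere
([plane_ode0]): the frame is real and made of automorphisms ([Gmx_real],
[frame_aut]). This gives the existence of the curve, of the frame and of the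
geometric map, and exhibits each of them as the image under the frame of a base
object ([is_nuP], [geometric_mapP]).

Harmonicity is tested on lifts to the group. Along a variation, the left-translated
velocities of a lift satisfy the Maurer-Cartan equation, and the invariance of the
Killing form turns the derivative of the energy density into a divergence plus the
pairing of the variation with the tension ([first_variation]); the divergence has
compact support and integrates to zero ([harmonic_of_tension]). Symmetry,
invariance and definiteness on isotropy algebras of the Killing form come from its
expression as a multiple of the trace form of the seven-dimensional representation
([killing_trace]), which rests on the projection of all matrices to derivations.
For the Toda frame, [tmx] is vertical and [pmx] horizontal over both quotients
([proj_conn]), because [tmx] lies in the Lie algebra of T and [pmx] is orthogonal
to that of K. The tension is then an explicit combination of first derivatives: the
real coefficients of the Higgs field are exponentials, whose derivatives cancel the
brackets with the torus part, and the remaining derivatives of the polynomial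
cancel by the Cauchy-Riemann equations ([tension_Fhat]).

The diagram is a matter of equivariance. The first two terms of the harmonic
sequence are multiples of the images under the frame of weight vectors, so the
geometric lift is the image of the base point of Y ([nu1E], [nu2E],
[geometric_liftE]), and the conditions defining the model spaces have only to be
checked at base points ([spaceX_actV], [spaceY_actq]). Two multiplication frames
that are orthonormal for the same Euclidean inner product differ by an automorphism
that is both Euclidean and split orthogonal; it commutes with the signature matrix,
so it preserves the imaginary quaternions, which gives the last equality
([ortho_stabilizes_ImH], [m30_iotaK]). *)

Set Implicit Arguments.
Unset Strict Implicit.
Unset Printing Implicit Defensive.

Import Order.TTheory GRing.Theory Num.Theory.
Import numFieldNormedType.Exports.

Local Open Scope classical_set_scope.
Local Open Scope complex_scope.
Local Open Scope ring_scope.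


(** * Smooth functions *)

Section Ck.
Variable R : realType.
Implicit Types V W : normedModType R.

Lemma open_near V (U : set V) (P : V -> Prop) x :
  open U -> U x -> (forall y, U y -> P y) -> \forall y \near x, P y.
Proof.
move=> oU Ux UP; apply: filterS UP _.
exact: open_nbhs_nbhs.
Qed.

Lemma Ck_cont V (U : set V) k (f : V -> R) x :
  Ck U k f -> U x -> {for x, continuous f}.
Proof. by case: k => [|k] [cf _] Ux; apply: cf; rewrite inE. Qed.

Lemma Ck_sub V (U U' : set V) k (f : V -> R) :
  U' `<=` U -> Ck U k f -> Ck U' k f.
Proof.
move=> sU; elim: k f => [|k IH] f [cf df]; split => //.
- by move=> x; rewrite inE => /sU Ux; apply: cf; rewrite inE.
- by move=> x; rewrite inE => /sU Ux; apply: cf; rewrite inE.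
- by move=> v; have [df1 df2] := df v; split => [x /sU /df1//|]; exact: IH.
Qed.

Lemma Ck_pred V (U : set V) k (f : V -> R) : Ck U k.+1 f -> Ck U k f.
Proof.
elim: k f => [|k IH] f [cf df]; split => //.
by move=> v; have [df1 df2] := df v; split => //; exact: IH.
Qed.

Lemma Ck_der V (U : set V) k (f : V -> R) v x :
  Ck U k.+1 f -> U x -> derivable f x v.
Proof. by case=> _ /(_ v)[+ _]; exact. Qed.

Lemma Ck_D V (U : set V) k (f : V -> R) v : Ck U k.+1 f -> Ck U k ('D_v f).
Proof. by case=> _ /(_ v)[]. Qed.

Lemma open_eq_der V (U : set V) (f g : V -> R) v x : open U -> U x ->
  {in U, f =1 g} -> derivable f x v -> derivable g x v.
Proof.
move=> oU Ux fg; apply: near_eq_derivable.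
by apply: (open_near oU Ux) => y Uy; apply: fg; rewrite inE.
Qed.

Lemma open_eq_D V (U : set V) (f g : V -> R) v x : open U -> U x ->
  {in U, f =1 g} -> 'D_v f x = 'D_v g x.
Proof.
move=> oU Ux fg; apply: near_eq_derive.
by apply: (open_near oU Ux) => y Uy; apply: fg; rewrite inE.
Qed.

Lemma open_eq_cont V (U : set V) (f g : V -> R) x : open U -> U x ->
  {in U, f =1 g} -> {for x, continuous f} -> {for x, continuous g}.
Proof.
move=> oU Ux fg cf.
rewrite /prop_for /continuous_at -(fg x) ?inE//.
apply: cvg_trans cf; apply: near_eq_cvg.
by apply: (open_near oU Ux) => y Uy; rewrite -fg// inE.
Qed.

Lemma Ck_eq V (U : set V) k (f g : V -> R) : open U ->
  {in U, f =1 g} -> Ck U k f -> Ck U k g.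
Proof.
move=> oU; elim: k f g => [|k IH] f g fg [cf df]; split => //.
- by move=> x; rewrite inE => Ux; apply: (open_eq_cont oU Ux fg (cf _ _)); rewrite inE.
- by move=> x; rewrite inE => Ux; apply: (open_eq_cont oU Ux fg (cf _ _)); rewrite inE.
move=> v; have [df1 df2] := df v; split => [x Ux|].
  exact: (open_eq_der oU Ux fg (df1 _ Ux)).
apply: IH df2 => x; rewrite inE => Ux.
exact: open_eq_D fg.
Qed.

(** Smoothness is local, which makes sense of it for maps known by local
formulas only. *)
Lemma Ck_local V (U : set V) k (f : V -> R) :
  (forall x, U x -> exists U', U' x /\ Ck U' k f) -> Ck U k f.
Proof.
elim: k f => [|k IH] f H; split => //.
- by move=> x; rewrite inE => /H[U' [U'x /Ck_cont]]; exact.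
- by move=> x; rewrite inE => /H[U' [U'x /Ck_cont]]; exact.
move=> v; split => [x /H[U' [U'x /Ck_der]]|]; first exact.
by apply: IH => x /H[U' [U'x /Ck_D]] => /(_ v) h; exists U'.
Qed.

Lemma derivable_ext V (f g : V -> R) x v :
  f =1 g -> derivable f x v -> derivable g x v.
Proof. by move=> /funext ->. Qed.

Lemma derive_ext V (f g : V -> R) x v : f =1 g -> 'D_v f x = 'D_v g x.
Proof. by move=> /funext ->. Qed.

Lemma Ck_cst V (U : set V) k (c : R) : Ck U k (fun _ : V => c).
Proof.
elim: k c => [|k IH] c; split => //; try by move=> x _; exact: cvg_cst.
move=> v; split => [x _|]; first exact: derivable_cst.
have -> : (fun x : V => 'D_v (fun _ : V => c) x) = (fun _ => 0).
  by apply/funext => x; rewrite derive_cst.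
exact: IH.
Qed.

Lemma Ck_add V (U : set V) k (f g : V -> R) : open U ->
  Ck U k f -> Ck U k g -> Ck U k (fun x => f x + g x).
Proof.
move=> oU; elim: k f g => [|k IH] f g [cf df] [cg dg]; split => //.
- by move=> x Ux; apply: cvgD; [exact: cf|exact: cg].
- by move=> x Ux; apply: cvgD; [exact: cf|exact: cg].
move=> v; have [df1 df2] := df v; have [dg1 dg2] := dg v; split => [x Ux|].
  by apply: derivableD; [exact: df1|exact: dg1].
apply: Ck_eq (IH _ _ df2 dg2) => // x; rewrite inE => Ux.
by rewrite deriveD//; [exact: df1|exact: dg1].
Qed.

Lemma Ck_mul V (U : set V) k (f g : V -> R) : open U ->
  Ck U k f -> Ck U k g -> Ck U k (fun x => f x * g x).
Proof.
move=> oU; elim: k f g => [|k IH] f g cf cg; split => //.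
- by move=> x; rewrite inE => Ux; apply: cvgM; [exact: Ck_cont cf Ux|exact: Ck_cont cg Ux].
- by move=> x; rewrite inE => Ux; apply: cvgM; [exact: Ck_cont cf Ux|exact: Ck_cont cg Ux].
move=> v; split => [x Ux|].
  by apply: derivableM; [exact: Ck_der cf Ux|exact: Ck_der cg Ux].
have h := Ck_add oU (IH _ _ (Ck_pred cf) (Ck_D v cg))
                    (IH _ _ (Ck_pred cg) (Ck_D v cf)).
apply: Ck_eq h => // x; rewrite inE => Ux.
by rewrite deriveM//; [exact: Ck_der cf Ux|exact: Ck_der cg Ux].
Qed.

Lemma Ck_opp V (U : set V) k (f : V -> R) : open U ->
  Ck U k f -> Ck U k (fun x => - f x).
Proof.
move=> oU cf; apply: Ck_eq (Ck_mul oU (Ck_cst U k (-1)) cf) => // x _.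
by rewrite mulN1r.
Qed.

Lemma Ck_sum V (U : set V) k (I : Type) (r : seq I) (F : I -> V -> R) : open U ->
  (forall i, Ck U k (F i)) -> Ck U k (fun x => \sum_(i <- r) F i x).
Proof.
move=> oU cF; elim: r => [|i r IH].
  by apply: Ck_eq (Ck_cst U k 0) => // x _; rewrite big_nil.
by apply: Ck_eq (Ck_add oU (cF i) IH) => // x _; rewrite big_cons.
Qed.

(** Directional derivatives are derivatives along a line, which reduces the
chain rule and the mean value theorem to functions of one real variable. *)
Lemma derive_line V (f : V -> R) x v :
  (derivable f x v <-> derivable (fun h : R => f (h *: v + x)) 0 1) *
  ('D_v f x = 'D_1 (fun h : R => f (h *: v + x)) 0).
Proof.
rewrite /derivable /derive /=.
have -> : (fun h : R => h^-1 *: (f ((h *: (1 : R^o) + 0) *: v + x)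
     - f ((0 : R) *: v + x))) = (fun h : R => h^-1 *: (f (h *: v + x) - f x)).
  by apply/funext => h; rewrite addr0 scale0r add0r [h *: _]mulr1.
by [].
Qed.

Lemma derive_comp1 V (g : R -> R) (f : V -> R) x v :
  derivable f x v -> derivable g (f x) 1 ->
  derivable (g \o f) x v /\ 'D_v (g \o f) x = 'D_1 g (f x) * 'D_v f x.
Proof.
move=> df dg.
pose F := fun h : R => f (h *: v + x).
have dF : derivable F 0 1 := (derive_line f x v).1.1 df.
have F0 : F 0 = f x by rewrite /F scale0r add0r.
have dgF : derivable g (F 0) 1 by rewrite F0.
split.
  have dF' := (derivable1_diffP _ _).1 dF; have dg' := (derivable1_diffP _ _).1 dgF.
  exact: ((derive_line (g \o f) x v).1.2
    ((derivable1_diffP _ _).2 (differentiable_comp dF' dg'))).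
rewrite (derive_line (g \o f) x v).2 (derive_line f x v).2 -F0.
have := derive1_comp dF dgF; rewrite !derive1E; exact.
Qed.

Lemma Ck_expR V (U : set V) k (f : V -> R) : open U ->
  Ck U k f -> Ck U k (fun x => expR (f x)).
Proof.
move=> oU; elim: k f => [|k IH] f cf; split => //.
- by move=> x; rewrite inE => Ux; apply: continuous_comp; [exact: Ck_cont cf Ux|exact: continuous_expR].
- by move=> x; rewrite inE => Ux; apply: continuous_comp; [exact: Ck_cont cf Ux|exact: continuous_expR].
have E v x : U x -> derivable (fun x => expR (f x)) x v /\
   'D_v (fun x => expR (f x)) x = expR (f x) * 'D_v f x.
  move=> Ux; have := @derive_comp1 _ expR f x v (Ck_der cf Ux) (@derivable_expR _ _).
  by rewrite (@derive_val _ _ _ _ _ _ _ (is_derive_expR (f x))).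
move=> v; split => [x Ux|]; first exact: (E _ _ Ux).1.
apply: Ck_eq (Ck_mul oU (IH _ (Ck_pred cf)) (Ck_D v cf)) => // x.
by rewrite inE => /(E v)[_ ->].
Qed.

(** Affine maps are given by a condition rather than bundled, so that slices,
projections and lines are all instances. *)
Lemma Ck_affine V W (a : V -> W) (A : V -> W) (U : set W) k (f : W -> R) :
  continuous a -> (forall (h : R) v x, a (h *: v + x) = h *: A v + a x) ->
  Ck U k f -> Ck (a @^-1` U) k (f \o a).
Proof.
move=> ca aA; elim: k f => [|k IH] f cf; split => //.
- by move=> x; rewrite inE => Ux; apply: continuous_comp; [exact: ca|exact: Ck_cont cf Ux].
- by move=> x; rewrite inE => Ux; apply: continuous_comp; [exact: ca|exact: Ck_cont cf Ux].
have E v x : (fun h : R => h^-1 *: ((f \o a) (h *: v + x) - (f \o a) x)) =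
   (fun h : R => h^-1 *: (f (h *: A v + a x) - f (a x))).
  by apply/funext => h /=; rewrite aA.
move=> v; split => [x Ux|].
  by rewrite /derivable E; exact: Ck_der cf Ux.
have -> : (fun x => 'D_v (f \o a) x) = 'D_(A v) f \o a.
  by apply/funext => x /=; rewrite /derive E.
exact: IH (Ck_D _ cf).
Qed.

Lemma derive_affine V W (a : V -> W) (A : V -> W) (f : W -> R) v x :
  (forall (h : R) v x, a (h *: v + x) = h *: A v + a x) ->
  'D_v (f \o a) x = 'D_(A v) f (a x).
Proof.
move=> aA; rewrite /derive.
by under eq_fun do rewrite /= aA.
Qed.

Lemma derivable_affine V W (a : V -> W) (A : V -> W) (f : W -> R) v x :
  (forall (h : R) v x, a (h *: v + x) = h *: A v + a x) ->
  derivable f (a x) (A v) -> derivable (f \o a) x v.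
Proof.
move=> aA; rewrite /derivable /=.
by under [X in _ -> cvg (X @ _)]eq_fun do rewrite /= aA.
Qed.

Lemma dist_lt_add (A B D e : R) : `|A - D| < e -> `|B - D| < e -> `|A - B| < e + e.
Proof.
move=> h1 h2; rewrite (_ : A - B = (A - D) - (B - D)); last by ring.
by rewrite (le_lt_trans (ler_normB _ _))// ltrD.
Qed.

(** The second difference of a function over a parallelogram of side [s],
evaluated in the two possible orders. *)
Lemma second_diff (a b c d p q p' q' s E1 E2 : R) : s != 0 ->
  a - b - (c - d) = (p - q) * s -> a - c - (b - d) = (p' - q') * s ->
  p - q = E1 * s -> p' - q' = E2 * s -> E1 = E2.
Proof.
move=> s0 h h' hp hp'; apply: (mulIf s0); apply: (mulIf s0).
by rewrite -hp -hp' -h -h'; ring.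
Qed.

Lemma mvt_line V (F : V -> R) x v (s : R) : 0 < s ->
  (forall h : R, 0 <= h <= s -> derivable F (h *: v + x) v) ->
  exists c : R, 0 <= c <= s /\ F (s *: v + x) - F x = 'D_v F (c *: v + x) * s.
Proof.
move=> s0 dF; pose a := fun h : R => h *: v + x.
have aA (h k y : R) : a (h *: k + y) = h *: (k *: v) + a y.
  by rewrite /a scalerDl scalerA addrA.
have dG (h : R) : 0 <= h <= s -> is_derive h (1 : R) (F \o a) ('D_v F (h *: v + x)).
  move=> hs; apply: DeriveDef.
    by apply: (@derivable_affine R^o V a ( *:%R^~ v) F) => //; rewrite scale1r; exact: dF.
  by rewrite (@derive_affine R^o V a ( *:%R^~ v) F)//= scale1r.
have [h|h hs|c cs] := @MVT R (F \o a) (fun h => 'D_v F (h *: v + x)) 0 s s0.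
- by rewrite in_itv/= => /andP[h0 hs]; apply: dG; rewrite !ltW.
- apply: derivable_within_continuous hs => k; rewrite in_itv/= => /dG[].
  by move=> + _.
rewrite /= /a scale0r add0r subr0 => Ec.
exists c; split => //.
by move: cs; rewrite in_itv/= => /andP[/ltW -> /ltW ->].
Qed.

Lemma cont_near V (F : V -> R) x (e : R) : {for x, continuous F} -> 0 < e ->
  nbhs x [set y | `|F x - F y| < e].
Proof. by move=> cF e0; apply: ((cvgrPdist_lt _ _).1 cF _ e0). Qed.

Lemma cont_meet V (F1 F2 : V -> R) x :
  {for x, continuous F1} -> {for x, continuous F2} ->
  (forall U : set V, nbhs x U -> exists y y', [/\ U y, U y' & F1 y = F2 y']) ->
  F1 x = F2 x.
Proof.
move=> c1 c2 H; apply/eqP; rewrite -subr_eq0; apply/negPn/negP => neq.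
pose e : R := `|F1 x - F2 x| / 2.
have e0 : 0 < e by rewrite divr_gt0// normr_gt0.
have {}c1 := cont_near c1 e0; have {}c2 := cont_near c2 e0.
have [y [y' [/= [h1 _] [_ h2] E]]] := H _ (filterI c1 c2).
rewrite /= E in h1; rewrite /= in h2.
have := dist_lt_add h1 h2.
by rewrite /e -splitr ltxx.
Qed.

(** Both mixed derivatives are limits of the same second difference. *)
Lemma schwarz V (U : set V) (f : V -> R) v w x : open U -> U x -> Ck U 2 f ->
  'D_v ('D_w f) x = 'D_w ('D_v f) x.
Proof.
move=> oU Ux cf; have c1 := Ck_cont (Ck_D v (Ck_D w cf)) Ux.
have c2 := Ck_cont (Ck_D w (Ck_D v cf)) Ux.
apply: (cont_meet c1 c2) => U' nU'.
have nb : nbhs x (U `&` U') by apply: filterI => //; exact: open_nbhs_nbhs.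
case/nbhs_ballP: nb => d /= d0 Bd.
set s := d / (`|v| + `|w| + 1) / 2.
have N0 : 0 < `|v| + `|w| + 1 by rewrite ltr_wpDl// addr_ge0.
have s0 : 0 < s by rewrite !divr_gt0.
have inB (a b : R) : 0 <= a <= s -> 0 <= b <= s -> ball x d (a *: v + (b *: w + x)).
  move=> /andP[a0 sa] /andP[b0 sb]; rewrite -ball_normE /= addrA opprD.
  rewrite addrCA subrr addr0 normrN.
  apply: (@le_lt_trans _ _ (s * (`|v| + `|w| + 1))).
    rewrite (le_trans (ler_normD _ _))// !normrZ !ger0_norm//.
    rewrite mulrDr mulrDr mulr1 -[leLHS]addr0 lerD ?lerD// ?ler_wpM2r//.
    exact: ltW.
  by rewrite /s mulrAC divfK ?gt_eqF// gtr_pMr// invf_lt1// ltr1n.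
have inB' a b : 0 <= a <= s -> 0 <= b <= s -> ball x d (b *: w + (a *: v + x)).
  by move=> ha hb; rewrite addrCA; exact: inB.
have sb : 0 <= s <= s by rewrite lexx ltW.
have zb : 0 <= (0 : R) <= s by rewrite lexx ltW.
have inU y : ball x d y -> U y by case/Bd.
have Uz a : 0 <= a <= s -> U (a *: v + x).
  by move=> ha; have := inU _ (inB' _ _ ha zb); rewrite scale0r add0r.
have Uw b : 0 <= b <= s -> U (b *: w + x).
  by move=> ha; have := inU _ (inB _ _ zb ha); rewrite scale0r add0r.
have dsh (z u y : V) : U (z + y) -> derivable (fun y => f (z + y)) y u /\
    'D_u (fun y => f (z + y)) y = 'D_u f (z + y).
  move=> Uzy; have zA (h : R) (u' y' : V) : z + (h *: u' + y') = h *: u' + (z + y').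
    by rewrite addrCA.
  split; last by rewrite (@derive_affine _ _ (+%R z) id f).
  exact: (@derivable_affine V V (+%R z) id f u y zA (Ck_der cf Uzy)).
have [c [cs Ec]] : exists c : R, 0 <= c <= s /\
    (f (s *: w + (s *: v + x)) - f (s *: v + x)) - (f (s *: w + x) - f x) =
    ('D_v f (s *: w + (c *: v + x)) - 'D_v f (c *: v + x)) * s.
  have [h hs|c [cs Ec]] := @mvt_line _ (fun y => f (s *: w + y) - f y) x v s s0.
    apply: derivableB; last exact: Ck_der cf (Uz _ hs).
    exact: (dsh _ _ _ (inU _ (inB' _ _ hs sb))).1.
  exists c; split => //; rewrite Ec deriveB; last exact: Ck_der cf (Uz _ cs).
    by rewrite (dsh _ _ _ (inU _ (inB' _ _ cs sb))).2.
  exact: (dsh _ _ _ (inU _ (inB' _ _ cs sb))).1.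
have [b [bs Eb]] := @mvt_line _ ('D_v f) (c *: v + x) w s s0
  (fun h hs => Ck_der (Ck_D v cf) (inU _ (inB' _ _ cs hs))).
have [c' [cs' Ec']] : exists c : R, 0 <= c <= s /\
    (f (s *: v + (s *: w + x)) - f (s *: w + x)) - (f (s *: v + x) - f x) =
    ('D_w f (s *: v + (c *: w + x)) - 'D_w f (c *: w + x)) * s.
  have [h hs|c' [cs' Ec']] := @mvt_line _ (fun y => f (s *: v + y) - f y) x w s s0.
    apply: derivableB; last exact: Ck_der cf (Uw _ hs).
    exact: (dsh _ _ _ (inU _ (inB _ _ sb hs))).1.
  exists c'; split => //; rewrite Ec' deriveB; last exact: Ck_der cf (Uw _ cs').
    by rewrite (dsh _ _ _ (inU _ (inB _ _ sb cs'))).2.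
  exact: (dsh _ _ _ (inU _ (inB _ _ sb cs'))).1.
have [b' [bs' Eb']] := @mvt_line _ ('D_w f) (c' *: w + x) v s s0
  (fun h hs => Ck_der (Ck_D w cf) (inU _ (inB _ _ hs cs'))).
have sn0 := negbT (gt_eqF s0).
exists (b' *: v + (c' *: w + x)), (b *: w + (c *: v + x)); split.
- exact: (Bd _ (inB _ _ bs' cs')).2.
- exact: (Bd _ (inB' _ _ cs bs)).2.
by rewrite [s *: v + (s *: w + x)]addrCA in Ec'; rewrite (second_diff sn0 Ec Ec' Eb Eb').
Qed.

End Ck.

(** * Matrix-valued functions *)

Section MxCalculus.
Variable R : realType.
Implicit Types V W : normedModType R.

Definition mxD V m n (v : V) (G : V -> 'M[R]_(m, n)) (x : V) : 'M[R]_(m, n) :=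
  \matrix_(i, j) 'D_v (fun y => G y i j) x.

Definition mxCk V m n (U : set V) (k : nat) (G : V -> 'M[R]_(m, n)) : Prop :=
  forall i j, Ck U k (fun x => G x i j).

Lemma mxCk_sub V m n (U U' : set V) k (G : V -> 'M[R]_(m, n)) :
  U' `<=` U -> mxCk U k G -> mxCk U' k G.
Proof. by move=> s cG i j; exact: Ck_sub s (cG i j). Qed.

Lemma mxCk_pred V m n (U : set V) k (G : V -> 'M[R]_(m, n)) :
  mxCk U k.+1 G -> mxCk U k G.
Proof. by move=> cG i j; exact: Ck_pred. Qed.

Lemma mxCk_D V m n (U : set V) k (G : V -> 'M[R]_(m, n)) v :
  mxCk U k.+1 G -> mxCk U k (mxD v G).
Proof.
move=> cG i j; have := Ck_D v (cG i j); congr (Ck U k _).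
by apply/funext => x; rewrite mxE.
Qed.

Lemma mxCk_cst V m n (U : set V) k (M : 'M[R]_(m, n)) : mxCk U k (fun _ => M).
Proof. by move=> i j; exact: Ck_cst. Qed.

Lemma mxCk_tr V m n (U : set V) k (G : V -> 'M[R]_(m, n)) :
  mxCk U k G -> mxCk U k (fun x => (G x)^T).
Proof.
move=> cG i j; have := cG j i; congr (Ck U k _).
by apply/funext => x; rewrite mxE.
Qed.

Lemma mxCk_mul V m n p (U : set V) k (G : V -> 'M[R]_(m, n)) (G' : V -> 'M[R]_(n, p)) :
  open U -> mxCk U k G -> mxCk U k G' -> mxCk U k (fun x => G x *m G' x).
Proof.
move=> oU cG cG' i j.
have := Ck_sum (index_enum 'I_n) oU (fun l => Ck_mul oU (cG i l) (cG' l j)).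
by congr (Ck U k _); apply/funext => x; rewrite mxE.
Qed.

Lemma mxCk_add V m n (U : set V) k (G G' : V -> 'M[R]_(m, n)) :
  open U -> mxCk U k G -> mxCk U k G' -> mxCk U k (fun x => G x + G' x).
Proof.
move=> oU cG cG' i j; have := Ck_add oU (cG i j) (cG' i j).
by congr (Ck U k _); apply/funext => x; rewrite mxE.
Qed.

Lemma mxCk_affine V W m n (a : V -> W) (A : V -> W) (U : set W) k
    (G : W -> 'M[R]_(m, n)) :
  continuous a -> (forall (h : R) v x, a (h *: v + x) = h *: A v + a x) ->
  mxCk U k G -> mxCk (a @^-1` U) k (G \o a).
Proof. by move=> ca aA cG i j; exact: (Ck_affine ca aA (cG i j)). Qed.

Lemma mxD_affine V W m n (a : V -> W) (A : V -> W) (G : W -> 'M[R]_(m, n)) v x :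
  (forall (h : R) v x, a (h *: v + x) = h *: A v + a x) ->
  mxD v (G \o a) x = mxD (A v) G (a x).
Proof.
move=> aA; apply/matrixP => i j; rewrite !mxE.
exact: (derive_affine (fun y => G y i j) v x aA).
Qed.

Lemma open_eq_mxD V m n (U : set V) (G G' : V -> 'M[R]_(m, n)) v x :
  open U -> U x -> {in U, G =1 G'} -> mxD v G x = mxD v G' x.
Proof.
move=> oU Ux GG'; apply/matrixP => i j; rewrite !mxE.
by apply: (open_eq_D _ oU Ux) => y Uy; rewrite GG'.
Qed.

Definition mxder V m n (G : V -> 'M[R]_(m, n)) x v : Prop :=
  forall i j, derivable (fun y => G y i j) x v.

Lemma mxCk_der V m n (U : set V) k (G : V -> 'M[R]_(m, n)) x v :
  mxCk U k.+1 G -> U x -> mxder G x v.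
Proof. by move=> cG Ux i j; exact: Ck_der (cG i j) Ux. Qed.

Lemma derivable_bigsum V (I : Type) (r : seq I) (F : I -> V -> R) x v :
  (forall i, derivable (F i) x v) ->
  derivable (fun y => \sum_(i <- r) F i y) x v /\
  'D_v (fun y => \sum_(i <- r) F i y) x = \sum_(i <- r) 'D_v (F i) x.
Proof.
move=> dF; elim: r => [|i r [IH1 IH2]].
  under eq_fun do rewrite big_nil.
  by rewrite big_nil; split; [exact: derivable_cst|exact: derive_cst].
under eq_fun do rewrite big_cons.
rewrite big_cons -IH2; split; first exact: (derivableD (dF i) IH1).
exact: (deriveD (dF i) IH1).
Qed.

Lemma mxD_mul V m n p (G : V -> 'M[R]_(m, n)) (G' : V -> 'M[R]_(n, p)) x v :
  mxder G x v -> mxder G' x v ->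
  mxder (fun y => G y *m G' y) x v /\
  mxD v (fun y => G y *m G' y) x = mxD v G x *m G' x + G x *m mxD v G' x.
Proof.
move=> dG dG'.
have H i j := derivable_bigsum (index_enum 'I_n)
  (fun l => derivableM (dG i l) (dG' l j)).
split=> [i j|].
  by apply: derivable_ext (H i j).1 => y; rewrite mxE.
apply/matrixP => i j; rewrite !mxE -big_split /=.
rewrite -(derive_ext x v (_ : (fun y => \sum_l ((fun y => G y i l) *
    (fun y => G' y l j)) y) =1 _)); last by move=> y; rewrite mxE.
rewrite (H i j).2; apply: eq_bigr => l _; rewrite deriveM// !mxE addrC.
by congr (_ + _); rewrite /GRing.scale /= mulrC.
Qed.

Lemma derive_mulr_cst V (f : V -> R) (c : R) x v : derivable f x v ->
  'D_v (fun y => f y * c) x = 'D_v f x * c.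
Proof.
move=> df; have dc : derivable (fun _ : V => c) x v by exact: derivable_cst.
by rewrite (deriveM df dc) derive_cst scaler0 add0r /GRing.scale /= mulrC.
Qed.

Lemma mxD_cst V m n (M : 'M[R]_(m, n)) x (v : V) :
  mxder (fun _ : V => M) x v /\ mxD v (fun _ : V => M) x = 0.
Proof.
split=> [i j|]; first exact: derivable_cst.
by apply/matrixP => i j; rewrite !mxE derive_cst.
Qed.

Lemma mxD_add V m n (G G' : V -> 'M[R]_(m, n)) x v :
  mxder G x v -> mxder G' x v ->
  mxder (fun y => G y + G' y) x v /\
  mxD v (fun y => G y + G' y) x = mxD v G x + mxD v G' x.
Proof.
move=> dG dG'; split=> [i j|].
  by apply: derivable_ext (derivableD (dG i j) (dG' i j)) => y; rewrite mxE.
apply/matrixP => i j; rewrite !mxE -deriveD//.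
by apply: derive_ext => y; rewrite mxE.
Qed.

Lemma mxD_lin V m n m' n' (L : {linear 'M[R]_(m, n) -> 'M[R]_(m', n')})
    (G : V -> 'M[R]_(m, n)) x v :
  mxder G x v ->
  mxder (L \o G) x v /\ mxD v (L \o G) x = L (mxD v G x).
Proof.
move=> dG.
have LE (M : 'M[R]_(m, n)) i j : L M i j =
    \sum_(kl : 'I_m * 'I_n) M kl.1 kl.2 * L (delta_mx kl.1 kl.2) i j.
  rewrite {1}(matrix_sum_delta M) pair_big linear_sum summxE /=.
  by apply: eq_bigr => kl _; rewrite linearZ mxE.
have dF i j (kl : 'I_m * 'I_n) :
    derivable (fun y => G y kl.1 kl.2 * L (delta_mx kl.1 kl.2) i j) x v.
  by apply: derivableM => //; exact: derivable_cst.
have H i j := derivable_bigsum (index_enum _) (dF i j).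
split=> [i j|].
  by apply: derivable_ext (H i j).1 => y /=; rewrite LE.
apply/matrixP => i j; rewrite mxE LE.
rewrite -(derive_ext x v (_ : (fun y => \sum_(kl : 'I_m * 'I_n)
    G y kl.1 kl.2 * L (delta_mx kl.1 kl.2) i j) =1 _)); last by move=> y /=; rewrite LE.
rewrite (H i j).2; apply: eq_bigr => kl _; rewrite mxE.
exact: derive_mulr_cst.
Qed.

Lemma mxCk_lin V m n m' n' (L : {linear 'M[R]_(m, n) -> 'M[R]_(m', n')})
    (U : set V) k (G : V -> 'M[R]_(m, n)) : open U ->
  mxCk U k G -> mxCk U k (L \o G).
Proof.
move=> oU cG i j.
have := Ck_sum (index_enum _) oU (fun kl : 'I_m * 'I_n =>
  Ck_mul oU (cG kl.1 kl.2) (Ck_cst U k (L (delta_mx kl.1 kl.2) i j))).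
congr (Ck U k _); apply/funext => x /=.
rewrite {2}(matrix_sum_delta (G x)) pair_big linear_sum summxE /=.
by apply: eq_bigr => kl _; rewrite linearZ mxE.
Qed.

Lemma mx_schwarz V m n (U : set V) (G : V -> 'M[R]_(m, n)) v w x :
  open U -> U x -> mxCk U 2 G -> mxD v (mxD w G) x = mxD w (mxD v G) x.
Proof.
move=> oU Ux cG; apply/matrixP => i j; rewrite [LHS]mxE [RHS]mxE.
rewrite (derive_ext x v (_ : _ =1 'D_w (fun y => G y i j))); last by move=> y; rewrite mxE.
rewrite (schwarz v w oU Ux (cG i j)).
by apply: derive_ext => y; rewrite mxE.
Qed.

End MxCalculus.

(** * Octonions in coordinates *)

Section Coordinates.

Lemma ord7_ind (P : 'I_7 -> Prop) :
  P 0 -> P 1 -> P 2%:R -> P 3%:R -> P 4%:R -> P 5%:R -> P 6%:R -> forall i, P i.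
Proof.
move=> p0 p1 p2 p3 p4 p5 p6 [[|[|[|[|[|[|[|//]]]]]]] hi].
- by rewrite (_ : Ordinal hi = 0)//; exact/val_inj.
- by rewrite (_ : Ordinal hi = 1)//; exact/val_inj.
- by rewrite (_ : Ordinal hi = 2%:R)//; exact/val_inj.
- by rewrite (_ : Ordinal hi = 3%:R)//; exact/val_inj.
- by rewrite (_ : Ordinal hi = 4%:R)//; exact/val_inj.
- by rewrite (_ : Ordinal hi = 5%:R)//; exact/val_inj.
- by rewrite (_ : Ordinal hi = 6%:R)//; exact/val_inj.
Qed.

Lemma sum7 (V : nmodType) (F : 'I_7 -> V) :
  \sum_i F i = F 0 + F 1 + F 2%:R + F 3%:R + F 4%:R + F 5%:R + F 6%:R.
Proof.
rewrite !big_ord_recl big_ord0 addr0 !addrA.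
by do ![congr (_ + _)]; congr (F _); exact/val_inj.
Qed.

Lemma sum4 (V : nmodType) (F : 'I_4 -> V) :
  \sum_i F i = F 0 + F 1 + F 2%:R + F 3%:R.
Proof.
rewrite !big_ord_recl big_ord0 addr0 !addrA.
by do ![congr (_ + _)]; congr (F _); exact/val_inj.
Qed.

Variable K : comNzRingType.

Definition oct_mul_coords (x y : octo K) : seq K :=
  [:: x 0 0 * y 0 0 - x 1 0 * y 1 0 - x 2%:R 0 * y 2%:R 0 - x 3%:R 0 * y 3%:R 0 + x 4%:R 0 * y 4%:R 0 + x 5%:R 0 * y 5%:R 0 + x 6%:R 0 * y 6%:R 0 + x 7%:R 0 * y 7%:R 0;
     x 0 0 * y 1 0 + x 1 0 * y 0 0 + x 2%:R 0 * y 3%:R 0 - x 3%:R 0 * y 2%:R 0 + x 4%:R 0 * y 5%:R 0 - x 5%:R 0 * y 4%:R 0 + x 6%:R 0 * y 7%:R 0 - x 7%:R 0 * y 6%:R 0;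
     x 0 0 * y 2%:R 0 - x 1 0 * y 3%:R 0 + x 2%:R 0 * y 0 0 + x 3%:R 0 * y 1 0 + x 4%:R 0 * y 6%:R 0 - x 5%:R 0 * y 7%:R 0 - x 6%:R 0 * y 4%:R 0 + x 7%:R 0 * y 5%:R 0;
     x 0 0 * y 3%:R 0 + x 1 0 * y 2%:R 0 - x 2%:R 0 * y 1 0 + x 3%:R 0 * y 0 0 + x 4%:R 0 * y 7%:R 0 + x 5%:R 0 * y 6%:R 0 - x 6%:R 0 * y 5%:R 0 - x 7%:R 0 * y 4%:R 0;
     x 0 0 * y 4%:R 0 + x 1 0 * y 5%:R 0 + x 2%:R 0 * y 6%:R 0 + x 3%:R 0 * y 7%:R 0 + x 4%:R 0 * y 0 0 - x 5%:R 0 * y 1 0 - x 6%:R 0 * y 2%:R 0 - x 7%:R 0 * y 3%:R 0;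
     x 0 0 * y 5%:R 0 - x 1 0 * y 4%:R 0 - x 2%:R 0 * y 7%:R 0 + x 3%:R 0 * y 6%:R 0 + x 4%:R 0 * y 1 0 + x 5%:R 0 * y 0 0 - x 6%:R 0 * y 3%:R 0 + x 7%:R 0 * y 2%:R 0;
     x 0 0 * y 6%:R 0 + x 1 0 * y 7%:R 0 - x 2%:R 0 * y 4%:R 0 - x 3%:R 0 * y 5%:R 0 + x 4%:R 0 * y 2%:R 0 + x 5%:R 0 * y 3%:R 0 + x 6%:R 0 * y 0 0 - x 7%:R 0 * y 1 0;
     x 0 0 * y 7%:R 0 - x 1 0 * y 6%:R 0 + x 2%:R 0 * y 5%:R 0 - x 3%:R 0 * y 4%:R 0 + x 4%:R 0 * y 3%:R 0 - x 5%:R 0 * y 2%:R 0 + x 6%:R 0 * y 1 0 + x 7%:R 0 * y 0 0].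

Definition cross_coords (x y : imo K) : seq K :=
  [:: x 1 0 * y 2%:R 0 - x 2%:R 0 * y 1 0 + x 3%:R 0 * y 4%:R 0 - x 4%:R 0 * y 3%:R 0 + x 5%:R 0 * y 6%:R 0 - x 6%:R 0 * y 5%:R 0;
     - x 0 0 * y 2%:R 0 + x 2%:R 0 * y 0 0 + x 3%:R 0 * y 5%:R 0 - x 4%:R 0 * y 6%:R 0 - x 5%:R 0 * y 3%:R 0 + x 6%:R 0 * y 4%:R 0;
     x 0 0 * y 1 0 - x 1 0 * y 0 0 + x 3%:R 0 * y 6%:R 0 + x 4%:R 0 * y 5%:R 0 - x 5%:R 0 * y 4%:R 0 - x 6%:R 0 * y 3%:R 0;
     x 0 0 * y 4%:R 0 + x 1 0 * y 5%:R 0 + x 2%:R 0 * y 6%:R 0 - x 4%:R 0 * y 0 0 - x 5%:R 0 * y 1 0 - x 6%:R 0 * y 2%:R 0;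
     - x 0 0 * y 3%:R 0 - x 1 0 * y 6%:R 0 + x 2%:R 0 * y 5%:R 0 + x 3%:R 0 * y 0 0 - x 5%:R 0 * y 2%:R 0 + x 6%:R 0 * y 1 0;
     x 0 0 * y 6%:R 0 - x 1 0 * y 3%:R 0 - x 2%:R 0 * y 4%:R 0 + x 3%:R 0 * y 1 0 + x 4%:R 0 * y 2%:R 0 - x 6%:R 0 * y 0 0;
     - x 0 0 * y 5%:R 0 + x 1 0 * y 4%:R 0 - x 2%:R 0 * y 3%:R 0 + x 3%:R 0 * y 2%:R 0 - x 4%:R 0 * y 1 0 + x 5%:R 0 * y 0 0].

Lemma omulE (x y : octo K) : omul x y = \col_k nth 0 (oct_mul_coords x y) k.
Proof.
have L (k : 'I_4) (j : 'I_8) : val k = val j -> @lshift 4 4 k = j by move=> h; exact/val_inj.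
have D (k : 'I_4) (j : 'I_8) : (4 + val k = val j)%N -> @rshift 4 4 k = j.
  by move=> h; exact/val_inj.
rewrite /omul; apply/colP => k; rewrite [RHS]mxE mxE.
case: (@splitP 4 4 k) => k' ->; rewrite mxE.
- by case: k' => -[|[|[|[|//]]]] hk' /=; rewrite !mxE /= ?(L 0 0)// ?(L 1 1)// ?(L 2%:R 2%:R)// ?(L 3%:R 3%:R)//
    ?(D 0 4%:R)// ?(D 1 5%:R)// ?(D 2%:R 6%:R)// ?(D 3%:R 7%:R)//=; ring.
- by case: k' => -[|[|[|[|//]]]] hk' /=; rewrite !mxE /= ?(L 0 0)// ?(L 1 1)// ?(L 2%:R 2%:R)// ?(L 3%:R 3%:R)//
    ?(D 0 4%:R)// ?(D 1 5%:R)// ?(D 2%:R 6%:R)// ?(D 3%:R 7%:R)//=; ring.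
Qed.

(** Locked, since unfolding the block matrix would expose coordinates at every
simplification. *)
Definition oct_def (a : K) (x : imo K) : octo K := @col_mx K 1 7 1 (a%:M) x.
Fact oct_key : unit. Proof. by []. Qed.
Definition oct := locked_with oct_key oct_def.
Canonical oct_unlockable := [unlockable fun oct].

Lemma oct0 a x : oct a x 0 0 = a.
Proof.
have -> : (0 : 'I_8) = @lshift 1 7 0 by exact/val_inj.
by rewrite [oct]unlock (@col_mxEu K 1 7 1) mxE eqxx mulr1n.
Qed.

Lemma octS a x (k : 'I_7) (j : 'I_8) : val j = (val k).+1 -> oct a x j 0 = x k 0.
Proof.
move=> E; have -> : j = @rshift 1 7 k by exact/val_inj.
by rewrite [oct]unlock (@col_mxEd K 1 7 1).
Qed.

Lemma octK a x : im_part (oct a x) = x.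
Proof. by rewrite /im_part [oct]unlock (@col_mxKd K 1 7 1). Qed.

Lemma oct_eta (z : octo K) : z = oct (z 0 0) (im_part z).
Proof.
rewrite [oct]unlock -[LHS](@vsubmxK K 1 7 1); congr (@col_mx K 1 7 1 _ _).
apply/matrixP => i j; rewrite !ord1 !mxE eqxx mulr1n.
by congr (z _ _); exact/val_inj.
Qed.

Lemma oct_inj a x b y : oct a x = oct b y -> a = b /\ x = y.
Proof.
move=> E; split; first by rewrite -(oct0 a x) E oct0.
by rewrite -(octK a x) E octK.
Qed.

Lemma oct_lin (c a b : K) x y : c *: oct a x + oct b y = oct (c * a + b) (c *: x + y).
Proof.
rewrite [LHS]oct_eta; congr oct; first by rewrite !mxE !oct0.
have L u v : im_part (c *: u + v) = c *: im_part u + im_part v.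
  by apply/matrixP => i j; rewrite !mxE.
by rewrite L !octK.
Qed.

Lemma im_injE x : im_inj x = oct 0 x.
Proof.
rewrite /im_inj [oct]unlock; congr (@col_mx K 1 7 1 _ _).
by apply/matrixP => i j; rewrite !mxE mul0rn.
Qed.

Lemma dotE (x y : imo K) : dot x y = x 0 0 * y 0 0 + x 1 0 * y 1 0 +
  x 2%:R 0 * y 2%:R 0 - x 3%:R 0 * y 3%:R 0 - x 4%:R 0 * y 4%:R 0 -
  x 5%:R 0 * y 5%:R 0 - x 6%:R 0 * y 6%:R 0.
Proof.
have L (z : imo K) (k : 'I_4) (j : 'I_7) : val k = (val j).+1 ->
    oct 0 z (@lshift 4 4 k) 0 = z j 0 by move=> h; rewrite (@octS _ _ j).
have D (z : imo K) (k : 'I_4) (j : 'I_7) : (4 + val k = (val j).+1)%N ->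
    oct 0 z (@rshift 4 4 k) 0 = z j 0 by move=> h; rewrite (@octS _ _ j).
have L0 (z : imo K) : oct 0 z (@lshift 4 4 0) 0 = 0.
  by rewrite -[RHS](oct0 0 z); congr (oct 0 z _ 0); exact/val_inj.
rewrite /dot !im_injE /odot !mxE !sum4 !mxE !L0.
rewrite !(L _ 1 0)// !(L _ 2%:R 1)// !(L _ 3%:R 2%:R)// !(D _ 0 3%:R)//.
rewrite !(D _ 1 4%:R)// !(D _ 2%:R 5%:R)// !(D _ 3%:R 6%:R)//.
ring.
Qed.

Lemma crossE (x y : imo K) : cross x y = \col_k nth 0 (cross_coords x y) k.
Proof.
have S (z : imo K) (j : 'I_8) (k : 'I_7) : val j = (val k).+1 -> oct 0 z j 0 = z k 0.
  exact: octS.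
apply/colP => k; rewrite /cross !im_injE omulE !mxE /=.
by elim/ord7_ind: k => /=; rewrite ?oct0 ?(S _ 1 0)// ?(S _ 2%:R 1)// ?(S _ 3%:R 2%:R)// ?(S _ 4%:R 3%:R)// ?(S _ 5%:R 4%:R)// ?(S _ 6%:R 5%:R)// ?(S _ 7%:R 6%:R)//; ring.
Qed.

(** The octonion product in terms of the two operations on imaginary octonions;
everything about automorphisms and derivations is read off from it. *)
Lemma omul_oct a x b y :
  omul (oct a x) (oct b y) = oct (a * b - dot x y) (a *: y + b *: x + cross x y).
Proof.
have S (c : K) (z : imo K) (j : 'I_8) (k : 'I_7) : val j = (val k).+1 -> oct c z j 0 = z k 0.
  exact: octS.
rewrite [LHS]oct_eta; congr oct.
  by rewrite omulE !mxE /= !oct0 dotE ?(S _ _ 1 0)// ?(S _ _ 2%:R 1)// ?(S _ _ 3%:R 2%:R)// ?(S _ _ 4%:R 3%:R)// ?(S _ _ 5%:R 4%:R)// ?(S _ _ 6%:R 5%:R)// ?(S _ _ 7%:R 6%:R)//; ring.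
apply/colP => k; rewrite omulE crossE !mxE /=.
by elim/ord7_ind: k => /=; rewrite ?oct0 ?(S _ _ 1 0)// ?(S _ _ 2%:R 1)// ?(S _ _ 3%:R 2%:R)// ?(S _ _ 4%:R 3%:R)// ?(S _ _ 5%:R 4%:R)// ?(S _ _ 6%:R 5%:R)// ?(S _ _ 7%:R 6%:R)//; ring.
Qed.

Lemma dotC (x y : imo K) : dot x y = dot y x.
Proof. by rewrite !dotE; ring. Qed.

Lemma dot_linl (c : K) (x y z : imo K) : dot (c *: x + y) z = c * dot x z + dot y z.
Proof. by rewrite !dotE !mxE; ring. Qed.

Lemma dot_linr (c : K) (x y z : imo K) : dot z (c *: x + y) = c * dot z x + dot z y.
Proof. by rewrite ![dot z _]dotC dot_linl. Qed.

Lemma cross_linl (c : K) (x y z : imo K) :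
  cross (c *: x + y) z = c *: cross x z + cross y z.
Proof.
by apply/colP => k; rewrite !crossE !mxE; elim/ord7_ind: k => /=; rewrite !mxE; ring.
Qed.

Lemma crossN (x y : imo K) : cross x y = - cross y x.
Proof.
by apply/colP => k; rewrite !crossE !mxE; elim/ord7_ind: k => /=; ring.
Qed.

Lemma cross_linr (c : K) (x y z : imo K) :
  cross z (c *: x + y) = c *: cross z x + cross z y.
Proof. by rewrite !(crossN z) cross_linl opprD scalerN. Qed.

Lemma crossxx (x : imo K) : cross x x = 0.
Proof.
by apply/colP => k; rewrite !crossE !mxE; elim/ord7_ind: k => /=; ring.
Qed.

(** On lists of coordinates the cross product computes, and an identity of
vectors becomes seven polynomial identities. *)
Definition col7 (s : seq K) : imo K := \col_k s`_k.

Definition crossS (x y : seq K) : seq K :=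
  [:: x`_1 * y`_2 - x`_2 * y`_1 + x`_3 * y`_4 - x`_4 * y`_3 + x`_5 * y`_6 - x`_6 * y`_5;
     - x`_0 * y`_2 + x`_2 * y`_0 + x`_3 * y`_5 - x`_4 * y`_6 - x`_5 * y`_3 + x`_6 * y`_4;
     x`_0 * y`_1 - x`_1 * y`_0 + x`_3 * y`_6 + x`_4 * y`_5 - x`_5 * y`_4 - x`_6 * y`_3;
     x`_0 * y`_4 + x`_1 * y`_5 + x`_2 * y`_6 - x`_4 * y`_0 - x`_5 * y`_1 - x`_6 * y`_2;
     - x`_0 * y`_3 - x`_1 * y`_6 + x`_2 * y`_5 + x`_3 * y`_0 - x`_5 * y`_2 + x`_6 * y`_1;
     x`_0 * y`_6 - x`_1 * y`_3 - x`_2 * y`_4 + x`_3 * y`_1 + x`_4 * y`_2 - x`_6 * y`_0;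
     - x`_0 * y`_5 + x`_1 * y`_4 - x`_2 * y`_3 + x`_3 * y`_2 - x`_4 * y`_1 + x`_5 * y`_0].

Definition dotS (x y : seq K) : K :=
  x`_0 * y`_0 + x`_1 * y`_1 + x`_2 * y`_2 - x`_3 * y`_3 - x`_4 * y`_4
  - x`_5 * y`_5 - x`_6 * y`_6.

Definition linS (a : K) (x y : seq K) : seq K :=
  [:: a * x`_0 + y`_0; a * x`_1 + y`_1; a * x`_2 + y`_2; a * x`_3 + y`_3;
      a * x`_4 + y`_4; a * x`_5 + y`_5; a * x`_6 + y`_6].

Lemma col7_eta (x : imo K) : x = col7 [:: x 0 0; x 1 0; x 2%:R 0; x 3%:R 0; x 4%:R 0;
  x 5%:R 0; x 6%:R 0].
Proof. by apply/colP => k; rewrite !mxE; elim/ord7_ind: k. Qed.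

Lemma cross_col7 x y : cross (col7 x) (col7 y) = col7 (crossS x y).
Proof. by apply/colP => k; rewrite crossE !mxE /cross_coords !mxE. Qed.

Lemma dot_col7 x y : dot (col7 x) (col7 y) = dotS x y.
Proof. by rewrite dotE !mxE. Qed.

Lemma lin_col7 a x y : a *: col7 x + col7 y = col7 (linS a x y).
Proof. by apply/colP => k; rewrite !mxE; elim/ord7_ind: k. Qed.

Lemma col7_eq (x y : seq K) : x = y -> col7 x = col7 y.
Proof. by move->. Qed.

End Coordinates.

(** * Automorphisms and derivations of the octonions *)

Section AutDer.
Variable R : realType.
Local Notation V7 := (imo R).

Lemma mulmx_ext m n (A B : 'M[R]_(m, n)) : (forall x : 'cV_n, A *m x = B *m x) -> A = B.
Proof.
move=> AB; apply/matrixP => i j.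
by have /colP/(_ i) := AB (delta_mx j 0); rewrite -!colE !mxE.
Qed.

Lemma im_mxE (g : 'M[R]_8) (x : V7) : im_mx g *m x = im_part (g *m oct 0 x).
Proof.
apply/colP => i; rewrite !mxE (@big_split_ord _ _ _ 1 7) /= big_ord1.
rewrite (_ : @lshift 1 7 0 = 0) ?oct0 ?mulr0 ?add0r; last exact/val_inj.
by apply: eq_bigr => j _; rewrite (@octS _ _ _ j)//; congr (_ * _); rewrite !mxE.
Qed.

Lemma oct_ext (A B : 'M[R]_8) :
  (forall a x, A *m oct a x = B *m oct a x) -> A = B.
Proof. by move=> AB; apply: mulmx_ext => z; rewrite (oct_eta z). Qed.

Definition ext_mx (c : R) (A : 'M[R]_7) : 'M[R]_8 := @block_mx R 1 7 1 7 c%:M 0 0 A.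

Lemma ext_mxE c A a x : ext_mx c A *m oct a x = oct (c * a) (A *m x).
Proof.
rewrite /ext_mx [@oct _]unlock /oct_def (@mul_block_col R 1 7 1 7 1).
by rewrite !mul0mx addr0 add0r -scalar_mxM.
Qed.

Lemma im_ext_mx c A : im_mx (ext_mx c A) = A.
Proof. by rewrite /im_mx /ext_mx (@block_mxKdr R 1 7 1 7). Qed.

Lemma octZ (c : R) a x : c *: oct a x = oct (c * a) (c *: x).
Proof.
have := oct_lin c a 0 x (0 : V7).
have -> : oct 0 (0 : V7) = 0.
  by have := oct_lin (-1) 0 0 (0 : V7) 0; rewrite scaleN1r addNr mulr0 addr0 scaler0 addr0 => <-.
by rewrite !addr0.
Qed.

Lemma oct_real (c : R) : oct c (0 : V7) = c *: oct 1 0.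
Proof. by rewrite octZ mulr1 scaler0. Qed.

Lemma octD a b (x y : V7) : oct a x + oct b y = oct (a + b) (x + y).
Proof. by have := oct_lin 1 a b x y; rewrite !scale1r mul1r. Qed.

Lemma oct00 : oct 0 (0 : V7) = 0.
Proof. by rewrite -[0 in LHS](mul0r 0) -[X in oct _ X](scale0r 0) -octZ scale0r. Qed.

Lemma cross0l (x : V7) : cross 0 x = 0.
Proof. by have := cross_linl (-1) 0 0 x; rewrite scaler0 addr0 scaleN1r addNr. Qed.
Lemma cross0r (x : V7) : cross x 0 = 0.
Proof. by rewrite crossN cross0l oppr0. Qed.
Lemma dot0l (x : V7) : dot 0 x = 0.
Proof. by have := dot_linl (-1) 0 0 x; rewrite scaler0 addr0 mulN1r addNr. Qed.
Lemma dot0r (x : V7) : dot x 0 = 0.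
Proof. by rewrite dotC dot0l. Qed.

Lemma omul1l (z : octo R) : omul (oct 1 0) z = z.
Proof. by rewrite (oct_eta z) omul_oct dot0l cross0l subr0 mul1r scale1r scaler0 !addr0. Qed.

Lemma omul1r (z : octo R) : omul z (oct 1 0) = z.
Proof. by rewrite (oct_eta z) omul_oct dot0r cross0r subr0 mulr1 scale1r scaler0 add0r addr0. Qed.

Lemma aut_fix1 (g : 'M[R]_8) : oct_aut g -> g *m oct 1 0 = oct 1 0.
Proof.
move=> [ug gM]; rewrite -[LHS]omul1r.
have E : oct 1 0 = g *m (invmx g *m oct 1 0) by rewrite mulmxA mulmxV// mul1mx.
by rewrite [X in omul _ X]E -gM omul1l -E.
Qed.

(** The square of an imaginary octonion is real, so the square of its image is
real too, and such an octonion is real or imaginary. It is not real, because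
automorphisms fix the reals and are injective. *)
Lemma aut_oct (g : 'M[R]_8) a x : oct_aut g ->
  g *m oct a x = oct a (im_mx g *m x).
Proof.
move=> gA; have [ug gM] := gA; have g1 := aut_fix1 gA.
have greal c : g *m oct c 0 = oct c 0.
  by rewrite oct_real -scalemxAr g1.
suff H : g *m oct 0 x = oct 0 (im_mx g *m x).
  have -> : oct a x = oct a 0 + oct 0 x by rewrite octD addr0 add0r.
  by rewrite mulmxDr H greal octD addr0 add0r.
rewrite im_mxE; set z := g *m oct 0 x.
rewrite [LHS]oct_eta; congr oct.
have := gM (oct 0 x) (oct 0 x); rewrite -/z (oct_eta z) !omul_oct crossxx.
rewrite !scale0r !addr0 mul0r sub0r greal crossxx addr0 => /oct_inj[_ /esym].
rewrite -scalerDl => /eqP; rewrite scaler_eq0 -mulr2n -mulr_natl mulf_eq0 pnatr_eq0 /=.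
rewrite oct0; case/orP => /eqP // y0.
have : g *m oct 0 x = g *m oct (z 0 0) 0 by rewrite greal -/z [LHS]oct_eta y0.
move/(congr1 (mulmx (invmx g))); rewrite !mulmxA mulVmx// !mul1mx.
by case/oct_inj.
Qed.

Lemma autE (g : 'M[R]_8) : oct_aut g -> g = ext_mx 1 (im_mx g).
Proof.
by move=> gA; apply: oct_ext => a x; rewrite aut_oct// ext_mxE mul1r.
Qed.

Lemma aut_cross (g : 'M[R]_8) x y : oct_aut g ->
  cross (im_mx g *m x) (im_mx g *m y) = im_mx g *m cross x y.
Proof.
move=> gA; have := gA.2 (oct 0 x) (oct 0 y).
by rewrite !aut_oct// !omul_oct !scale0r !add0r aut_oct// => /oct_inj[].
Qed.

Lemma aut_dot (g : 'M[R]_8) x y : oct_aut g ->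
  dot (im_mx g *m x) (im_mx g *m y) = dot x y.
Proof.
move=> gA; have := gA.2 (oct 0 x) (oct 0 y).
rewrite !aut_oct// !omul_oct !scale0r !add0r aut_oct// => /oct_inj[+ _].
by rewrite mul0r !sub0r => /oppr_inj.
Qed.

(** Converse to [aut_cross] and [aut_dot]. *)
Lemma ext_aut (A : 'M[R]_7) : A \in unitmx ->
  (forall x y, cross (A *m x) (A *m y) = A *m cross x y) ->
  (forall x y, dot (A *m x) (A *m y) = dot x y) -> oct_aut (ext_mx 1 A).
Proof.
move=> uA cA dA; split=> [|z w].
  by rewrite unitmxE /ext_mx (@det_ublock R 1 7) det_scalar1 mul1r -unitmxE.
rewrite (oct_eta z) (oct_eta w) !ext_mxE !omul_oct ext_mxE !mul1r cA dA.
by rewrite !mulmxDr -!scalemxAr.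
Qed.

(** The square of an imaginary octonion is real, and derivations kill the reals. *)
Lemma der_oct (X : 'M[R]_8) a x : is_der X -> X *m oct a x = oct 0 (im_mx X *m x).
Proof.
move=> dX.
have X1 : X *m oct 1 0 = 0.
  have := dX (oct 1 0) (oct 1 0); rewrite omul1r omul1l omul1r => h.
  by apply: (addrI (X *m oct 1 0)); rewrite -h addr0.
have greal c : X *m oct c 0 = 0.
  by rewrite oct_real -scalemxAr X1 scaler0.
suff H : X *m oct 0 x = oct 0 (im_mx X *m x).
  have -> : oct a x = oct a 0 + oct 0 x by rewrite octD addr0 add0r.
  by rewrite mulmxDr H greal add0r.
rewrite im_mxE; set z := X *m oct 0 x.
rewrite [LHS]oct_eta; congr oct.
have := dX (oct 0 x) (oct 0 x); rewrite -/z (oct_eta z) !omul_oct crossxx.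
rewrite !scale0r !addr0 mul0r sub0r greal octD => /esym; rewrite -oct00 => /oct_inj[_].
rewrite add0r (crossN x) addrACA subrr addr0.
rewrite -scalerDl => /eqP; rewrite scaler_eq0 -mulr2n -mulr_natl mulf_eq0 pnatr_eq0 /=.
rewrite oct0; case/orP => /eqP // x0.
by rewrite /z x0 oct00 mulmx0 mxE.
Qed.

Lemma derE (X : 'M[R]_8) : is_der X -> X = ext_mx 0 (im_mx X).
Proof.
by move=> dX; apply: oct_ext => a x; rewrite der_oct// ext_mxE mul0r.
Qed.

Lemma der_cross (X : 'M[R]_8) x y : is_der X ->
  im_mx X *m cross x y = cross (im_mx X *m x) y + cross x (im_mx X *m y).
Proof.
move=> dX; have := dX (oct 0 x) (oct 0 y).
by rewrite !der_oct// !omul_oct der_oct// !scale0r !add0r octD => /oct_inj[].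
Qed.

Lemma der_dot (X : 'M[R]_8) x y : is_der X ->
  dot (im_mx X *m x) y + dot x (im_mx X *m y) = 0.
Proof.
move=> dX; have := dX (oct 0 x) (oct 0 y).
rewrite !der_oct// !omul_oct der_oct// !scale0r !add0r octD => /oct_inj[+ _].
by rewrite !mul0r !sub0r -opprD => /esym/eqP; rewrite oppr_eq0 => /eqP.
Qed.

(** Converse to [der_cross] and [der_dot]. *)
Lemma ext_der (A : 'M[R]_7) :
  (forall x y, A *m cross x y = cross (A *m x) y + cross x (A *m y)) ->
  (forall x y, dot (A *m x) y + dot x (A *m y) = 0) -> is_der (ext_mx 0 A).
Proof.
move=> cA dA z w; rewrite (oct_eta z) (oct_eta w) !(ext_mxE, omul_oct) octD.
congr oct; first by rewrite !mul0r !mulr0 !sub0r -opprD dA oppr0.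
rewrite !mulmxDr -!scalemxAr cA !mul0r !scale0r !add0r.
by rewrite addr0 [RHS]addrACA [w 0 0 *: _ + _]addrC.
Qed.

End AutDer.

(** * The Killing form *)

Section Killing.
Variable R : realType.
Local Notation V7 := (imo R).
Local Notation mb := (@mbasis R).

Definition eps (i : 'I_7) : R := if (i < 3)%N then 1 else -1.

Lemma eps2 i : eps i * eps i = 1.
Proof. by rewrite /eps; case: ifP => _; rewrite ?mulr1// mulN1r opprK. Qed.

Lemma dot_sum (x y : V7) : dot x y = \sum_i eps i * x i 0 * y i 0.
Proof. by rewrite dotE sum7 /eps /=; ring. Qed.

Lemma dot_mbl i (x : V7) : dot (mb i) x = eps i * x i 0.
Proof.
rewrite dot_sum (bigD1 i)//= big1 ?addr0; first by rewrite /mbasis mxE !eqxx mulr1.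
by move=> j ji; rewrite /mbasis mxE (negbTE ji) /= mulr0 mul0r.
Qed.

Lemma imo_sum (x : V7) : x = \sum_i x i 0 *: mb i.
Proof.
rewrite {1}(matrix_sum_delta x); apply: eq_bigr => i _.
by rewrite big_ord1.
Qed.

Definition cmx (f : V7 -> V7) : 'M[R]_7 := \matrix_(i, j) f (mb j) i 0.

Lemma cmxE (f : V7 -> V7) x :
  (forall c u v, f (c *: u + v) = c *: f u + f v) -> cmx f *m x = f x.
Proof.
move=> fL; have f0 : f 0 = 0.
  by have := fL (-1) 0 0; rewrite scaler0 addr0 scaleN1r addNr.
have fS (r : seq 'I_7) (F : 'I_7 -> R) :
    f (\sum_(i <- r) F i *: mb i) = \sum_(i <- r) F i *: f (mb i).
  by elim: r => [|i r IH]; rewrite ?big_nil// !big_cons fL IH.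
rewrite [in RHS](imo_sum x) fS; apply/colP => i; rewrite mxE summxE.
by apply: eq_bigr => j _; rewrite !mxE mulrC.
Qed.

Definition Cmx (v : V7) := cmx (cross v).

Lemma CmxE v x : Cmx v *m x = cross v x.
Proof. by apply: cmxE => c u w; exact: cross_linr. Qed.

(** Alternativity of the octonions. *)
Lemma cross_cross (x y : V7) : cross x (cross x y) = dot x y *: x - dot x x *: y.
Proof.
apply/colP => k; rewrite !crossE !mxE !dotE.
by elim/ord7_ind: k => /=; rewrite !mxE /=; ring.
Qed.

(** The infinitesimal rotation in the plane of [u] and [v] becomes a derivation
once a third of the cross product by [cross u v] is taken off; denominators are
cleared, and the shape of the combination suits [lin_col7]. *)
Definition wedge3 (u v w : V7) : V7 :=
  (3 * dot u w) *: v + ((- 3 * dot v w) *: u + ((-1) *: cross (cross u v) w + 0 *: w)).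

Lemma wedge3_cross u v x y :
  wedge3 u v (cross x y) = 1 *: cross (wedge3 u v x) y + cross x (wedge3 u v y).
Proof.
rewrite (col7_eta u) (col7_eta v) (col7_eta x) (col7_eta y).
set us := [:: u _ _; _; _; _; _; _; _]; set vs := [:: v _ _; _; _; _; _; _; _].
set xs := [:: x _ _; _; _; _; _; _; _]; set ys := [:: y _ _; _; _; _; _; _; _].
have Z (s : seq R) : 0 *: col7 s = col7 [:: 0; 0; 0; 0; 0; 0; 0].
  by apply/colP => k; rewrite !mxE mul0r; elim/ord7_ind: k.
rewrite /wedge3 !(cross_col7, dot_col7, Z, lin_col7) /us /vs /xs /ys.
apply: col7_eq; cbv [crossS dotS nth linS].
by congr [:: _; _; _; _; _; _; _]; ring.
Qed.

Lemma wedge3_dot u v x y : dot (wedge3 u v x) y + dot x (wedge3 u v y) = 0.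
Proof.
rewrite (col7_eta u) (col7_eta v) (col7_eta x) (col7_eta y).
set us := [:: u _ _; _; _; _; _; _; _]; set vs := [:: v _ _; _; _; _; _; _; _].
set xs := [:: x _ _; _; _; _; _; _; _]; set ys := [:: y _ _; _; _; _; _; _; _].
have Z (s : seq R) : 0 *: col7 s = col7 [:: 0; 0; 0; 0; 0; 0; 0].
  by apply/colP => k; rewrite !mxE mul0r; elim/ord7_ind: k.
rewrite /wedge3 !(cross_col7, dot_col7, Z, lin_col7) /us /vs /xs /ys.
by cbv [crossS dotS nth linS]; ring.
Qed.

Lemma wedge3_lin u v c x y : wedge3 u v (c *: x + y) = c *: wedge3 u v x + wedge3 u v y.
Proof.
rewrite /wedge3 !dot_linr !cross_linr; apply/colP => k; rewrite !mxE; ring.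
Qed.

Lemma ext_mx_lin c (A B : 'M[R]_7) : ext_mx 0 (c *: A + B) = c *: ext_mx 0 A + ext_mx 0 B.
Proof.
apply: oct_ext => a x; rewrite mulmxDl -scalemxAl !ext_mxE mul0r octZ octD.
by rewrite mulmxDl -scalemxAl mulr0 addr0.
Qed.

Lemma ext_mx0 : ext_mx 0 (0 : 'M[R]_7) = 0.
Proof.
by have := ext_mx_lin (-1) 0 0; rewrite scaler0 addr0 scaleN1r addNr.
Qed.

Definition inner_der (i j : 'I_7) : 'M[R]_7 :=
  (eps j / 6) *: cmx (wedge3 (mb j) (mb i)).

Lemma inner_der_der i j : is_der (ext_mx 0 (inner_der i j)).
Proof.
have E x : cmx (wedge3 (mb j) (mb i)) *m x = wedge3 (mb j) (mb i) x.
  by apply: cmxE => c u v; exact: wedge3_lin.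
have := is_der_lin (eps j / 6) (_ : is_der (ext_mx 0 (cmx (wedge3 (mb j) (mb i)))))
  (@is_der0 R).
rewrite addr0 => H; have <- : (eps j / 6) *: ext_mx 0 (cmx (wedge3 (mb j) (mb i))) =
    ext_mx 0 (inner_der i j).
  by have := ext_mx_lin (eps j / 6) (cmx (wedge3 (mb j) (mb i))) 0; rewrite ext_mx0 !addr0.
apply: H; apply: ext_der => x y; rewrite !E; first by rewrite wedge3_cross scale1r.
exact: wedge3_dot.
Qed.

Lemma inner_derE i j : inner_der i j =
  2^-1 *: (delta_mx i j - (eps i * eps j) *: delta_mx j i) -
  (eps j / 6) *: Cmx (cross (mb j) (mb i)).
Proof.
apply: mulmx_ext => x; rewrite mulmxBl -!scalemxAl mulmxBl -scalemxAl CmxE.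
rewrite cmxE; last by move=> c u v; exact: wedge3_lin.
have D (a b : 'I_7) : delta_mx a b *m x = x b 0 *: mb a.
  rewrite /mbasis; apply/colP => k; rewrite !mxE (bigD1 b)//= big1 ?addr0.
    by rewrite mxE !eqxx andbT mulrC; case: (k == a); rewrite ?mulr1 ?mulr0.
  by move=> l lb; rewrite mxE (negbTE lb) andbF mul0r.
rewrite !D /wedge3 !dot_mbl; move: (cross (cross (mb j) (mb i)) x) => Y.
have := eps2 j; move: (eps j) (mb i) (mb j) => a u v aa.
apply/colP => k; rewrite !mxE.
rewrite (_ : a / 6 * _ = (a * a) * x j 0 * u k 0 / 2 - eps i * a * x i 0 * v k 0 / 2
  - a / 6 * Y k 0); last by field.
by rewrite aa; field.
Qed.

(** A projection of all matrices onto the derivations: skew part for the split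
metric, minus the cross product that it contains. *)
Definition der_proj (A : 'M[R]_7) : 'M[R]_7 := \sum_i \sum_j A i j *: inner_der i j.

Lemma der_proj_der A : is_der (ext_mx 0 (der_proj A)).
Proof.
have S (r : seq 'I_7) (F : 'I_7 -> 'M[R]_7) : (forall i, is_der (ext_mx 0 (F i))) ->
    is_der (ext_mx 0 (\sum_(i <- r) F i)).
  move=> dF; elim: r => [|i r IH]; first by rewrite big_nil ext_mx0; exact: is_der0.
  rewrite big_cons -[F i]scale1r ext_mx_lin; exact: is_der_lin.
apply: (S) => i; apply: (S) => j; have := ext_mx_lin (A i j) (inner_der i j) 0.
rewrite ext_mx0 !addr0 => ->; rewrite -[X in is_der X]addr0.
by apply: is_der_lin; [exact: inner_der_der|exact: is_der0].
Qed.

Lemma der_skew (X : 'M[R]_8) i j : is_der X ->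
  im_mx X i j = - (eps i * eps j) * im_mx X j i.
Proof.
move=> dX; have := der_dot (mb i) (mb j) dX; set A := im_mx X.
have E a b : (A *m mb b) a 0 = A a b by rewrite /mbasis -colE mxE.
rewrite dotC !dot_mbl !E => /eqP; rewrite addr_eq0 => /eqP h.
have := congr1 ( *%R (eps i)) h; rewrite mulrN !mulrA eps2 mul1r.
by move=> h'; rewrite mulNr h' opprK.
Qed.

(** The Leibniz rule for the cross product by [v], tested on suitable pairs of
basis vectors, isolates each coordinate of [v]. *)
Lemma cross_not_der (v : V7) : is_der (ext_mx 0 (Cmx v)) -> v = 0.
Proof.
move=> dv.
have H (a b d : 'I_7) : cross v (cross (mb a) (mb b)) d 0 =
    (cross (cross v (mb a)) (mb b)) d 0 + (cross (mb a) (cross v (mb b))) d 0.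
  by have := der_cross (mb a) (mb b) dv; rewrite im_ext_mx !CmxE => ->; rewrite mxE.
have M k : mb k = col7 [seq ((k == i :> nat)%:R) | i <- iota 0 7].
  by apply/colP => i; rewrite !mxE; elim/ord7_ind: i; elim/ord7_ind: k.
apply/colP => k; rewrite [RHS]mxE; move: k.
have G a b d := H a b d; rewrite (col7_eta v) in G.
elim/ord7_ind.
- have := G 6%:R 4%:R 2%:R; rewrite !M !cross_col7 !mxE /=; lra.
- have := G 6%:R 5%:R 2%:R; rewrite !M !cross_col7 !mxE /=; lra.
- have := G 6%:R 5%:R 1; rewrite !M !cross_col7 !mxE /=; lra.
- have := G 6%:R 5%:R 4%:R; rewrite !M !cross_col7 !mxE /=; lra.
- have := G 6%:R 5%:R 3%:R; rewrite !M !cross_col7 !mxE /=; lra.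
- have := G 6%:R 4%:R 3%:R; rewrite !M !cross_col7 !mxE /=; lra.
- have := G 5%:R 4%:R 3%:R; rewrite !M !cross_col7 !mxE /=; lra.
Qed.

Lemma Cmx_lin c u v : Cmx (c *: u + v) = c *: Cmx u + Cmx v.
Proof.
by apply: mulmx_ext => x; rewrite mulmxDl -scalemxAl !CmxE cross_linl.
Qed.

Lemma der_proj_id (X : 'M[R]_8) : is_der X -> ext_mx 0 (der_proj (im_mx X)) = X.
Proof.
move=> dX; set A := im_mx X.
have [v Ev] : exists v, der_proj A = A - Cmx v.
  exists (\sum_i \sum_j (A i j * eps j / 6) *: cross (mb j) (mb i)).
  have C0 : Cmx 0 = 0 by have := Cmx_lin (-1) 0 0; rewrite scaler0 addr0 scaleN1r addNr.
  have CS (r : seq 'I_7) (F : 'I_7 -> V7) : Cmx (\sum_(i <- r) F i) = \sum_(i <- r) Cmx (F i).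
    elim: r => [|i r IH]; rewrite ?big_nil// !big_cons -IH -[F i]scale1r Cmx_lin.
    by rewrite !scale1r.
  have CZ (a : R) u : Cmx (a *: u) = a *: Cmx u.
    by rewrite -[a *: u]addr0 Cmx_lin C0 addr0.
  rewrite [X in _ = X - _]matrix_sum_delta CS -sumrB /der_proj.
  have T : \sum_i \sum_j A i j *: ((eps i * eps j) *: delta_mx j i) =
           - \sum_i \sum_j A i j *: delta_mx i j :> 'M[R]_7.
    rewrite exchange_big -sumrN; apply: eq_bigr => i _ /=.
    rewrite -sumrN; apply: eq_bigr => j _ /=.
    rewrite scalerA -scaleNr [in RHS](der_skew i j dX) -/A.
    by congr (_ *: _); rewrite mulNr opprK mulrC [eps j * _]mulrC.
  transitivity (\sum_i \sum_j (2^-1 *: (A i j *: delta_mx i j)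
      - 2^-1 *: (A i j *: ((eps i * eps j) *: delta_mx j i))
      - (A i j * eps j / 6) *: Cmx (cross (mb j) (mb i)))).
    apply: eq_bigr => i _; apply: eq_bigr => j _; rewrite inner_derE.
    rewrite !scalerBr !scalerA; congr (_ - _ - _); congr (_ *: _); ring.
  transitivity (2^-1 *: (\sum_i \sum_j A i j *: delta_mx i j)
    - 2^-1 *: (\sum_i \sum_j A i j *: ((eps i * eps j) *: delta_mx j i))
    - \sum_i \sum_j (A i j * eps j / 6) *: Cmx (cross (mb j) (mb i))).
    rewrite !scaler_sumr -!sumrB; apply: eq_bigr => i _.
    by rewrite !scaler_sumr -!sumrB.
  rewrite T scalerN opprK -scalerDl -[2^-1]mul1r -splitr scale1r -sumrB.
  apply: eq_bigr => i _; congr (_ - _); rewrite CS.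
  by apply: eq_bigr => j _; rewrite CZ.
have dv : is_der (ext_mx 0 (Cmx v)).
  have -> : Cmx v = (-1) *: der_proj A + A by rewrite scaleN1r Ev opprB subrK.
  rewrite ext_mx_lin -(derE dX); apply: is_der_lin => //; exact: der_proj_der.
rewrite Ev (cross_not_der dv) [Cmx 0](_ : _ = 0) ?subr0; first exact/esym/derE.
by have := Cmx_lin (-1) 0 0; rewrite scaler0 addr0 scaleN1r addNr.
Qed.

(** A trace over the Lie algebra may be taken over all 7 x 7 matrices, once
these are projected to derivations. *)
Lemma trace_der_proj (f : 'M[R]_8 -> 'M[R]_8) :
  (forall c X Y, f (c *: X + Y) = c *: f X + f Y) ->
  (forall X, is_der X -> is_der (f X)) ->
  \sum_(i < \dim (lieG R)) coord (vbasis (lieG R)) i (f (vbasis (lieG R))`_i) =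
  \sum_i \sum_j im_mx (f (ext_mx 0 (inner_der i j))) i j.
Proof.
move=> fL fD; set b := vbasis (lieG R).
have f0 : f 0 = 0 by have := fL (-1) 0 0; rewrite scaler0 addr0 scaleN1r addNr.
pose F (kl : 'I_7 * 'I_7) := f (ext_mx 0 (inner_der kl.1 kl.2)).
have FG kl : F kl \in lieG R by apply/mem_lieG/fD; exact: inner_der_der.
have bG (i : 'I_(\dim (lieG R))) : is_der b`_i by apply/mem_lieG/vbasis_mem/mem_nth; rewrite size_tuple.
have fb (i : 'I_(\dim (lieG R))) : f b`_i = \sum_(kl : 'I_7 * 'I_7) im_mx b`_i kl.1 kl.2 *: F kl.
  rewrite -{1}(der_proj_id (bG i)) /der_proj pair_big /=.
  elim: (index_enum _) => [|kl r IH]; first by rewrite !big_nil ext_mx0 f0.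
  by rewrite !big_cons ext_mx_lin fL IH.
transitivity (\sum_(i < \dim (lieG R)) \sum_(kl : 'I_7 * 'I_7) im_mx b`_i kl.1 kl.2 * coord b i (F kl)).
  apply: eq_bigr => i _; rewrite fb linear_sum; apply: eq_bigr => kl _.
  by rewrite linearZ.
rewrite [RHS]pair_big exchange_big /=; apply: eq_bigr => kl _.
rewrite [X in im_mx X](coord_vbasis (FG kl)) -/b.
have IS (r : seq 'I_(\dim (lieG R))) (c : 'I_(\dim (lieG R)) -> R) :
    im_mx (\sum_(i <- r) c i *: b`_i) = \sum_(i <- r) c i *: im_mx b`_i.
  by elim: r => [|i r IH]; rewrite ?big_nil ?im_mx0// !big_cons im_mx_lin IH.
rewrite IS summxE; apply: eq_bigr => i _.
by rewrite !mxE mulrC.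
Qed.

Lemma mul_delta (M N : 'M[R]_7) (a b i j : 'I_7) :
  (M *m delta_mx a b *m N) i j = M i a * N b j.
Proof.
rewrite mxE (bigD1 b)//= big1 ?addr0 => [|l lb].
  rewrite mxE (bigD1 a)//= big1 ?addr0 => [|l la].
    by rewrite mxE !eqxx mulr1.
  by rewrite mxE (negbTE la) mulr0.
rewrite mxE big1 ?mul0r// => k _.
by rewrite mxE (negbTE lb) andbF mulr0.
Qed.

Lemma der_Cmx (X : 'M[R]_8) v : is_der X ->
  im_mx X *m Cmx v - Cmx v *m im_mx X = Cmx (im_mx X *m v).
Proof.
move=> dX; apply: mulmx_ext => x; rewrite mulmxBl -!mulmxA !CmxE der_cross//.
by rewrite addrK.
Qed.

(** The identity [cross_cross] summed over the basis. *)
Lemma sum_Cmx2 : \sum_j eps j *: (Cmx (mb j) *m Cmx (mb j)) = - 6%:M.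
Proof.
apply: mulmx_ext => x; rewrite mulmx_suml mulNmx mul_scalar_mx.
under eq_bigr do rewrite -scalemxAl -mulmxA !CmxE cross_cross scalerBr !scalerA.
rewrite sumrB.
have -> : \sum_i (eps i * dot (mb i) x) *: mb i = x.
  by rewrite [RHS]imo_sum; apply: eq_bigr => i _; rewrite dot_mbl mulrA eps2 mul1r.
have -> : \sum_i (eps i * dot (mb i) (mb i)) *: x = 7 *: x.
  under eq_bigr do rewrite dot_mbl mulrA eps2 mul1r /mbasis mxE !eqxx scale1r.
  by rewrite sumr_const card_ord scaler_nat.
by rewrite -{1}[x]scale1r -scalerBl -scaleNr; congr (_ *: _); ring.
Qed.

Lemma im_mxM_der (X Y : 'M[R]_8) : is_der X -> is_der Y ->
  im_mx (X *m Y) = im_mx X *m im_mx Y.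
Proof.
move=> dX dY; apply: mulmx_ext => x.
by rewrite im_mxE -!mulmxA !der_oct// octK.
Qed.

Lemma bracket_der (X Y : 'M[R]_8) : is_der X -> is_der Y -> is_der (bracket X Y).
Proof.
move=> dX dY x y; rewrite /bracket !mulmxBl -!mulmxA dY dX !mulmxDr !dX !dY.
have omulDl (a b c : octo R) : omul (a + b) c = omul a c + omul b c.
  by have := omul_linl 1 a b c; rewrite !scale1r.
have omulDr (a b c : octo R) : omul c (a + b) = omul c a + omul c b.
  by have := omul_linr 1 a b c; rewrite !scale1r.
have omulNl (a c : octo R) : omul (- a) c = - omul a c.
  have := omul_linl (-1) a 0 c; rewrite !scaleN1r !addr0 => ->.
  by have := omul_linl (-1) 0 0 c; rewrite scaler0 addr0 scaleN1r addNr => ->; rewrite addr0.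
have omulNr (a c : octo R) : omul c (- a) = - omul c a.
  have := omul_linr (-1) a 0 c; rewrite !scaleN1r !addr0 => ->.
  by have := omul_linr (-1) 0 0 c; rewrite scaler0 addr0 scaleN1r addNr => ->; rewrite addr0.
rewrite omulDl omulDr omulNl omulNr.
move: (omul (X *m (Y *m x)) y) (omul (X *m x) (Y *m y)) (omul (Y *m x) (X *m y))
  (omul x (X *m (Y *m y))) (omul (Y *m (X *m x)) y) (omul x (Y *m (X *m y))) => a b c d e f.
apply/matrixP => i j; rewrite !mxE; ring.
Qed.

Lemma bracket_linr (X U V : 'M[R]_8) c : bracket X (c *: U + V) = c *: bracket X U + bracket X V.
Proof.
by rewrite /bracket mulmxDr mulmxDl -scalemxAl -scalemxAr scalerBr opprD addrACA.
Qed.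

Lemma tr_der (X : 'M[R]_8) : is_der X -> \tr (im_mx X) = 0.
Proof.
move=> dX; rewrite /mxtrace big1// => i _.
have := der_skew i i dX; rewrite eps2 mulN1r => /eqP.
rewrite -addr_eq0 -mulr2n -mulr_natl mulf_eq0 pnatr_eq0 /=.
by move/eqP.
Qed.

(** The adjoint trace over [so(3,4)] is five times the trace form of the vector
representation. As a module over the derivations, [so(3,4)] is their sum with
the seven-dimensional representation of the cross products, whose share is one
trace form. *)
Lemma killing_trace (X Y : 'M[R]_8) : is_der X -> is_der Y ->
  killing X Y = 4 * \tr (im_mx X *m im_mx Y).
Proof.
move=> dX dY; rewrite /killing (trace_der_proj (f := fun Z => bracket X (bracket Y Z))).
- set A := im_mx X; set B := im_mx Y.
  pose g (N : 'M[R]_7) := A *m B *m N *m 1%:M - A *m N *m B - B *m N *m A + 1%:M *m N *m (B *m A).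
  have gE i j : im_mx (bracket X (bracket Y (ext_mx 0 (inner_der i j)))) = g (inner_der i j).
    have dD := inner_der_der i j.
    have IB (U V : 'M[R]_8) : is_der U -> is_der V ->
        im_mx (bracket U V) = im_mx U *m im_mx V - im_mx V *m im_mx U.
      move=> dU dV; rewrite -!im_mxM_der// /bracket.
      by apply/matrixP => a b; rewrite !mxE.
    rewrite !IB ?im_ext_mx//; last exact: bracket_der.
    rewrite /g mulmx1 mul1mx mulmxBr mulmxBl !mulmxA -/A -/B opprB.
    by apply/matrixP => k l; rewrite !mxE; ring.
  under eq_bigr do under eq_bigr do rewrite gE.
  have gL c (M N : 'M[R]_7) : g (c *: M + N) = c *: g M + g N.
    rewrite /g !mulmxDr !mulmxDl -!scalemxAr -!scalemxAl.
    rewrite [in RHS]scalerDr ![in RHS]scalerBr.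
    move: (A *m B *m M *m 1%:M) (A *m B *m N *m 1%:M) (A *m M *m B) (A *m N *m B)
      (B *m M *m A) (B *m N *m A) (1%:M *m M *m (B *m A)) (1%:M *m N *m (B *m A)).
    move=> a b d e h k l m; apply/matrixP => i j; rewrite !mxE; ring.
  have gC v : g (Cmx v) = Cmx (A *m (B *m v)).
    rewrite -(der_Cmx _ dX) -(der_Cmx _ dY) /g mulmx1 mul1mx -/A -/B.
    rewrite mulmxBr mulmxBl !mulmxA opprB.
    by apply/matrixP => k l; rewrite !mxE; ring.
  have gD i j : g (delta_mx i j) i j = (A *m B) i i + (B *m A) j j
      - A i i * B j j - B i i * A j j.
    have addE (M N : 'M[R]_7) : (M + N) i j = M i j + N i j by rewrite mxE.
    have oppE (M : 'M[R]_7) : (- M) i j = - M i j by rewrite mxE.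
    have one k : (1%:M : 'M[R]_7) k k = 1 by rewrite mxE eqxx.
    by rewrite /g !(addE, oppE) !mul_delta !one; ring.
  have gT i j : (eps i * eps j) * g (delta_mx j i) i j =
      (i == j)%:R * (A *m B) i j + 2 * (A i j * B j i) + (i == j)%:R * (B *m A) i j.
    have addE (M N : 'M[R]_7) : (M + N) i j = M i j + N i j by rewrite mxE.
    have oppE (M : 'M[R]_7) : (- M) i j = - M i j by rewrite mxE.
    have one : (1%:M : 'M[R]_7) i j = (i == j)%:R by rewrite mxE.
    have e1 : eps i * eps j * (i == j)%:R = (i == j)%:R.
      by have [->|_] := eqVneq i j; rewrite ?eps2 ?mulr1 ?mulr0.
    have hB : eps i * eps j * B i j = - B j i.
      by rewrite (der_skew j i dY) -/B mulNr opprK [eps j * _]mulrC.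
    rewrite /g !(addE, oppE) !mul_delta !one.
    move: (A *m B) (B *m A) => P Q.
    transitivity ((eps i * eps j * (i == j)%:R) * P i j
      - 2 * (A i j * (eps i * eps j * B i j)) + (eps i * eps j * (i == j)%:R) * Q i j).
      by ring.
    by rewrite e1 hB; ring.
  have C3 i j : Cmx (A *m (B *m cross (mb j) (mb i))) i j =
      - (Cmx (mb j) *m (A *m B *m Cmx (mb j))) i i.
    have -> : Cmx (A *m (B *m cross (mb j) (mb i))) i j =
        cross (A *m (B *m cross (mb j) (mb i))) (mb j) i 0 by rewrite mxE.
    rewrite crossN -CmxE -CmxE !mulmxA; move: (Cmx _ *m A *m B *m Cmx _) => M.
    by rewrite mxE -colE mxE.
  set t := \tr (A *m B).
  have tBA : \tr (B *m A) = t by rewrite mxtrace_mulC.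
  have sum_const (c : R) : \sum_(i < 7) c = 7 * c by rewrite sumr_const card_ord mulr_natl.
  have delta_tr (M : 'M[R]_7) : \sum_i \sum_j (i == j)%:R * M i j = \tr M.
    apply: eq_bigr => i _; rewrite (bigD1 i)//= eqxx mul1r big1 ?addr0// => j ji.
    by rewrite eq_sym (negbTE ji) mul0r.
  have s1 : \sum_i \sum_j g (delta_mx i j) i j = 14 * t.
    under eq_bigr => i _ do under eq_bigr => j _ do rewrite gD.
    under eq_bigr => i _ do rewrite !big_split /= !sumrN -!mulr_sumr.
    rewrite !big_split /= !sumrN -!mulr_suml.
    under eq_bigr => i _ do rewrite sum_const.
    rewrite -mulr_sumr sum_const -/(\tr (A *m B)) -/(\tr (B *m A)) tBA -/t.
    rewrite -/(\tr A) -/(\tr B) (tr_der dX) (tr_der dY); ring.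
  have s2 : \sum_i \sum_j (eps i * eps j) * g (delta_mx j i) i j = 4 * t.
    under eq_bigr => i _ do under eq_bigr => j _ do rewrite gT.
    under eq_bigr => i _ do rewrite !big_split /= -mulr_sumr.
    rewrite !big_split /= -mulr_sumr !delta_tr tBA -/t.
    have -> : \sum_i \sum_j A i j * B j i = t by apply: eq_bigr => i _; rewrite mxE.
    ring.
  have s3 : \sum_i \sum_j eps j * Cmx (A *m (B *m cross (mb j) (mb i))) i j = 6 * t.
    rewrite exchange_big /=.
    transitivity (\sum_j - \tr (A *m B *m (eps j *: (Cmx (mb j) *m Cmx (mb j))))).
      apply: eq_bigr => j _; under eq_bigr => i _ do rewrite C3.
      rewrite -mulr_sumr sumrN -scalemxAr mxtraceZ mulrN; congr (- (_ * _)).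
      by rewrite -/(\tr _) mxtrace_mulC !mulmxA.
    rewrite sumrN -linear_sum -mulmx_sumr sum_Cmx2 mulmxN mul_mx_scalar.
    by rewrite linearN opprK; exact: mxtraceZ.
  transitivity (2^-1 * (14 * t - 4 * t) - 6^-1 * (6 * t)); last by field.
  rewrite -s1 -s2 -s3 -sumrB !mulr_sumr -sumrB; apply: eq_bigr => i _.
  rewrite -sumrB !mulr_sumr -sumrB; apply: eq_bigr => j _.
  have gZ c M : g (c *: M) = c *: g M.
    have g0 : g 0 = 0 by rewrite /g !(mulmx0, mul0mx) !subr0 addr0.
    by have := gL c M 0; rewrite g0 !addr0.
  have -> : inner_der i j = (- (eps j / 6)) *: Cmx (cross (mb j) (mb i)) +
      2^-1 *: ((- (eps i * eps j)) *: delta_mx j i + delta_mx i j).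
    by rewrite inner_derE [RHS]addrC scaleNr [_ + delta_mx i j]addrC scaleNr.
  rewrite gL gC gZ gL.
  have addE (M N : 'M[R]_7) : (M + N) i j = M i j + N i j by rewrite mxE.
  have scE c (M : 'M[R]_7) : (c *: M) i j = c * M i j by rewrite mxE.
  rewrite !(addE, scE); ring.
- by move=> c U V; rewrite !bracket_linr.
- by move=> Z dZ; do 2?apply: bracket_der.
Qed.

End Killing.

(** * Isotropy groups and the induced metrics *)

Section Groups.
Variable R : realType.
Local Notation V7 := (imo R).
Local Notation mb := (@mbasis R).
Local Notation G := (G2 R).

Lemma G2P (g : G) : oct_aut (G2mx g). Proof. exact: proj2_sig. Qed.

Lemma G2unit (g : G) : G2mx g \in unitmx. Proof. by case: (G2P g). Qed.

Lemma G2_eq (g g' : G) : G2mx g = G2mx g' -> g = g'.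
Proof.
case: g g' => [g pg] [g' pg'] /= E; subst g'; congr exist; exact: Prop_irrelevance.
Qed.

Lemma aut1 : oct_aut (1%:M : 'M[R]_8).
Proof. by split=> [|x y]; rewrite ?unitmx1// !mul1mx. Qed.

Lemma autM (g g' : 'M[R]_8) : oct_aut g -> oct_aut g' -> oct_aut (g *m g').
Proof.
move=> [ug gM] [ug' gM']; split=> [|x y]; first by rewrite unitmx_mul ug.
by rewrite -!mulmxA gM' gM.
Qed.

Lemma autV (g : 'M[R]_8) : oct_aut g -> oct_aut (invmx g).
Proof.
move=> [ug gM]; split=> [|x y]; first by rewrite unitmx_inv.
have gK (z : octo R) : z = g *m (invmx g *m z) by rewrite mulmxA mulmxV// mul1mx.
by rewrite {1}(gK x) {1}(gK y) -gM mulmxA mulVmx// mul1mx.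
Qed.

Definition G2one : G := exist _ _ aut1.
Definition G2mul (g g' : G) : G := exist _ _ (autM (G2P g) (G2P g')).
Definition G2inv (g : G) : G := exist _ _ (autV (G2P g)).

Definition J7 : 'M[R]_7 := diag_mx (\row_i eps R i).

Lemma J7E (x y : V7) : dot x y = (x^T *m (J7 *m y)) 0 0.
Proof.
rewrite dot_sum mxE; apply: eq_bigr => i _.
by rewrite mul_diag_mx !mxE [eps R i * _]mulrC mulrA.
Qed.

Lemma J7J7 : J7 *m J7 = 1%:M.
Proof.
apply/matrixP => i j; rewrite mul_diag_mx !mxE.
by case: (i == j); rewrite ?mulr1n ?mulr0n ?mulr0 // eps2.
Qed.

Lemma ext_mxM a A b B : ext_mx a A *m ext_mx b B = ext_mx (a * b) (A *m B) :> 'M[R]_8.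
Proof. by apply: oct_ext => c x; rewrite -mulmxA !ext_mxE !mulrA mulmxA. Qed.

Lemma ext_mx1 : ext_mx 1 1%:M = 1%:M :> 'M[R]_8.
Proof. by apply: oct_ext => c x; rewrite ext_mxE !mul1mx mul1r. Qed.

Lemma ext_mx_tr a A : (ext_mx a A)^T = ext_mx a A^T :> 'M[R]_8.
Proof. by rewrite /ext_mx (@tr_block_mx R 1 7 1 7) !trmx0 tr_scalar_mx. Qed.

Definition J8 : 'M[R]_8 := ext_mx 1 J7.

(** The isometry property of [aut_dot] as a matrix identity. *)
Lemma aut_ortho (g : 'M[R]_8) : oct_aut g -> (im_mx g)^T *m J7 *m im_mx g = J7.
Proof.
move=> gA; have H (x y : V7) : (x^T *m ((im_mx g)^T *m J7 *m im_mx g *m y)) 0 0 = (x^T *m (J7 *m y)) 0 0.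
  by rewrite -J7E -(aut_dot x y gA) J7E trmx_mul !mulmxA.
apply/matrixP => i j; have := H (mb i) (mb j).
by rewrite /mbasis trmx_delta -!colE -!rowE !mxE.
Qed.

(** Smoothness of an inverse follows, its entries being linear in those of the
automorphism. *)
Lemma aut_inv (g : 'M[R]_8) : oct_aut g -> invmx g = J8 *m g^T *m J8.
Proof.
move=> gA; have ug := gA.1.
suff H : J8 *m g^T *m J8 *m g = 1%:M.
  by rewrite -[LHS]mul1mx -H mulmxK.
rewrite (autE gA) ext_mx_tr !ext_mxM !mul1r -!mulmxA.
by rewrite [_^T *m _]mulmxA aut_ortho// J7J7 ext_mx1.
Qed.

Lemma im_mx_aut (g g' : 'M[R]_8) : oct_aut g -> oct_aut g' ->
  im_mx (g *m g') = im_mx g *m im_mx g'.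
Proof.
move=> gA gA'; apply: mulmx_ext => x.
by rewrite im_mxE -!mulmxA !aut_oct// octK.
Qed.

Lemma im_mx1 : im_mx (1%:M : 'M[R]_8) = 1%:M.
Proof. by rewrite -ext_mx1 im_ext_mx. Qed.

Lemma im_mx_autV (g : 'M[R]_8) : oct_aut g -> im_mx (invmx g) = invmx (im_mx g).
Proof.
move=> gA; have H : im_mx (invmx g) *m im_mx g = 1%:M.
  by rewrite -im_mx_aut ?mulVmx ?im_mx1//; [exact: gA.1|exact: autV].
have ug := mulmx1_unit H; by rewrite -[RHS]mul1mx -H mulmxK// ug.2.
Qed.

Lemma im_mx_unit (g : 'M[R]_8) : oct_aut g -> im_mx g \in unitmx.
Proof.
move=> gA; have H : im_mx (invmx g) *m im_mx g = 1%:M.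
  by rewrite -im_mx_aut ?mulVmx ?im_mx1//; [exact: gA.1|exact: autV].
by case: (mulmx1_unit H).
Qed.

Lemma conj_der (g X : 'M[R]_8) : oct_aut g -> is_der X -> is_der (invmx g *m X *m g).
Proof.
move=> gA dX x y; have [ug gM] := gA; have [_ gM'] := autV gA.
by rewrite -!mulmxA gM dX mulmxDr !gM' !mulmxA mulVmx// !mul1mx.
Qed.

Lemma mem_actV (g : G) (U : {vspace V7}) v :
  reflect (exists2 u, u \in U & v = actv g u) (v \in actV g U).
Proof.
apply: (iffP memv_imgP) => -[u uU ->]; exists u => //; by rewrite lfunE.
Qed.

Lemma mem_mspan (s : seq 'I_7) (v : V7) :
  v \in mspan R s <-> forall i, i \notin s -> v i 0 = 0.
Proof.
split=> [vs i is_|H].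
  have : forall t : seq 'I_7, {subset t <= s} ->
      forall w : V7, w \in mspan R t -> w i 0 = 0.
    elim=> [|j t IH] ts w; first by rewrite /mspan span_nil memv0 => /eqP ->; rewrite mxE.
    rewrite /mspan /= span_cons => /memv_addP[a /vlineP[c ->] [b bt ->]].
    rewrite !mxE (IH _ b)//; last by move=> l lt; apply: ts; rewrite inE lt orbT.
    have ij : i != j by apply: contra is_ => /eqP ->; apply: ts; rewrite mem_head.
    by rewrite /mbasis (negbTE ij) mulr0 addr0.
  by move/(_ s (fun _ => id)); exact.
rewrite (imo_sum v); apply: memv_suml => i _.
have [is_|/H ->] := boolP (i \in s); last by rewrite scale0r mem0v.
by apply/memvZ/memv_span; apply/mapP; exists i.
Qed.

Lemma mem_ImH (v : V7) : v \in ImH R <-> forall i : 'I_7, (3 <= i)%N -> v i 0 = 0.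
Proof.
rewrite mem_mspan; split => H i Hi; apply: H.
  by apply/negP; rewrite !inE => /or3P[] /eqP E; move: Hi; rewrite E.
by move: Hi; elim/ord7_ind: i.
Qed.

Lemma lieT_sub_lieK : (lieT R <= lieK R)%VS.
Proof.
apply/subvP => X /mem_lieT[dX xX sP _ _]; apply/mem_lieK; split => // v.
have -> : ImH R = (<[mb 0%R]> + mspan R [:: 1; 2%:R])%VS by rewrite /ImH /mspan /= span_cons.
case/memv_addP => a /vlineP[c ->] [b bP ->].
by rewrite mulmxDr -scalemxAr xX scaler0 add0r; apply: (subvP (addvSr _ _)); exact: sP.
Qed.

(** A matrix in the isotropy algebra of the quaternions is block diagonal, hence
skew for the Euclidean metric too, and the trace of its square is minus the sum of
the squares of its entries. Definiteness makes the orthogonal splittings exist. *)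
Lemma lieK_neg (X : 'M[R]_8) : X \in lieK R -> killing X X = 0 -> X = 0.
Proof.
move=> /mem_lieK[dX sX]; rewrite killing_trace//; set A := im_mx X => tA.
have E a b : (A *m mb b) a 0 = A a b by rewrite /mbasis -colE mxE.
have A0 (i j : 'I_7) : (3 <= i)%N -> (j < 3)%N -> A i j = 0.
  move=> i3 j3; rewrite -E; apply: (mem_ImH _).1 i3; apply: sX; apply/mem_ImH => k k3.
  rewrite /mbasis mxE; have [kj|//] := eqVneq k j.
  by move: k3; rewrite kj leqNgt j3.
have A0' (i j : 'I_7) : (3 <= i)%N -> (j < 3)%N -> A j i = 0.
  by move=> i3 j3; rewrite (der_skew j i dX) -/A A0// mulr0.
have skew i j : A i j = - A j i.
  rewrite (der_skew i j dX) -/A /eps; case: ltnP => i3; case: ltnP => j3.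
  - by rewrite mulr1 mulN1r.
  - by rewrite (A0 j i)// mulr0 oppr0.
  - by rewrite A0' // mulr0 oppr0.
  - by rewrite mulrNN mulr1 mulN1r.
have : \sum_i \sum_j A i j ^+ 2 = 0.
  apply/eqP; rewrite -oppr_eq0 -sumrN; apply/eqP.
  have : \tr (A *m A) = 0 by move/eqP: tA; rewrite mulf_eq0 pnatr_eq0 /= => /eqP.
  move=> tAA; transitivity (\tr (A *m A)) => //.
  apply: eq_bigr => i _; rewrite mxE -sumrN; apply: eq_bigr => j _.
  by rewrite (skew j i) mulrN.
move/eqP; rewrite psumr_eq0 => [/allP H|i _]; last by apply: sumr_ge0 => j _; rewrite sqr_ge0.
suff A00 : A = 0 by rewrite (derE dX) -/A A00 ext_mx0.
apply/matrixP => i j; rewrite [RHS]mxE.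
have := H i (mem_index_enum _) => /=; rewrite psumr_eq0 => [/allP H'|k _]; last exact: sqr_ge0.
by have := H' j (mem_index_enum _) => /=; rewrite sqrf_eq0 => /eqP.
Qed.

Lemma killingC (X Y : 'M[R]_8) : is_der X -> is_der Y -> killing X Y = killing Y X.
Proof. by move=> dX dY; rewrite !killing_trace// mxtrace_mulC. Qed.

Lemma killing_ad (X Y Z : 'M[R]_8) : is_der X -> is_der Y -> is_der Z ->
  killing (bracket X Y) Z = killing X (bracket Y Z).
Proof.
move=> dX dY dZ; have dXY := bracket_der dX dY; have dYZ := bracket_der dY dZ.
have IB (U W : 'M[R]_8) : is_der U -> is_der W ->
    im_mx (bracket U W) = im_mx U *m im_mx W - im_mx W *m im_mx U.
  move=> dU dW; rewrite -!im_mxM_der// /bracket.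
  by apply/matrixP => a b; rewrite !mxE.
rewrite !killing_trace// !IB// mulmxBl mulmxBr !linearB /=; congr (_ * (_ - _)).
  by rewrite mulmxA.
by rewrite -mulmxA mxtrace_mulC -mulmxA.
Qed.

Lemma killing_conj (g X Y : 'M[R]_8) : oct_aut g -> is_der X -> is_der Y ->
  killing (invmx g *m X *m g) (invmx g *m Y *m g) = killing X Y.
Proof.
move=> gA dX dY; rewrite !killing_trace//; try exact: conj_der.
congr (_ * _); have ug := im_mx_unit gA.
have E (U : 'M[R]_8) : is_der U -> im_mx (invmx g *m U *m g) =
    invmx (im_mx g) *m im_mx U *m im_mx g.
  move=> dU; apply: mulmx_ext => x.
  rewrite im_mxE -!mulmxA aut_oct// der_oct// aut_oct ?octK ?im_mx_autV//; exact: autV.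
rewrite !E// -!mulmxA [im_mx g *m (invmx _ *m _)]mulmxA mulmxV// mul1mx.
by rewrite mxtrace_mulC -!mulmxA mulmxV// mulmx1.
Qed.

(** What the variational argument uses of an isotropy group [H] and its Lie
algebra [h]. *)
Record isotropy (H : set G) (h : {vspace 'M[R]_8}) : Prop := Isotropy {
  iso_sub : (h <= lieK R)%VS;
  iso_one : H G2one;
  iso_mul : forall k k', H k -> H k' -> H (G2mul k k');
  iso_inv : forall k, H k -> H (G2inv k);
  iso_Ad : forall k X, H k -> X \in h -> invmx (G2mx k) *m X *m G2mx k \in h;
  iso_vel : forall (V : normedModType R) (U : set V) (k : V -> G) (p v : V),
    open U -> U p -> (forall x, U x -> H (k x)) -> mxder (fun x => G2mx (k x)) p v ->
    invmx (G2mx (k p)) *m mxD v (fun x => G2mx (k x)) p \in h }.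

Lemma actvM (g g' : G) v : actv (G2mul g g') v = actv g (actv g' v).
Proof. by rewrite /actv im_mx_aut ?mulmxA//; exact: G2P. Qed.

Lemma actv1 v : actv G2one v = v.
Proof. by rewrite /actv im_mx1 mul1mx. Qed.

Lemma actvK (g : G) v : actv (G2inv g) (actv g v) = v.
Proof.
rewrite -actvM; have -> : G2mul (G2inv g) g = G2one; last exact: actv1.
by apply: G2_eq; rewrite /= mulVmx// G2unit.
Qed.

Lemma actVM (g g' : G) U : actV (G2mul g g') U = actV g (actV g' U).
Proof.
apply/vspaceP => v; apply/mem_actV/mem_actV => -[u uU ->].
  by exists (actv g' u); [apply/mem_actV; exists u|rewrite actvM].
by move/mem_actV: uU => [w wU ->]; exists w => //; rewrite actvM.
Qed.

Lemma actV1 U : actV G2one U = U.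
Proof.
apply/vspaceP => v; apply/mem_actV/idP => [[u uU ->]|vU]; first by rewrite actv1.
by exists v => //; rewrite actv1.
Qed.

Lemma actVK (g : G) U : actV (G2inv g) (actV g U) = U.
Proof.
rewrite -actVM; have -> : G2mul (G2inv g) g = G2one; last exact: actV1.
by apply: G2_eq; rewrite /= mulVmx// G2unit.
Qed.

Lemma mem_actVE (g : G) U v : (actv g v \in actV g U) = (v \in U).
Proof.
apply/mem_actV/idP => [[u uU /(congr1 (actv (G2inv g)))]|vU]; last by exists v.
by rewrite !actvK => ->.
Qed.

Lemma conj_stabilizes (k : G) X U : is_der X -> actV k U = U -> stabilizes X U ->
  stabilizes (invmx (G2mx k) *m X *m G2mx k) U.
Proof.
move=> dX kU sX v vU.
have -> : im_mx (invmx (G2mx k) *m X *m G2mx k) *m v = actv (G2inv k) (im_mx X *m actv k v).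
  rewrite [LHS]im_mxE -!mulmxA (aut_oct 0 v (G2P k)) (der_oct _ _ dX).
  by rewrite (aut_oct _ _ (autV (G2P k))) octK.
rewrite -(mem_actVE k) -actvM.
have -> : G2mul k (G2inv k) = G2one by apply: G2_eq; rewrite /= mulmxV// G2unit.
by rewrite actv1 kU sX// -kU mem_actVE.
Qed.

(** Left multiplications turn the octonion product into a matrix product, whose
derivative is known. *)
Definition lmulmx (x : octo R) : 'M[R]_8 := \matrix_(i, j) omul x (delta_mx j 0) i 0.

Lemma lmulmxE x y : omul x y = lmulmx x *m y.
Proof.
have f0 : omul x 0 = 0.
  by have := omul_linr (-1) 0 0 x; rewrite scaler0 addr0 scaleN1r addNr.
have fS (r : seq 'I_8) (F : 'I_8 -> R) :
    omul x (\sum_(i <- r) F i *: delta_mx i 0) = \sum_(i <- r) F i *: omul x (delta_mx i 0).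
  by elim: r => [|i r IH]; rewrite ?big_nil// !big_cons omul_linr IH.
have yE : y = \sum_i y i 0 *: delta_mx i 0.
  by rewrite {1}(matrix_sum_delta y); apply: eq_bigr => i _; rewrite big_ord1.
rewrite [in LHS]yE fS; apply/colP => i; rewrite mxE summxE.
by apply: eq_bigr => j _; rewrite !mxE mulrC.
Qed.

Lemma lmulmx_is_linear : linear lmulmx.
Proof.
move=> c x y; apply: mulmx_ext => z.
by rewrite mulmxDl -scalemxAl -!lmulmxE omul_linl.
Qed.
HB.instance Definition _ := GRing.isLinear.Build R _ _ _ lmulmx lmulmx_is_linear.

Lemma mxD_omul (V : normedModType R) (a b : V -> octo R) p v :
  mxder a p v -> mxder b p v ->
  mxD v (fun t => omul (a t) (b t)) p = omul (mxD v a p) (b p) + omul (a p) (mxD v b p).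
Proof.
move=> da db; under [X in mxD v X]eq_fun do rewrite lmulmxE.
have [dl Dl] := mxD_lin lmulmx da.
by rewrite (mxD_mul dl db).2 Dl !lmulmxE.
Qed.

(** Differentiate the multiplicativity of the curve. *)
Lemma vel_der (V : normedModType R) (k : V -> G) (p v : V) :
  mxder (fun x => G2mx (k x)) p v ->
  is_der (invmx (G2mx (k p)) *m mxD v (fun x => G2mx (k x)) p).
Proof.
move=> dk x y; set g := G2mx (k p); set X := mxD v _ p.
have [ug _] := G2P (k p); have [_ gM'] := autV (G2P (k p)).
have Dk (z : octo R) : mxder (fun t => G2mx (k t) *m z) p v /\
    mxD v (fun t => G2mx (k t) *m z) p = X *m z.
  have [dz Dz] := mxD_cst z p v; have [d1 D1] := mxD_mul dk dz.
  by split => //; rewrite D1 Dz mulmx0 addr0.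
suff H : X *m omul x y = omul (X *m x) (g *m y) + omul (g *m x) (X *m y).
  rewrite -mulmxA H mulmxDr !gM' !mulmxA !(mulVmx ug) !mul1mx//.
rewrite -(Dk (omul x y)).2.
have -> : (fun t => G2mx (k t) *m omul x y) = (fun t => omul (G2mx (k t) *m x) (G2mx (k t) *m y)).
  by apply/funext => t; exact: (G2P (k t)).2.
have [dx <-] := Dk x; have [dy <-] := Dk y; rewrite /g.
by rewrite mxD_omul.
Qed.

(** The image of a vector of the subspace is fixed by a projection onto the
subspace, and so is its derivative. *)
Lemma vel_stabilizes (V : normedModType R) (W : set V) (k : V -> G) (p v : V) U :
  open W -> W p -> (forall x, W x -> actV (k x) U = U) ->
  mxder (fun x => G2mx (k x)) p v ->
  stabilizes (invmx (G2mx (k p)) *m mxD v (fun x => G2mx (k x)) p) U.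
Proof.
move=> oW Wp kU dk u uU.
have [du Du] := mxD_cst (oct 0 u) p v.
have [d1 D1] := mxD_mul dk du; rewrite Du mulmx0 addr0 in D1.
have [d2 D2] := mxD_lin (@dsubmx R 1 7 1) d1.
have kin x : W x -> actv (k x) u \in U by move=> Wx; rewrite -(kU x Wx) mem_actVE.
have H : im_part (mxD v (fun x => G2mx (k x)) p *m oct 0 u) \in U.
  rewrite /im_part -D1 -D2.
  set c := (X in mxD v X p) in d2 D2 *.
  have cE x : c x = actv (k x) u by rewrite /actv im_mxE.
  have [d3 D3] := mxD_lin (projv U) d2.
  suff -> : mxD v c p = projv U (mxD v c p) by exact: memv_proj.
  rewrite -D3; apply: (open_eq_mxD v oW Wp) => x; rewrite inE => Wx /=.
  have cin : c x \in U by rewrite cE kin.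
  exact: (esym (projv_id cin)).
have -> : im_mx (invmx (G2mx (k p)) *m mxD v (fun x => G2mx (k x)) p) *m u =
    actv (G2inv (k p)) (im_part (mxD v (fun x => G2mx (k x)) p *m oct 0 u)).
  have dX := vel_der dk; set M := mxD v _ p in dX *.
  have ME : M *m oct 0 u = oct 0 (im_part (M *m oct 0 u)).
    rewrite [LHS]oct_eta; congr oct.
    have := der_oct 0 u dX; rewrite -mulmxA => /(congr1 (mulmx (G2mx (k p)))).
    rewrite mulmxA mulmxV ?G2unit// mul1mx (aut_oct _ _ (G2P (k p))) => ->.
    by rewrite oct0.
  by rewrite [LHS]im_mxE -mulmxA ME (aut_oct _ _ (autV (G2P (k p)))) !octK.
rewrite -(mem_actVE (k p)) -actvM.
have -> : G2mul (k p) (G2inv (k p)) = G2one by apply: G2_eq; rewrite /= mulmxV// G2unit.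
rewrite actv1 (_ : actV (k p) U = U) ?kU//.
Qed.

Lemma isotropyK : isotropy (@groupK R) (lieK R).
Proof.
split=> //.
- exact: actV1.
- by move=> k k' kK kK'; rewrite /groupK /= actVM kK' kK.
- by move=> k kK; rewrite /groupK /= -{1}kK actVK.
- move=> k X kK /mem_lieK[dX sX]; apply/mem_lieK; split.
    by apply: conj_der => //; exact: G2P.
  exact: conj_stabilizes.
- move=> V U k p v oU Up kK dk; apply/mem_lieK; split; first exact: vel_der.
  exact: (vel_stabilizes oU Up).
Qed.

Lemma groupTP (k : G) : groupT k <-> [/\ actv k (mb 0) = mb 0,
  actV k (mspan R [:: 1; 2%:R]) = mspan R [:: 1; 2%:R],
  actV k (mspan R [:: 3%:R; 4%:R]) = mspan R [:: 3%:R; 4%:R] &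
  actV k (mspan R [:: 5%:R; 6%:R]) = mspan R [:: 5%:R; 6%:R]].
Proof. by rewrite /groupT /=; split=> [[-> -> -> ->]|[-> -> -> ->]]. Qed.

Lemma isotropyT : isotropy (@groupT R) (lieT R).
Proof.
split.
- exact: lieT_sub_lieK.
- by apply/groupTP; rewrite !actV1 actv1.
- move=> k k' /groupTP[h1 h2 h3 h4] /groupTP[k1 k2 k3 k4]; apply/groupTP.
  by rewrite !actVM actvM k1 h1 k2 k3 k4 h2 h3 h4.
- move=> k /groupTP[h1 h2 h3 h4]; apply/groupTP; split.
  + by rewrite -{1}h1 actvK.
  + by rewrite -{1}h2 actVK.
  + by rewrite -{1}h3 actVK.
  + by rewrite -{1}h4 actVK.
- move=> k X /groupTP[h1 h2 h3 h4] /mem_lieT[dX X0 s1 s2 s3]; apply/mem_lieT.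
  split; try exact: conj_stabilizes; first by apply: conj_der => //; exact: G2P.
  rewrite [LHS]im_mxE -!mulmxA (aut_oct _ _ (G2P k)) (der_oct _ _ dX).
  rewrite -/(actv k _) h1 X0 (aut_oct _ _ (autV (G2P k))) octK.
  by rewrite mulmx0.
- move=> V U k p v oU Up kT dk; apply/mem_lieT.
  have h x : U x -> _ := fun Ux => (groupTP (k x)).1 (kT x Ux).
  split; first exact: vel_der.
  + have [dm Dm] := mxD_cst (oct 0 (mb 0)) p v.
    have [_ D1] := mxD_mul dk dm; rewrite Dm mulmx0 addr0 in D1.
    rewrite im_mxE -mulmxA -D1.
    rewrite (open_eq_mxD v oU Up (_ : {in U, _ =1 (fun _ => oct 0 (mb 0))})); last first.
      by move=> x; rewrite inE => /h[+ _ _ _]; rewrite (aut_oct _ _ (G2P (k x))) -/(actv _ _) => ->.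
    by rewrite Dm mulmx0; apply/colP => i; rewrite !mxE.
  + by apply: (vel_stabilizes oU Up) => // x /h[].
  + by apply: (vel_stabilizes oU Up) => // x /h[].
  + by apply: (vel_stabilizes oU Up) => // x /h[].
Qed.

(** ** Killing-orthogonal splitting *)

Section Splitting.
Variable h : {vspace 'M[R]_8}.
Hypothesis hK : (h <= lieK R)%VS.

Lemma split_der X : X \in h -> is_der X.
Proof. by move/(subvP hK)/mem_lieK => -[]. Qed.

Lemma split_cap : (orth h :&: h = 0)%VS.
Proof.
apply/eqP; rewrite -subv0; apply/subvP => X; rewrite memv_cap memv0.
move=> /andP[/mem_orth[_ Xh] hX]; apply/eqP/lieK_neg; first exact: (subvP hK).
exact: Xh.
Qed.

Lemma killing_sum (r : seq 'I_(\dim h)) (c : 'I_(\dim h) -> R) (F : 'I_(\dim h) -> 'M[R]_8) Y :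
  killing (\sum_(i <- r) c i *: F i) Y = \sum_(i <- r) c i * killing (F i) Y.
Proof.
have k0 : killing 0 Y = 0.
  by have := killing_linl (-1) 0 0 Y; rewrite scaler0 addr0 mulN1r addNr.
by elim: r => [|i r IH]; rewrite ?big_nil// !big_cons killing_linl IH.
Qed.

(** Definiteness on [h] makes the Gram matrix of a basis invertible. *)
Lemma split_exists X : X \in lieG R -> exists2 A, A \in h & X - A \in orth h.
Proof.
move=> XG; pose d := \dim h; set b := vbasis h.
have bh (i : 'I_d) : b`_i \in h by apply: vbasis_mem; rewrite mem_nth// size_tuple.
pose Gm : 'M[R]_d := \matrix_(i, j) killing b`_i b`_j.
pose y (v : 'rV[R]_d) := \sum_i v 0 i *: b`_i.
have yh v : y v \in h by apply: memv_suml => i _; rewrite memvZ.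
have yB v (j : 'I_d) : killing (y v) b`_j = (v *m Gm) 0 j.
  by rewrite killing_sum mxE; apply: eq_bigr => i _; rewrite mxE.
have uG : Gm \in unitmx.
  rewrite -row_free_unit -kermx_eq0; apply/rowV0P => v /sub_kermxP vG.
  have : y v = 0.
    apply: lieK_neg; first exact: (subvP hK).
    rewrite {2}/y killingC; [|exact: split_der|].
      rewrite killing_sum big1// => j _.
      by rewrite killingC ?yB ?vG ?mxE ?mulr0//; apply: split_der.
    by apply: split_der; exact: yh.
  move=> yv; have /freeP := basis_free (vbasisP h) => fr.
  by apply/rowP => i; rewrite mxE; apply: fr.
pose t : 'rV[R]_d := \row_j killing X b`_j.
exists (y (t *m invmx Gm)); first exact: yh.
apply/mem_orth; split=> [|Y hY].
  rewrite memvB//; apply/mem_lieG; exact: split_der.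
have kB (Z : 'M[R]_8) : is_der Z -> killing Z Y = \sum_j coord b j Y * killing Z b`_j.
  move=> dZ; rewrite [in LHS](coord_vbasis hY) killingC//; last first.
    by apply: split_der; apply: memv_suml => i _; rewrite memvZ.
  rewrite killing_sum; apply: eq_bigr => j _; congr (_ * _).
  by rewrite killingC//; exact: split_der.
have dX := (mem_lieG X).1 XG.
have -> : X - y (t *m invmx Gm) = (-1) *: y (t *m invmx Gm) + X by rewrite scaleN1r addrC.
rewrite killing_linl !kB//; last exact: split_der.
rewrite mulN1r; apply/eqP; rewrite addrC subr_eq0; apply/eqP.
by apply: eq_bigr => j _; rewrite yB mulmxKV// mxE.
Qed.

Definition proj_orth (X : 'M[R]_8) : 'M[R]_8 := daddv_pi (orth h) h X.

Lemma proj_orthP X : X \in lieG R -> proj_orth X \in orth h /\ X - proj_orth X \in h.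
Proof.
move=> /split_exists[A Ah XA]; split; first exact: memv_pi.
have XE : X \in (orth h + h)%VS.
  by apply/memv_addP; exists (X - A) => //; exists A => //; rewrite subrK.
have -> : X - proj_orth X = daddv_pi h (orth h) X.
  by rewrite -{1}(daddv_pi_add split_cap XE) addrC addKr.
exact: memv_pi.
Qed.

(** How all projections are computed below: a decomposition is enough. *)
Lemma proj_orth_uniq b A : b \in orth h -> A \in h -> proj_orth (b + A) = b.
Proof.
move=> bo Ah; rewrite /proj_orth linearD /= daddv_pi_id ?split_cap//.
suff -> : daddv_pi (orth h) h A = 0 by rewrite addr0.
have AE : A \in (orth h + h)%VS by rewrite (subvP (addvSr _ _)).
have := daddv_pi_add split_cap AE.
rewrite [daddv_pi h _ A]daddv_pi_id//; last by rewrite capvC split_cap.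
by move/(congr1 (fun Z => Z - A)); rewrite addrK subrr.
Qed.

Lemma orth_der X : X \in orth h -> is_der X.
Proof. by case/mem_orth => /mem_lieG. Qed.

Definition qform (X Y : 'M[R]_8) : R := killing (proj_orth X) (proj_orth Y).

Lemma qformE X Y : is_der X -> is_der Y -> qform X Y = killing X (proj_orth Y).
Proof.
move=> /mem_lieG XG /mem_lieG YG; have [Xo Xh] := proj_orthP XG.
have [Yo _] := proj_orthP YG.
have -> : X = 1 *: (X - proj_orth X) + proj_orth X by rewrite scale1r subrK.
rewrite killing_linl [killing (X - _) _]killingC; [|exact: split_der|exact: orth_der].
have /mem_orth[_ ->//] := Yo; rewrite mulr0 add0r /qform.
by rewrite addrC proj_orth_uniq// scale1r.
Qed.

Lemma qformC X Y : is_der X -> is_der Y -> qform X Y = qform Y X.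
Proof.
move=> /mem_lieG XG /mem_lieG YG; apply: killingC; apply: orth_der.
  exact: (proj_orthP XG).1.
exact: (proj_orthP YG).1.
Qed.

End Splitting.

(** The isotropy group acts on the Lie algebra by isometries of the Killing form
that preserve [h], hence also its orthogonal complement. *)
Lemma proj_orth_conj (H : set G) h k X : isotropy H h -> H k -> is_der X ->
  proj_orth h (invmx (G2mx k) *m X *m G2mx k) =
  invmx (G2mx k) *m proj_orth h X *m G2mx k.
Proof.
move=> iH Hk /mem_lieG XG; have hK := iso_sub iH.
have [Xo Xh] := proj_orthP hK XG.
have -> : invmx (G2mx k) *m X *m G2mx k = invmx (G2mx k) *m proj_orth h X *m G2mx k +
    invmx (G2mx k) *m (X - proj_orth h X) *m G2mx k.
  by rewrite -mulmxDl -mulmxDr addrC subrK.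
apply: proj_orth_uniq => //; last exact: (iso_Ad iH).
apply/mem_orth; split; first by apply/mem_lieG/conj_der; [exact: G2P|exact: orth_der Xo].
move=> Y hY; have dY := split_der hK hY.
have := iso_Ad iH (iso_inv iH Hk) hY => /= hY'.
have ik : invmx (invmx (G2mx k)) = G2mx k by rewrite invmxK.
rewrite ik in hY'.
have -> : Y = invmx (G2mx k) *m (G2mx k *m Y *m invmx (G2mx k)) *m G2mx k.
  by rewrite !mulmxA mulVmx ?G2unit// mul1mx -mulmxA mulVmx ?G2unit// mulmx1.
rewrite killing_conj; [|exact: G2P|exact: orth_der Xo|exact: split_der hY'].
by have /mem_orth[_ ->] := Xo.
Qed.

Lemma qform_conj (H : set G) h k X Y : isotropy H h -> H k -> is_der X -> is_der Y ->
  qform h (invmx (G2mx k) *m X *m G2mx k) (invmx (G2mx k) *m Y *m G2mx k) = qform h X Y.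
Proof.
move=> iH Hk dX dY; rewrite /qform !(proj_orth_conj iH)//.
have hK := iso_sub iH; apply: killing_conj; first exact: G2P.
  by apply: orth_der; exact: (proj_orthP hK ((mem_lieG X).2 dX)).1.
by apply: orth_der; exact: (proj_orthP hK ((mem_lieG Y).2 dY)).1.
Qed.

End Groups.

(** * Integrals over the square *)

Lemma cont_pair (T U W : topologicalType) (f : T -> U) (g : T -> W) :
  continuous f -> continuous g -> continuous (fun x => (f x, g x)).
Proof.
move=> cf cg x A [[B D] /= [nB nD] BD].
have nf : nbhs x (f @^-1` B) by exact: cf.
have ng : nbhs x (g @^-1` D) by exact: cg.
by apply: filterS (filterI nf ng) => y [By Dy]; exact: (BD (f y, g y)).
Qed.

Section Square.
Variable R : realType.
Local Notation leb := (@lebesgue_measure R).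
Local Notation leb2 := ((@lebesgue_measure R) \x (@lebesgue_measure R))%E.

Lemma open_measurable_plane (O : set (plane R)) : open O -> measurable O.
Proof.
move=> oO.
pose r (n : nat) : R := n.+1%:R^-1.
pose box (q1 q2 : rat) (n : nat) : set (plane R) :=
  ball (ratr q1 : R) (r n) `*` ball (ratr q2 : R) (r n).
pose F q1 q2 n := if `[< box q1 q2 n `<=` O >] then box q1 q2 n else set0.
have -> : O = \bigcup_(q1 in setT) \bigcup_(q2 in setT) \bigcup_(n in setT) F q1 q2 n.
  apply/seteqP; split => [p Op|p [q1 _ [q2 _ [n _]]]]; last first.
    by rewrite /F; case: asboolP => // sub; exact: sub.
  have /nbhs_ballP[e /= e0 sub] : nbhs p O by exact: open_nbhs_nbhs.
  have [n rn] : exists n, r n < e / 2.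
    have e2 : 0 < e / 2 by rewrite divr_gt0.
    exists (Num.truncn (e / 2)^-1); rewrite /r invf_plt ?posrE ?invr_gt0//.
    exact: Num.Theory.truncnS_gt.
  have rn0 : 0 < r n by rewrite invr_gt0.
  have rat_near (x : R) : exists q : rat, ball (ratr q : R) (r n) x.
    have /rat_in_itvoo[q] : x - r n < x + r n by rewrite ltrBlDr -addrA ltrDl addr_gt0.
    rewrite in_itv/= => /andP[h1 h2]; exists q.
    by rewrite -ball_normE /= ltr_distlC; apply/andP; split; lra.
  have [q1 h1] := rat_near p.1; have [q2 h2] := rat_near p.2.
  exists q1 => //; exists q2 => //; exists n => //; rewrite /F.
  case: asboolP => [_ //|]; case=> z [z1 z2]; apply: sub.
  have tri (q x y : R) : ball q (r n) x -> ball q (r n) y -> ball x e y.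
    rewrite -!ball_normE /= => hx hy.
    rewrite (_ : x - y = (q - y) - (q - x)); last by ring.
    by rewrite (le_lt_trans (ler_normB _ _))//; lra.
  by split; [exact: tri h1 z1|exact: tri h2 z2].
apply: bigcupT_measurable_rat => q1; apply: bigcupT_measurable_rat => q2.
apply: bigcupT_measurable => n; rewrite /F; case: asboolP => // _.
by apply: measurableX; exact: measurable_ball.
Qed.

Lemma cont_measurable_plane (f : plane R -> R) : continuous f -> measurable_fun setT f.
Proof.
move=> cf; apply: (measurability _ (RGenOInfty.measurableE R)).
move=> _ [_ [x ->] <-]; rewrite setTI; apply: open_measurable_plane.
move/continuousP : cf; apply.
by rewrite set_itvE; exact: open_gt.
Qed.

Lemma square_compact (M : R) : compact (square M).
Proof. by apply: compact_setX; exact: segment_compact. Qed.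

Lemma square_measurable (M : R) : measurable (square M).
Proof. by apply: measurableX. Qed.

Lemma square_fin (M : R) : (leb2 (square M) < +oo)%E.
Proof.
rewrite product_measure1E//= lebesgue_measure_itv/=.
by case: ifP => _; rewrite ?mul0e// -EFinB -EFinM ltry.
Qed.

Lemma cont_bounded_square (f : plane R -> R) M : continuous f ->
  [bounded f p | p in square M].
Proof.
move=> cf; have := @continuous_compact _ _ f (square M) (continuous_subspaceT cf) (@square_compact M).
move/compact_bounded => [N [Nr NM]]; exists N; split => // x Nx p sp.
by apply: (NM x Nx); exists p.
Qed.

Lemma cont_integrable_square (f : plane R -> R) M : continuous f ->
  leb2.-integrable (square M) (EFin \o f).
Proof.
move=> cf; apply: measurable_bounded_integrable.
- exact: square_measurable.
- exact: square_fin.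
- exact: measurable_funTS (cont_measurable_plane cf).
- exact: cont_bounded_square.
Qed.

Lemma integral_deriv0 (f : R -> R) (M : R) : (forall x, derivable f x 1) ->
  continuous ('D_1 f) -> (forall x, M < `|x| -> f x = 0) ->
  (\int[leb]_(x in [set` `[(- M)%R, M]]) ('D_1 f x)%:E = 0)%E.
Proof.
move=> df cdf f0; have cf : continuous f.
  by move=> x; apply: differentiable_continuous; apply/derivable1_diffP; exact: df.
have [M0|M0] := ltP 0 M; last first.
  have [->|Mn0] := eqVneq M 0; first by rewrite oppr0 set_itv1 integral_set1.
  rewrite set_itv_ge ?integral_set0// bnd_simp -ltNge.
  have Mlt : M < 0 by rewrite lt_neqAle Mn0.
  by rewrite (lt_trans Mlt)// oppr_gt0.
have edge (x : R) : `|x| = M -> f x = 0.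
  move=> xM; apply: contrapT => /eqP fx0.
  have fx0' : 0 < `|f x| by rewrite normr_gt0.
  have /nbhs_ballP[e /= e0 be] := cont_near (cf x) fx0'.
  pose y := x + (if 0 <= x then e / 2 else - (e / 2)).
  have yx : ball x e y.
    rewrite -ball_normE /= /y opprD addrA subrr add0r normrN.
    by case: ifP => _; rewrite ?normrN gtr0_norm; lra.
  have yM : M < `|y|.
    rewrite -xM /y; case: ifPn => [x0|]; last rewrite -ltNge => x0.
      by rewrite !ger0_norm//; lra.
    by rewrite !ltr0_norm//; lra.
  by have := be y yx; rewrite /= (f0 y yM) subr0 ltxx.
have MM : - M < M by lra.
have H := @continuous_FTC2 R ('D_1 f) f (- M) M MM.
rewrite H ?edge ?normrN ?gtr0_norm ?subee//.
- exact: continuous_subspaceT.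
- split => //.
  + by apply: cvg_at_right_filter; exact: cf.
  + by apply: cvg_at_left_filter; exact: cf.
- by move=> x _; rewrite derive1E.
Qed.

Lemma fubini_square0_1 (f : plane R -> R) M : continuous f ->
  (forall y, \int[leb]_(x in [set` `[(- M)%R, M]]) (f (x, y))%:E = 0)%E ->
  (\int[leb2]_(p in square M) (f p)%:E = 0)%E.
Proof.
move=> cf H; rewrite integral_mkcond.
have I : leb2.-integrable setT ((EFin \o f) \_ (square M)).
  by rewrite -integrable_mkcond; [exact: cont_integrable_square|exact: square_measurable].
rewrite -(integral21_prod_meas1 I) integral0_eq// => y _.
rewrite /fubini_G.
have [yM|yM] := pselect ([set` `[(- M)%R, M]] y).
  rewrite -[RHS](H y) [RHS]integral_mkcond; apply: eq_integral => x _.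
  rewrite !patchE; congr (if _ then _ else _).
  by apply/idP/idP; rewrite !inE /square /=; [case|split].
apply: integral0_eq => x _; rewrite patchE ifF//.
by apply/negP; rewrite inE => -[].
Qed.

Lemma fubini_square0_2 (f : plane R -> R) M : continuous f ->
  (forall x, \int[leb]_(y in [set` `[(- M)%R, M]]) (f (x, y))%:E = 0)%E ->
  (\int[leb2]_(p in square M) (f p)%:E = 0)%E.
Proof.
move=> cf H; rewrite integral_mkcond.
have I : leb2.-integrable setT ((EFin \o f) \_ (square M)).
  by rewrite -integrable_mkcond; [exact: cont_integrable_square|exact: square_measurable].
rewrite -(integral12_prod_meas1 I) integral0_eq// => x _.
rewrite /fubini_F.
have [xM|xM] := pselect ([set` `[(- M)%R, M]] x).
  rewrite -[RHS](H x) [RHS]integral_mkcond; apply: eq_integral => y _.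
  rewrite !patchE; congr (if _ then _ else _).
  by apply/idP/idP; rewrite !inE /square /=; [case|split].
apply: integral0_eq => y _; rewrite patchE ifF//.
by apply/negP; rewrite inE => -[].
Qed.

Lemma Ck_continuous (V : normedModType R) k (f : V -> R) : Ck setT k f -> continuous f.
Proof. by move=> cf x; exact: Ck_cont cf I. Qed.

Lemma square_off (M : R) p : M < `|p.1| \/ M < `|p.2| -> ~ square M p.
Proof.
move=> H [/=]; rewrite !in_itv/= -!ler_norml => h1 h2.
by case: H; rewrite ltNge ?h1 ?h2.
Qed.

Lemma integral_dx0 (W : plane R -> R) M : Ck setT 1 W ->
  (forall z, ~ square M z -> W z = 0) ->
  (\int[leb2]_(p in square M) ('D_(dirx R) W p)%:E = 0)%E.
Proof.
move=> cW W0; apply: fubini_square0_1.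
  exact: (Ck_continuous (Ck_D (dirx R) cW)).
move=> y; pose a (x : R) : plane R := (x, y).
have aA (h : R) (v x : R^o) : a (h *: v + x) = h *: (v, 0) + a x.
  by apply: injective_projections => //=; rewrite scaler0 add0r.
have E x : 'D_1 (W \o a : R^o -> R) x = 'D_(dirx R) W (x, y).
  exact: (@derive_affine _ R^o _ a (fun v => (v, 0)) W 1 x aA).
under eq_integral do rewrite -E.
apply: integral_deriv0.
- move=> x; apply: (@derivable_affine _ R^o _ a (fun v => (v, 0)) W 1 x aA).
  exact: Ck_der cW I.
- rewrite (_ : 'D_1 (W \o a) = 'D_(dirx R) W \o a); last by apply/funext => x; exact: E.
  move=> x; apply: continuous_comp; last exact: (Ck_continuous (Ck_D (dirx R) cW)).
  by move: x; apply: cont_pair => x; [exact: cvg_id|exact: cvg_cst].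
- by move=> x Mx /=; apply: W0; apply: square_off; left.
Qed.

Lemma integral_dy0 (W : plane R -> R) M : Ck setT 1 W ->
  (forall z, ~ square M z -> W z = 0) ->
  (\int[leb2]_(p in square M) ('D_(diry R) W p)%:E = 0)%E.
Proof.
move=> cW W0; apply: fubini_square0_2.
  exact: (Ck_continuous (Ck_D (diry R) cW)).
move=> x; pose a (y : R) : plane R := (x, y).
have aA (h : R) (v y : R^o) : a (h *: v + y) = h *: (0, v) + a y.
  by apply: injective_projections => //=; rewrite scaler0 add0r.
have E y : 'D_1 (W \o a : R^o -> R) y = 'D_(diry R) W (x, y).
  exact: (@derive_affine _ R^o _ a (fun v => (0, v)) W 1 y aA).
under eq_integral do rewrite -E.
apply: integral_deriv0.
- move=> y; apply: (@derivable_affine _ R^o _ a (fun v => (0, v)) W 1 y aA).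
  exact: Ck_der cW I.
- rewrite (_ : 'D_1 (W \o a) = 'D_(diry R) W \o a); last by apply/funext => y; exact: E.
  move=> y; apply: continuous_comp; last exact: (Ck_continuous (Ck_D (diry R) cW)).
  by move: y; apply: cont_pair => y; [exact: cvg_cst|exact: cvg_id].
- by move=> y My /=; apply: W0; apply: square_off; right.
Qed.

Definition dirt : R * plane R := (1, 0).

(** Differentiation under the integral sign turns the derivative of the energy into
the integral of a divergence with compact support. *)
Lemma square_variation (M : R) (E : R * plane R -> R) (V1 V2 : plane R -> R) :
  Ck setT 1 E -> Ck setT 1 V1 -> Ck setT 1 V2 ->
  (forall z, 'D_dirt E (0, z) = 2 * ('D_(dirx R) V1 z + 'D_(diry R) V2 z)) ->
  (forall z, ~ square M z -> V1 z = 0 /\ V2 z = 0) ->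
  is_derive (0 : R) (1 : R) (fun t : R => \int[leb2]_(p in square M) E (t, p) : R^o) (0 : R).
Proof.
move=> cE c1 c2 DE V0.
pose f (t : R) (p : plane R) := E (t, p).
have cD := Ck_continuous (Ck_D dirt cE).
pose a (p : plane R) (t : R) : R * plane R := (t, p).
have aA p (h : R) (v x : R^o) : a p (h *: v + x) = h *: (v, 0) + a p x.
  by apply: injective_projections => //=; rewrite scaler0 add0r.
have D1 t p : partial1of2 f t p = 'D_dirt E (t, p).
  rewrite /partial1of2 derive1E.
  exact: (@derive_affine _ R^o _ (a p) (fun v => (v, 0)) E 1 t (aA p)).
have [N [Nr NB]] : [bounded 'D_dirt E p | p in [set` `[-1, 1]] `*` square M].
  have cpt : compact ([set` `[-1, 1]] `*` square M : set (R * plane R)).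
    by apply: compact_setX; [exact: segment_compact|exact: square_compact].
  have := continuous_compact (continuous_subspaceT cD) cpt.
  move/compact_bounded => [N [Nr NM]]; exists N; split => // x Nx p sp.
  by apply: (NM x Nx); exists p.
have sl0 (t : R) : continuous (fun p => E (t, p)).
  move=> p; apply: (@continuous_comp _ _ _ (fun p => (t, p)) E); last exact: (Ck_continuous cE).
  by move: p; apply: cont_pair => p; [exact: cvg_cst|exact: cvg_id].
have I01 : (`]-1, 1[%classic : set R) 0 by rewrite /= in_itv/=; apply/andP; split; lra.
have int t : (`]-1, 1[%classic : set R) t -> leb2.-integrable (square M) (EFin \o f t).
  by move=> _; exact: (cont_integrable_square M (sl0 t)).
have der t p : (`]-1, 1[%classic : set R) t -> square M p -> derivable (f ^~ p) t 1.
  move=> _ _; apply: (@derivable_affine _ R^o _ (a p) (fun v => (v, 0)) E 1 t (aA p)).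
  exact: Ck_der cE I.
pose N1 : R := `|N| + 1.
have N10 (p : plane R) : 0 <= (fun _ : plane R => N1) p by rewrite addr_ge0.
have intN : leb2.-integrable (square M) (EFin \o (fun _ : plane R => N1)).
  by apply: cont_integrable_square => x; exact: cvg_cst.
have bd t p : (`]-1, 1[%classic : set R) t -> square M p -> `|partial1of2 f t p| <= N1.
  move=> t1 sp; rewrite D1; apply: (NB N1); first by rewrite /N1 (le_lt_trans (ler_norm N))// ltrDl.
  by split => //=; move: t1; rewrite /= !in_itv/= => /andP[/ltW -> /ltW ->].
have dF := @derivable_under_integral R _ _ leb2 f (square M) (square_measurable M) 0 (-1) 1
  I01 int der (fun=> N1) N10 intN bd.
have eF := @differentiation_under_integral R _ _ leb2 f (square M) (square_measurable M) 0 (-1) 1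
  I01 int der (fun=> N1) N10 intN bd.
apply: DeriveDef; first exact: dF.
rewrite -derive1E eF.
under eq_Rintegral => p _ do rewrite D1 DE.
have cx := Ck_continuous (Ck_D (dirx R) c1); have cy := Ck_continuous (Ck_D (diry R) c2).
have ix := cont_integrable_square M cx; have iy := cont_integrable_square M cy.
rewrite RintegralZl; [|exact: square_measurable|].
  rewrite RintegralD//; last exact: square_measurable.
  rewrite /Rintegral integral_dx0//; last by move=> z /V0[].
  by rewrite integral_dy0//= ?addr0 ?mulr0// => z /V0[].
apply: cont_integrable_square => x; apply: cvgD; [exact: cx|exact: cy].
Qed.

End Square.

(** * Lifts of maps to a homogeneous space *)

Lemma square_closed (R : realType) (M : R) : closed (square M).
Proof.
have -> : square M = (fst @^-1` [set` `[- M, M]]) `&` (snd @^-1` [set` `[- M, M]]).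
  by [].
apply: closedI; apply: closed_comp => //; try exact: interval_closed.
  by move=> x _; exact: cvg_fst.
by move=> x _; exact: cvg_snd.
Qed.

Section Lifts.
Variable R : realType.
Local Notation G := (G2 R).
Implicit Types V : normedModType R.

Definition G2fun V (g : V -> G) : V -> 'M[R]_8 := fun x => G2mx (g x).

Definition vel V (g : V -> G) (v p : V) : 'M[R]_8 :=
  invmx (G2mx (g p)) *m mxD v (G2fun g) p.

Lemma G2fun_inv V (g : V -> G) x : invmx (G2fun g x) = J8 R *m (G2fun g x)^T *m J8 R.
Proof. exact/aut_inv/G2P. Qed.

Lemma mxCk_inv V (g : V -> G) U k : open U ->
  mxCk U k (G2fun g) -> mxCk U k (fun x => invmx (G2fun g x)).
Proof.
move=> oU cg; under eq_fun do rewrite G2fun_inv.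
by do 2?[apply: mxCk_mul => //]; try exact: mxCk_cst; exact: mxCk_tr.
Qed.

Lemma mxCk_vel V (g : V -> G) U k v : open U ->
  mxCk U k.+1 (G2fun g) -> mxCk U k (vel g v).
Proof.
move=> oU cg; apply: mxCk_mul => //; last exact: mxCk_D.
exact/(mxCk_inv oU)/mxCk_pred.
Qed.

Lemma vel_is_der V (g : V -> G) U p v : U p -> mxCk U 1 (G2fun g) -> is_der (vel g v p).
Proof. by move=> Up cg; apply: vel_der; exact: mxCk_der cg Up. Qed.

Lemma mxD_mem V (W : {vspace 'M[R]_8}) (U : set V) (X : V -> 'M[R]_8) p v :
  open U -> U p -> mxder X p v -> (forall x, U x -> X x \in W) -> mxD v X p \in W.
Proof.
move=> oU Up dX XW; have [d2 D2] := mxD_lin (projv W) dX.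
suff -> : mxD v X p = projv W (mxD v X p) by exact: memv_proj.
rewrite -D2; apply: (open_eq_mxD v oU Up) => x; rewrite inE => Ux /=.
by rewrite projv_id// XW.
Qed.

Lemma mxD_inv V (g : V -> G) p v : mxder (G2fun g) p v ->
  mxder (fun x => invmx (G2fun g x)) p v /\
  mxD v (fun x => invmx (G2fun g x)) p = - (vel g v p *m invmx (G2fun g p)).
Proof.
move=> dg.
have di : mxder (fun x => invmx (G2fun g x)) p v.
  under eq_fun do rewrite G2fun_inv.
  have dt : mxder (fun x => (G2fun g x)^T) p v.
    by move=> i j; apply: derivable_ext (dg j i) => y; rewrite mxE.
  exact: (mxD_mul (mxD_mul (mxD_cst _ _ _).1 dt).1 (mxD_cst _ _ _).1).1.
split => //.
have [_] := mxD_mul di dg.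
have -> : (fun y => invmx (G2fun g y) *m G2fun g y) = (fun=> 1%:M).
  by apply/funext => y; rewrite mulVmx// G2unit.
rewrite (mxD_cst _ _ _).2 => /esym/eqP; rewrite addr_eq0 => /eqP E.
by rewrite -[LHS](mulmxK (G2unit (g p))) E mulNmx.
Qed.

(** The Maurer-Cartan equation, from the symmetry of second derivatives. *)
Lemma vel_flat V (g : V -> G) U p v w : open U -> U p -> mxCk U 2 (G2fun g) ->
  mxD v (vel g w) p = mxD w (vel g v) p - bracket (vel g v p) (vel g w p).
Proof.
move=> oU Up cg.
have E a b : mxD a (vel g b) p = invmx (G2fun g p) *m mxD a (mxD b (G2fun g)) p
    - vel g a p *m vel g b p.
  have da : mxder (G2fun g) p a by exact: mxCk_der (mxCk_pred cg) Up.
  have db : mxder (mxD b (G2fun g)) p a by exact: mxCk_der (mxCk_D b cg) Up.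
  have [di Di] := mxD_inv da.
  rewrite (mxD_mul di db).2 Di addrC mulNmx.
  by rewrite [vel g b p]/vel mulmxA.
rewrite !E (mx_schwarz v w oU Up cg) /bracket; apply/matrixP => i j; rewrite !mxE; ring.
Qed.

Section Isotropy.
Variables (H : set G) (h : {vspace 'M[R]_8}).
Hypothesis iH : isotropy H h.

Lemma qproj_eq g g' : qproj H g = qproj H g' -> H (G2mul (G2inv g) g').
Proof.
move=> [E]; have : lcoset H g' g'.
  by exists (G2one R); [exact: iso_one iH|rewrite /= mulmx1].
rewrite -E => -[k Hk gk]; rewrite (_ : G2mul _ _ = k)//.
by apply: G2_eq; rewrite /= gk mulmxA mulVmx ?G2unit// mul1mx.
Qed.

Lemma qproj_mul g k : H k -> qproj H (G2mul g k) = qproj H g.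
Proof.
move=> Hk; have E : lcoset H (G2mul g k) = lcoset H g.
  apply/seteqP; split=> x [l Hl E].
    by exists (G2mul k l); [exact: (iso_mul iH)|rewrite E /= mulmxA].
  exists (G2mul (G2inv k) l); first by apply: (iso_mul iH) => //; exact: iso_inv iH _ Hk.
  by rewrite E /= -!mulmxA; congr (_ *m _); rewrite !mulmxA mulmxV ?G2unit// mul1mx.
rewrite /qproj; move: (ex_intro _ _ _) (ex_intro _ _ _); rewrite E => a b.
by congr exist; exact: Prop_irrelevance.
Qed.

Definition vform V (g : V -> G) (v w p : V) : R := qform h (vel g v p) (vel g w p).

(** Two lifts of the same map differ by a map to [H], whose velocity is
vertical. *)
Lemma vform_lift V (F : V -> quot H) U g U' g' p v w :
  smooth_lift F U g -> smooth_lift F U' g' -> U p -> U' p ->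
  vform g' v w p = vform g v w p.
Proof.
move=> [oU sg gF] [oU' sg' gF'] Up Up'.
have cg : mxCk U 1 (G2fun g) by move=> i j; exact: sg.
have cg' : mxCk U' 1 (G2fun g') by move=> i j; exact: sg'.
pose k x := G2mul (G2inv (g x)) (g' x).
have oW : open (U `&` U') by exact: openI.
have Wp : (U `&` U') p by [].
have Hk x : (U `&` U') x -> H (k x).
  by move=> [Ux Ux']; apply: qproj_eq; rewrite gF// gF'.
have dg u : mxder (G2fun g) p u by exact: mxCk_der cg Up.
have dg' u : mxder (G2fun g') p u by exact: mxCk_der cg' Up'.
have dk u : mxder (G2fun k) p u by exact: (mxD_mul (mxD_inv (dg u)).1 (dg' u)).1.
have E u : vel g' u p = invmx (G2mx (k p)) *m vel g u p *m G2mx (k p) + vel k u p.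
  have kg : G2fun g' = (fun x => G2fun g x *m G2fun k x).
    by apply/funext => x; rewrite /G2fun /= mulmxA mulmxV ?mul1mx// G2unit.
  have ug := G2unit (g p); have uk := G2unit (k p).
  have ik : invmx (G2mx (g' p)) = invmx (G2mx (k p)) *m invmx (G2mx (g p)).
    apply: (can_inj (mulmxK (G2unit (g' p)))); rewrite mulVmx ?G2unit//.
    have -> : G2mx (g' p) = G2mx (g p) *m G2mx (k p) by exact: (congr1 (fun f => f p) kg).
    by rewrite mulmxA -[_ *m G2mx (g p)]mulmxA mulVmx// mulmx1 mulVmx.
  rewrite /vel kg (mxD_mul (dg u) (dk u)).2 ik mulmxDr !mulmxA.
  by congr (_ + _); rewrite -[_ *m _ *m G2fun g p]mulmxA mulVmx// mulmx1.
have vk u : vel k u p \in h by exact: (iso_vel iH oW Wp Hk (dk u)).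
have P u : proj_orth h (vel g' u p) =
    proj_orth h (invmx (G2mx (k p)) *m vel g u p *m G2mx (k p)).
  have dv : is_der (invmx (G2mx (k p)) *m vel g u p *m G2mx (k p)).
    by apply: conj_der; [exact: G2P|exact: vel_is_der Up cg].
  have [xo xh] := proj_orthP (iso_sub iH) ((mem_lieG _).2 dv).
  rewrite E -{1}[_ *m _ *m _](subrK (proj_orth h (invmx (G2mx (k p)) *m vel g u p *m G2mx (k p)))).
  by rewrite addrAC addrC (proj_orth_uniq (iso_sub iH))// memvD.
rewrite /vform /qform !P -!/(qform h _ _) (qform_conj iH (Hk _ Wp))//; exact: vel_is_der Up cg.
Qed.

(** By the trace formula the pulled back metric is polynomial in the entries of
this linear projection, which makes it smooth and computes its derivatives. *)
Definition im_proj (X : 'M[R]_8) : 'M[R]_7 := im_mx (proj_orth h X).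

Lemma im_proj_is_linear : linear im_proj.
Proof. by move=> c X Y; rewrite /im_proj /proj_orth linearP im_mx_lin. Qed.
HB.instance Definition _ := GRing.isLinear.Build R _ _ _ im_proj im_proj_is_linear.

Lemma qform_tr X Y : is_der X -> is_der Y ->
  qform h X Y = 4 * \tr (im_proj X *m im_proj Y).
Proof.
move=> /mem_lieG XG /mem_lieG YG; apply: killing_trace.
  by apply: orth_der; exact: (proj_orthP (iso_sub iH) XG).1.
by apply: orth_der; exact: (proj_orthP (iso_sub iH) YG).1.
Qed.

Lemma Ck_vform V (g : V -> G) U k v w : open U -> mxCk U k.+1 (G2fun g) ->
  Ck U k (vform g v w).
Proof.
move=> oU cg.
have c1 u : mxCk U k (im_proj \o vel g u) by apply: mxCk_lin => //; exact: mxCk_vel.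
have c2 := mxCk_mul oU (c1 v) (c1 w).
have c3 := Ck_mul oU (Ck_cst U k 4) (Ck_sum (index_enum 'I_7) oU (fun i => c2 i i)).
apply: Ck_eq c3 => // x; rewrite inE => Ux.
have cg1 : mxCk U 1 (G2fun g).
  elim: k cg {c1 c2} => [|k IH] cg //; exact/IH/mxCk_pred.
by rewrite /vform qform_tr//; exact: vel_is_der Ux cg1.
Qed.

Lemma D_vform V (g : V -> G) U p u v w : open U -> U p -> mxCk U 2 (G2fun g) ->
  'D_u (vform g v w) p = qform h (mxD u (vel g v) p) (vel g w p) +
                         qform h (vel g v p) (mxD u (vel g w) p).
Proof.
move=> oU Up cg; have cg1 := mxCk_pred cg.
have dv a : mxder (vel g a) p u by exact: mxCk_der (mxCk_vel a oU cg) Up.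
have Dder a : is_der (mxD u (vel g a) p).
  by apply/mem_lieG/(mxD_mem oU Up) => // x Ux; apply/mem_lieG; exact: vel_is_der Ux cg1.
have vder a x : U x -> is_der (vel g a x) by move=> Ux; exact: vel_is_der Ux cg1.
have [d1 D1] := mxD_lin im_proj (dv v); have [d2 D2] := mxD_lin im_proj (dv w).
have [d3 D3] := mxD_mul d1 d2.
have [d4 D4] := derivable_bigsum (index_enum 'I_7) (fun i => d3 i i).
rewrite !qform_tr//; try exact: vder.
rewrite (open_eq_D u oU Up (_ : {in U, _ =1
    (fun x => \tr (im_proj (vel g v x) *m im_proj (vel g w x)) * 4)})); last first.
  by move=> x; rewrite inE => Ux; rewrite mulrC; apply: qform_tr; exact: vder.
rewrite (derive_mulr_cst _ d4) D4 mulrC -mulrDr; congr (_ * _).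
rewrite -mxtraceD; move: D3; rewrite D1 D2 => <-.
by apply: eq_bigr => i _; rewrite [RHS]mxE.
Qed.

(** The pull-back of the metric is a function of the map alone, as lifts exist
only locally. *)
Definition pullback V (F : V -> quot H) (v w p : V) : R :=
  xget 0 [set c | exists U g, [/\ U p, smooth_lift F U g & c = vform g v w p]].

Lemma pullbackE V (F : V -> quot H) U g v w p : U p -> smooth_lift F U g ->
  pullback F v w p = vform g v w p.
Proof.
move=> Up sg; rewrite /pullback.
case: xgetP => [c _ /= [U' [g' [Up' sg' ->]]]|/(_ (vform g v w p)) []].
  exact: (vform_lift v w sg sg').
by exists U, g.
Qed.

Lemma Ck_pullback V (F : V -> quot H) k v w : smooth_quot F -> Ck setT k (pullback F v w).
Proof.
move=> sF; apply: Ck_local => x _; have [U [g [Ux sg]]] := sF x.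
exists U; split => //; have [oU cg _] := sg.
have := @Ck_vform _ g U k v w oU (fun i j => cg i j k.+1).
by apply: Ck_eq => // y; rewrite inE => Uy; rewrite (pullbackE v w Uy sg).
Qed.

(** * The first variation of the energy *)

Section Variation.
Let dirt := dirt R.
Variable Fh : plane R -> G.
Hypothesis smFh : forall i j k, Ck setT k (fun p => G2mx (Fh p) i j).
Variable Phi : R -> plane R -> quot H.
Let F2 (p : R * plane R) := Phi p.1 p.2.
Hypothesis smPhi : smooth_quot F2.
Hypothesis Phi0 : forall z, Phi 0 z = qproj H (Fh z).

Let slice (t : R) (z : plane R) : R * plane R := (t, z).
Let base (p : R * plane R) : R * plane R := (0, p.2).
Definition dirs (d : plane R) : R * plane R := (0, d).

Lemma slice_affine t (c : R) d z : slice t (c *: d + z) = c *: dirs d + slice t z.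
Proof. by apply: injective_projections => //=; rewrite scaler0 add0r. Qed.

Lemma slice_cont t : continuous (slice t).
Proof. by apply: cont_pair => x; [exact: cvg_cst|exact: cvg_id]. Qed.

Lemma base_cont : continuous base.
Proof. by apply: cont_pair => x; [exact: cvg_cst|exact: cvg_snd]. Qed.

Lemma base_affine (c : R) d p : base (c *: d + p) = c *: base d + base p.
Proof. by apply: injective_projections => //=; rewrite scaler0 add0r. Qed.

Lemma open_pre (V W : normedModType R) (a : V -> W) U :
  continuous a -> open U -> open (a @^-1` U).
Proof. by move=> /continuousP; exact. Qed.

(** Correct a local lift of the variation by the map to [H], independent of time,
that carries its restriction to the given lift of the initial map. *)
Lemma normalized_lift z0 : exists U g, [/\ U (slice 0 z0), smooth_lift F2 U g
  & forall z, U (slice 0 z) -> g (slice 0 z) = Fh z].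
Proof.
have [U [g [Uz [oU sg gF]]]] := smPhi (slice 0 z0).
pose k p := G2mul (G2inv (g (base p))) (Fh p.2).
pose U' := U `&` (base @^-1` U).
have oU' : open U' by apply: openI => //; exact: open_pre base_cont oU.
have Hk p : U' p -> H (k p).
  by move=> [_ Up]; apply: qproj_eq; rewrite gF// /F2 /= Phi0.
exists U', (fun p => G2mul (g p) (k p)); split => //.
- split => // [i j n|p [Up Upb]]; last by rewrite qproj_mul ?gF//; exact: Hk.
  have cg : mxCk U' n (G2fun g) by move=> a b; apply: Ck_sub (sg a b n) => x [].
  have cgb : mxCk U' n (G2fun g \o base).
    apply: mxCk_sub (mxCk_affine base_cont base_affine (fun a b => sg a b n)).
    by move=> x [].
  have cF : mxCk U' n (fun p : R * plane R => G2fun Fh p.2).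
    have snd_aff (c : R) (d p : R * plane R) : (c *: d + p).2 = c *: d.2 + p.2 by [].
    have snd_cont : continuous (@snd R (plane R)) by move=> p; exact: cvg_snd.
    apply: mxCk_sub (mxCk_affine snd_cont snd_aff (fun a b => smFh a b n)) => //.
  have cgi := @mxCk_inv _ (g \o base) U' n oU' cgb.
  exact: (mxCk_mul oU' cg (mxCk_mul oU' cgi cF)).
- by move=> z _; apply: G2_eq; rewrite /= mulmxA mulmxV ?mul1mx// G2unit.
Qed.

Let S v w := pullback F2 v w.

(** The density of each map of the variation is the restriction of one function on
the product of the time axis with the plane. *)
Lemma energy_densityE t z : energy_density h (Phi t) z =
  S (dirs (dirx R)) (dirs (dirx R)) (slice t z) +
  S (dirs (diry R)) (dirs (diry R)) (slice t z).
Proof.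
have [U [g [Uz sg]]] := smPhi (slice t z); have [oU cg gF] := sg.
rewrite /S !(pullbackE _ _ Uz sg).
pose g1 := g \o slice t; pose U1 := slice t @^-1` U.
have sg1 : smooth_lift (Phi t) U1 g1.
  split; first exact: open_pre (@slice_cont t) oU.
    by move=> i j n; exact: (Ck_affine (@slice_cont t) (slice_affine t) (cg i j n)).
  by move=> p Up; rewrite gF.
have vE d : vel g1 d z = vel g (dirs d) (slice t z).
  by rewrite /vel -(mxD_affine (G2fun g) d z (slice_affine t)).
rewrite /energy_density; case: xgetP => [c _ /= [U' [g' [Uz' sg' ->]]]|].
  have e d : metric h (maurer_cartan g' d z) = vform g1 d d z.
    exact: (vform_lift d d sg1 sg' (Uz : U1 z) Uz').
  by rewrite !e /vform !vE.
move=> /(_ (metric h (maurer_cartan g1 (dirx R) z) + metric h (maurer_cartan g1 (diry R) z))) [].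
by exists U1, g1.
Qed.

(** The tension field in the frame of the lift: the divergence of the part of the
velocity that is tangent to the quotient, the bracket accounting for the motion of
the frame. *)
Definition tension z : 'M[R]_8 :=
  (proj_orth h (mxD (dirx R) (vel Fh (dirx R)) z) +
    bracket (vel Fh (dirx R) z) (proj_orth h (vel Fh (dirx R) z))) +
  (proj_orth h (mxD (diry R) (vel Fh (diry R)) z) +
    bracket (vel Fh (diry R) z) (proj_orth h (vel Fh (diry R) z))).

Let variation_algebra (lx ly rx ry ax ay bx by' cx cy : R) :
  lx = 2 * (ax - bx) -> ly = 2 * (ay - by') -> rx = ax + cx -> ry = ay + cy ->
  cx + bx + (cy + by') = 0 -> lx + ly = 2 * (rx + ry).
Proof. by move=> -> -> -> -> h0; rewrite -[LHS]addr0 -[X in _ + X](mulr0 2) -h0; ring. Qed.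

Let alg_double (s v a b m : R) : s = v -> v = a + b -> b = a -> a = m -> s = 2 * m.
Proof. by move=> -> -> -> ->; rewrite mulr_natl mulr2n. Qed.

Let alg_sum (s v a b c : R) : s = v -> v = a + b -> b = c -> s = a + c.
Proof. by move=> -> -> ->. Qed.

(** Let [X] be the velocity in time and [Y] the one in a direction of the plane. The
Maurer-Cartan equation turns the time derivative of [Y] into the space derivative
of [X], up to a bracket; the invariance of the Killing form moves this bracket onto
[Y]. What is left besides the divergence of the pairing of [X] with [Y] is the
pairing of [X] with the tension. *)
Lemma first_variation z : tension z = 0 ->
  'D_dirt (fun p => S (dirs (dirx R)) (dirs (dirx R)) p +
                    S (dirs (diry R)) (dirs (diry R)) p) (slice 0 z) =
  2 * ('D_(dirx R) (fun z => S dirt (dirs (dirx R)) (slice 0 z)) z +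
       'D_(diry R) (fun z => S dirt (dirs (diry R)) (slice 0 z)) z).
Proof.
move=> tz; have [U [g [Uz sg gFh]]] := normalized_lift z.
have [oU cg _] := sg; set p := slice 0 z.
have cS v w : Ck setT 1 (S v w) by exact: Ck_pullback.
have cg2 : mxCk U 2 (G2fun g) by move=> i j; exact: cg.
have cg1 := mxCk_pred cg2.
have Sg v w x : U x -> S v w x = vform g v w x by move=> Ux; exact: pullbackE Ux sg.
have DS u v w : 'D_u (S v w) p = 'D_u (vform g v w) p.
  by apply: (open_eq_D u oU Uz) => x; rewrite inE; exact: Sg.
rewrite deriveD; [|exact: Ck_der (cS _ _) I..].
have sl d : 'D_d (fun z => S dirt (dirs d) (slice 0 z)) z = 'D_(dirs d) (S dirt (dirs d)) p.
  exact: (derive_affine (S dirt (dirs d)) d z (slice_affine 0)).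
have vd v x : U x -> is_der (vel g v x) by move=> Ux; exact: vel_is_der Ux cg1.
have dv u v : mxder (vel g v) p u by exact: mxCk_der (mxCk_vel v oU cg2) Uz.
have Dd u v : is_der (mxD u (vel g v) p).
  by apply/mem_lieG/(mxD_mem oU Uz) => // x Ux; apply/mem_lieG; exact: vd.
have hK := iso_sub iH.
have po X : is_der X -> is_der (proj_orth h X).
  by move=> dX; apply: orth_der; exact: (proj_orthP hK ((mem_lieG X).2 dX)).1.
have vF d y : U (slice 0 y) -> vel g (dirs d) (slice 0 y) = vel Fh d y.
  move=> Uy; rewrite /vel gFh//; congr (_ *m _).
  rewrite -(mxD_affine (G2fun g) d y (slice_affine 0)).
  have oU0 := open_pre (@slice_cont 0) oU.
  by apply: (open_eq_mxD d oU0 Uy) => x; rewrite inE => Ux /=; rewrite /G2fun gFh.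
have DvF d : mxD (dirs d) (vel g (dirs d)) p = mxD d (vel Fh d) z.
  rewrite -(mxD_affine (vel g (dirs d)) d z (slice_affine 0)).
  have oU0 := open_pre (@slice_cont 0) oU.
  by apply: (open_eq_mxD d oU0 Uz) => x; rewrite inE => Ux /=; rewrite vF.
have K1 d : qform h (mxD dirt (vel g (dirs d)) p) (vel g (dirs d) p) =
    qform h (mxD (dirs d) (vel g dirt) p) (vel g (dirs d) p)
    - killing (vel g dirt p) (bracket (vel Fh d z) (proj_orth h (vel Fh d z))).
  have dT := vd dirt _ Uz; have dX := vd (dirs d) _ Uz.
  rewrite (vel_flat dirt (dirs d) oU Uz cg2) qformE//; last first.
    have := is_der_lin (-1) (bracket_der dT dX) (Dd (dirs d) dirt).
    by rewrite scaleN1r addrC.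
  rewrite addrC -scaleN1r killing_linl mulN1r addrC -qformE//; congr (_ - _).
  have vFp : vel g (dirs d) p = vel Fh d z by exact: vF.
  by rewrite -vFp; exact: (killing_ad dT dX (po _ dX)).
have vp v : is_der (vel g v p) by exact: vd.
have K2 d : qform h (vel g dirt p) (mxD (dirs d) (vel g (dirs d)) p) =
    killing (vel g dirt p) (proj_orth h (mxD d (vel Fh d) z)).
  by rewrite -(DvF d); exact: (qformE hK (vp _) (Dd _ _)).
have K3 d : qform h (vel g (dirs d) p) (mxD dirt (vel g (dirs d)) p) =
   qform h (mxD dirt (vel g (dirs d)) p) (vel g (dirs d) p).
  exact: (qformC hK (vp _) (Dd _ _)).
have L d : 'D_dirt (S (dirs d) (dirs d)) p =
    2 * (qform h (mxD (dirs d) (vel g dirt) p) (vel g (dirs d) p)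
    - killing (vel g dirt p) (bracket (vel Fh d z) (proj_orth h (vel Fh d z)))).
  exact: (alg_double (DS _ _ _) (D_vform _ _ _ oU Uz cg2) (K3 d) (K1 d)).
have Rr d : 'D_d (fun z => S dirt (dirs d) (slice 0 z)) z =
    qform h (mxD (dirs d) (vel g dirt) p) (vel g (dirs d) p) +
    killing (vel g dirt p) (proj_orth h (mxD d (vel Fh d) z)).
  exact: (alg_sum (etrans (sl d) (DS _ _ _)) (D_vform _ _ _ oU Uz cg2) (K2 d)).
have vFd d : is_der (vel Fh d z) by rewrite -(vF d z Uz); exact: vp.
have pD d : is_der (proj_orth h (mxD d (vel Fh d) z)) by rewrite -DvF; exact: (po _ (Dd _ _)).
have bD d : is_der (bracket (vel Fh d z) (proj_orth h (vel Fh d z))).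
  exact: (bracket_der (vFd d) (po _ (vFd d))).
have sD (X Y : 'M[R]_8) : is_der X -> is_der Y -> is_der (X + Y).
  by move=> dX dY; have := is_der_lin 1 dX dY; rewrite scale1r.
have kD (X Y : 'M[R]_8) : is_der X -> is_der Y ->
    killing (vel g dirt p) (X + Y) = killing (vel g dirt p) X + killing (vel g dirt p) Y.
  move=> dX dY; rewrite (killingC (vp _) (sD _ _ dX dY)) -[X in X + Y]scale1r killing_linl mul1r.
  by rewrite (killingC dX (vp _)) (killingC dY (vp _)).
have tz0 : killing (vel g dirt p) (tension z) = 0.
  rewrite tz (killingC (vp _) (@is_der0 R)).
  by have := killing_linl (-1) 0 0 (vel g dirt p); rewrite scaler0 addr0 mulN1r addNr.
have Lx := L (dirx R); have Ly := L (diry R).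
have Rx := Rr (dirx R); have Ry := Rr (diry R).
rewrite /tension (kD _ _ (sD _ _ (pD _) (bD _)) (sD _ _ (pD _) (bD _))) in tz0.
have kx := kD _ _ (pD (dirx R)) (bD (dirx R)).
have ky := kD _ _ (pD (diry R)) (bD (diry R)).
exact: (variation_algebra Lx Ly Rx Ry (etrans (esym (congr2 +%R kx ky)) tz0)).
Qed.

(** Outside the square, the lift of the initial map lifts the variation. *)
Lemma variation_vanish (M : R) d z : ~ square M z ->
  (forall t z, ~ square M z -> Phi t z = qproj H (Fh z)) ->
  S dirt (dirs d) (slice 0 z) = 0.
Proof.
move=> nz hM.
have osq : open (~` @square R M).
  exact/closed_openC/square_closed.
pose U := (@snd R (plane R)) @^-1` (~` @square R M).
have snd_cont : continuous (@snd R (plane R)) by move=> p; exact: cvg_snd.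
have oU : open U by exact: open_pre snd_cont osq.
have snd_aff (c : R) (u p : R * plane R) : (c *: u + p).2 = c *: u.2 + p.2 by [].
have sg : smooth_lift F2 U (Fh \o snd).
  split => // [i j n|p Up]; last by rewrite /F2 hM.
  apply: Ck_sub (Ck_affine snd_cont snd_aff (smFh i j n)) => //.
rewrite /S (pullbackE _ _ _ sg)// /vform (_ : vel _ dirt _ = 0).
  rewrite /qform /proj_orth linear0.
  by have := killing_linl (-1) 0 0 (daddv_pi (orth h) h (vel (Fh \o snd) (dirs d) (slice 0 z)));
     rewrite scaler0 addr0 mulN1r addNr.
rewrite /vel (mxD_affine (G2fun Fh) dirt (slice 0 z) snd_aff) /=.
rewrite (_ : mxD 0 _ _ = 0) ?mulmx0//; apply/matrixP => i j; rewrite !mxE.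
exact: derive0.
Qed.

End Variation.

(** The energy is stationary at a map with zero tension: up to a divergence, the
first variation of its density is the pairing of the variation with the
tension. *)
Lemma harmonic_of_tension (Fh : plane R -> G) :
  (forall i j k, Ck setT k (fun p => G2mx (Fh p) i j)) ->
  (forall z, tension Fh z = 0) -> harmonic_map h (fun z => qproj H (Fh z)).
Proof.
move=> sF tF; split=> [p|Phi M sPhi Phi0 Phiout].
  by exists setT, Fh; split => //; split => //; first exact: openT.
pose F2 (p : R * plane R) := Phi p.1 p.2.
pose S := pullback F2.
pose E p := S (dirs (dirx R)) (dirs (dirx R)) p + S (dirs (diry R)) (dirs (diry R)) p.
pose W d (z : plane R) := S (dirt R) (dirs d) (0, z).
have cS v w : Ck setT 1 (S v w) by exact: Ck_pullback.
have cE : Ck setT 1 E by apply: Ck_add => //; exact: openT.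
have cW d : Ck setT 1 (W d).
  exact: (Ck_affine (slice_cont (t := 0)) (slice_affine 0) (cS (dirt R) (dirs d))).
have DE z : 'D_(dirt R) E (0, z) = 2 * ('D_(dirx R) (W (dirx R)) z + 'D_(diry R) (W (diry R)) z).
  exact: (first_variation sF sPhi Phi0 (tF z)).
have W0 z : ~ square M z -> W (dirx R) z = 0 /\ W (diry R) z = 0.
  by move=> nz; split; apply: variation_vanish nz Phiout.
have := square_variation cE (cW _) (cW _) DE W0.
set I := (fun t => _ : R^o) => dI.
have -> : (fun t : R => energy h M (Phi t) : R^o) = 2^-1 *: I.
  apply/funext => t; rewrite /energy /I /=; congr (_ * _).
  by apply: eq_Rintegral => p _; rewrite (energy_densityE sPhi).
have := is_deriveZ (2^-1 : R) dI; rewrite scaler0; exact.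
Qed.
End Isotropy.
End Lifts.

(** * The derivations of the Toda frame *)

Section TodaDerivations.
Variable R : realType.

Definition mx7 (rows : seq (seq R)) : 'M[R]_7 := \matrix_(i, j) (nth [::] rows i)`_j.

Definition rowS (r x : seq R) : R := r`_0 * x`_0 + r`_1 * x`_1 + r`_2 * x`_2 +
  r`_3 * x`_3 + r`_4 * x`_4 + r`_5 * x`_5 + r`_6 * x`_6.

Lemma mx7_col7 r0 r1 r2 r3 r4 r5 r6 x : mx7 [:: r0; r1; r2; r3; r4; r5; r6] *m col7 x =
  col7 [:: rowS r0 x; rowS r1 x; rowS r2 x; rowS r3 x; rowS r4 x; rowS r5 x; rowS r6 x].
Proof.
apply/colP => i; rewrite !mxE sum7 !mxE.
by elim/ord7_ind: i.
Qed.

(** The sum of a Higgs field and its adjoint, in the multiplication basis, when the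
field has entries [t], [b], [g] and [- sqrt(-2) t] in the unitary weight basis; the
arguments are the real and imaginary parts of [t], [b] and [g]. *)
Definition pmx (t1 t2 b1 b2 g1 g2 : R) : 'M[R]_7 := mx7
  [:: [:: 0; 0; 0; 2 * t2; 2 * t1; 0; 0];
      [:: 0; 0; 0; b1; b2; - t1 - g1; - t2 + g2];
      [:: 0; 0; 0; b2; - b1; t2 + g2; - t1 + g1];
      [:: 2 * t2; b1; b2; 0; 0; 0; 0];
      [:: 2 * t1; b2; - b1; 0; 0; 0; 0];
      [:: 0; - t1 - g1; t2 + g2; 0; 0; 0; 0];
      [:: 0; - t2 + g2; - t1 + g1; 0; 0; 0; 0]].

(** The element of the torus with weights [sqrt(-1) d1] on [e_3] and [sqrt(-1) d2]
on [e_2]; its weight on [e_1] is the difference. *)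
Definition tmx (d1 d2 : R) : 'M[R]_7 := mx7
  [:: [:: 0; 0; 0; 0; 0; 0; 0];
      [:: 0; 0; d2; 0; 0; 0; 0];
      [:: 0; - d2; 0; 0; 0; 0; 0];
      [:: 0; 0; 0; 0; d2 - d1; 0; 0];
      [:: 0; 0; 0; d1 - d2; 0; 0; 0];
      [:: 0; 0; 0; 0; 0; 0; d1];
      [:: 0; 0; 0; 0; 0; - d1; 0]].

Lemma add_col7 (x y : seq R) : col7 x + col7 y = col7 (linS 1 x y).
Proof. by rewrite -lin_col7 scale1r. Qed.

(** In coordinates both conditions of [ext_der] are polynomial identities. *)
Lemma pmx_der t1 t2 b1 b2 g1 g2 : is_der (ext_mx 0 (pmx t1 t2 b1 b2 g1 g2)).
Proof.
apply: ext_der => x y; rewrite (col7_eta x) (col7_eta y).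
  set xs := [:: x _ _; _; _; _; _; _; _]; set ys := [:: y _ _; _; _; _; _; _; _].
  rewrite /pmx !(cross_col7, mx7_col7, add_col7) /xs /ys; apply: col7_eq.
  by cbv [crossS rowS nth linS]; congr [:: _; _; _; _; _; _; _]; ring.
set xs := [:: x _ _; _; _; _; _; _; _]; set ys := [:: y _ _; _; _; _; _; _; _].
rewrite /pmx !(dot_col7, mx7_col7) /xs /ys.
by cbv [dotS rowS nth]; ring.
Qed.

Lemma tmx_der d1 d2 : is_der (ext_mx 0 (tmx d1 d2)).
Proof.
apply: ext_der => x y; rewrite (col7_eta x) (col7_eta y).
  set xs := [:: x _ _; _; _; _; _; _; _]; set ys := [:: y _ _; _; _; _; _; _; _].
  rewrite /tmx !(cross_col7, mx7_col7, add_col7) /xs /ys; apply: col7_eq.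
  by cbv [crossS rowS nth linS]; congr [:: _; _; _; _; _; _; _]; ring.
set xs := [:: x _ _; _; _; _; _; _; _]; set ys := [:: y _ _; _; _; _; _; _; _].
rewrite /tmx !(dot_col7, mx7_col7) /xs /ys.
by cbv [dotS rowS nth]; ring.
Qed.

(** The torus rotates the root vectors [t], [b] and [g] by the angles of their
roots. *)
Lemma bracket_tmx_pmx d1 d2 t1 t2 b1 b2 g1 g2 :
  tmx d1 d2 *m pmx t1 t2 b1 b2 g1 g2 - pmx t1 t2 b1 b2 g1 g2 *m tmx d1 d2 =
  pmx (- (d2 - d1) * t2) ((d2 - d1) * t1) (- (d1 - 2 * d2) * b2) ((d1 - 2 * d2) * b1)
      (- (d1 + d2) * g2) ((d1 + d2) * g1).
Proof.
apply: mulmx_ext => x; rewrite mulmxBl -!mulmxA (col7_eta x).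
set xs := [:: x _ _; _; _; _; _; _; _].
have sub_col7 (u v : seq R) : col7 u - col7 v = col7 (linS (-1) v u).
  by rewrite -lin_col7 scaleN1r addrC.
rewrite /pmx /tmx !(mx7_col7, sub_col7) /xs; apply: col7_eq.
by cbv [rowS nth linS]; congr [:: _; _; _; _; _; _; _]; ring.
Qed.

Lemma tmx_lieT d1 d2 : ext_mx 0 (tmx d1 d2) \in lieT R.
Proof.
have E (x : imo R) : tmx d1 d2 *m x = col7
    [:: 0; d2 * x 2%:R 0; - d2 * x 1 0; (d2 - d1) * x 4%:R 0; (d1 - d2) * x 3%:R 0;
        d1 * x 6%:R 0; - d1 * x 5%:R 0].
  rewrite {1}(col7_eta x) /tmx mx7_col7; apply: col7_eq.
  by cbv [rowS nth]; congr [:: _; _; _; _; _; _; _]; ring.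
apply/mem_lieT; split; first exact: tmx_der.
- rewrite im_ext_mx E; apply/colP => i; rewrite !mxE /=.
  by elim/ord7_ind: i; rewrite /= ?mulr0.
- move=> v /mem_mspan H; apply/mem_mspan => i; rewrite im_ext_mx E mxE.
  by elim/ord7_ind: i => //= _; rewrite H ?mulr0.
- move=> v /mem_mspan H; apply/mem_mspan => i; rewrite im_ext_mx E mxE.
  by elim/ord7_ind: i => //= _; rewrite H ?mulr0.
- move=> v /mem_mspan H; apply/mem_mspan => i; rewrite im_ext_mx E mxE.
  by elim/ord7_ind: i => //= _; rewrite H ?mulr0.
Qed.

Lemma orth_sub (h h' : {vspace 'M[R]_8}) X : (h <= h')%VS -> X \in orth h' -> X \in orth h.
Proof.
move=> hh /mem_orth[XG Xh]; apply/mem_orth; split => // Y hY.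
by apply: Xh; exact: (subvP hh).
Qed.

(** Elements of [lieK] are block diagonal, and this one is block antidiagonal. *)
Lemma pmx_orth t1 t2 b1 b2 g1 g2 : ext_mx 0 (pmx t1 t2 b1 b2 g1 g2) \in orth (lieK R).
Proof.
have dP := pmx_der t1 t2 b1 b2 g1 g2.
apply/mem_orth; split; first exact/mem_lieG.
move=> Y hY; have /mem_lieK[dY sY] := hY.
have A0 (i j : 'I_7) : (3 <= i)%N -> (j < 3)%N -> im_mx Y i j = 0.
  move=> i3 j3; have <- : (im_mx Y *m mbasis R j) i 0 = im_mx Y i j.
    by rewrite /mbasis -colE mxE.
  apply: (mem_ImH _).1 i3; apply: sY; apply/mem_ImH => k k3.
  rewrite /mbasis mxE; have [kj|//] := eqVneq k j.
  by move: k3; rewrite kj leqNgt j3.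
have A0' (i j : 'I_7) : (3 <= i)%N -> (j < 3)%N -> im_mx Y j i = 0.
  by move=> i3 j3; rewrite (der_skew j i dY) A0// mulr0.
rewrite killing_trace// im_ext_mx /mxtrace big1 ?mulr0// => i _.
rewrite mxE big1// => j _.
have [ij|ij] := boolP ((i < 3)%N == (j < 3)%N).
  suff -> : pmx t1 t2 b1 b2 g1 g2 i j = 0 by rewrite mul0r.
  rewrite /pmx mxE; move: ij.
  by elim/ord7_ind: i; elim/ord7_ind: j.
have [i3|i3] := ltnP i 3.
  by rewrite A0 ?mulr0//; move: ij; rewrite i3; case: ltnP.
by rewrite A0' ?mulr0//; move: ij; rewrite [(i < 3)%N]ltnNge i3; case: ltnP.
Qed.

(** ** Uniqueness for linear differential equations *)

(** The function [e^(- C t) s t] decreases. *)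
Lemma gronwall (s : R -> R) (C : R) : (forall t, derivable s t 1) ->
  (forall t, 0 <= t <= 1 -> 'D_1 s t <= C * s t) -> s 0 = 0 -> s 1 <= 0.
Proof.
move=> ds sC s0.
pose e (t : R) := expR (t * - C); pose g (t : R) := e t * s t.
have dl (t : R) : derivable (fun t : R => t * - C) t 1.
  have dc : derivable (fun _ : R => - C) t 1 by exact: derivable_cst.
  have di : derivable (id : R -> R) t 1 by exact: derivable_id.
  exact: (derivableM di dc).
have Dl (t : R) : 'D_1 (fun t : R => t * - C) t = - C.
  have di : derivable (id : R -> R) t 1 by exact: derivable_id.
  have -> := derive_mulr_cst (- C) di.
  by rewrite derive_id mul1r.
have de (t : R) := derive_comp1 (dl t) (@derivable_expR R (t * - C)).
have dg (t : R) : derivable g t 1 by exact: (derivableM (de t).1 (ds t)).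
have Dg (t : R) : 'D_1 g t = e t * ('D_1 s t - C * s t).
  rewrite (deriveM (de t).1 (ds t)) (de t).2 Dl.
  rewrite (@derive_val _ _ _ _ _ _ _ (is_derive_expR (t * - C))) /=.
  rewrite /GRing.scale /= -/(e t); set d := 'D_1 s t; by ring.
have [c [c01]] := mvt_line (F := g) (x := 0) (v := 1) ltr01 (fun h _ => dg _).
have lin (h : R) : h *: (1 : R) + 0 = h by rewrite addr0 [h *: _]mulr1.
rewrite !lin Dg mulr1 => gE.
have g0 : g 0 = 0 by rewrite /g s0 mulr0.
have : g 1 <= 0.
  move: gE; rewrite g0 subr0 => ->.
  by rewrite pmulr_rle0 ?expR_gt0// subr_le0; exact: sC.
by rewrite /g pmulr_rle0// expR_gt0.
Qed.

Lemma quad_sum_le (I : finType) (m z : I -> R) (p S : R) :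
  p * p <= S -> (forall j, z j * z j <= S) ->
  p * (\sum_j m j * z j) + p * (\sum_j m j * z j) <= 2 * (\sum_j `|m j|) * S.
Proof.
move=> pS zS; have two (a : R) : a + a = 2 * a by ring.
rewrite two -[leRHS]mulrA ler_pM2l ?ltr0n// mulr_sumr mulr_suml.
apply: ler_sum => j _.
have H : `|p * z j| <= S.
  have := zS j; rewrite ler_norml => rS; apply/andP; split.
    by have := sqr_ge0 (p + z j); nra.
  by have := sqr_ge0 (p - z j); nra.
by rewrite (le_trans (ler_norm _))// mulrCA normrM ler_wpM2l.
Qed.

(** Apply [gronwall] to the sum of the squares of the unknowns along the segment, on
which the coefficients are bounded. The unknowns entering an equation are selected
by [f], so that matrix systems need no sum over pairs of indices. *)
Lemma line_ode0 (V : normedModType R) (x v : V) (I J : finType) (f : I -> J -> I)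
    (y : I -> V -> R) (M : I -> J -> V -> R) (t0 : R) :
  (forall i p, derivable (y i) p v) ->
  (forall i p, 'D_v (y i) p = \sum_j M i j p * y (f i j) p) ->
  (forall i j, continuous (M i j)) ->
  (forall i, y i x = 0) -> forall i, y i (t0 *: v + x) = 0.
Proof.
move=> dy yM cM y0.
pose a (h : R) : V := (h * t0) *: v + x.
have aA (h k l : R) : a (h *: k + l) = h *: ((k * t0) *: v) + a l.
  by rewrite /a mulrDl scalerDl -[h *: k]/(h * k) -mulrA -scalerA addrA.
have ca : continuous a.
  move=> h; apply: (@cvgD R V R (nbhs h) _ (fun h => (h * t0) *: v) (fun=> x)).
    apply: (cvgZr_tmp (s := fun h => h * t0)).
    by apply: (cvgMr_tmp (f := fun h : R => h)); exact: cvg_id.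
  exact: cvg_cst.
pose z i := y i \o a.
pose l (p : V) (h : R) : V := h *: v + p.
have lA p (h k m : R) : l p (h *: k + m) = h *: (k *: v) + l p m.
  by rewrite /l scalerDl -[h *: k]/(h * k) -scalerA addrA.
have dl i p (t : R) : derivable (y i \o l p) t 1.
  by apply: (derivable_affine (lA p)); rewrite scale1r; exact: dy.
have Dl i p (t : R) : 'D_1 (y i \o l p) t = 'D_v (y i) (l p t).
  by rewrite (derive_affine _ _ _ (lA p)) scale1r.
have dm (t : R) : derivable (fun t : R => t * t0) t 1 /\ 'D_1 (fun t : R => t * t0) t = t0.
  have di : derivable (id : R -> R) t 1 by exact: derivable_id.
  have dc : derivable (fun _ : R => t0) t 1 by exact: derivable_cst.
  split; first exact: (derivableM di dc).
  by rewrite (derive_mulr_cst t0 di) derive_id mul1r.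
have dzD i (t : R) := derive_comp1 (dm t).1 (dl i x (t * t0)).
have dz i (t : R) : derivable (z i) t 1 by exact: (dzD i t).1.
have Dz i (t : R) : 'D_1 (z i) t = \sum_j (t0 * M i j (a t)) * z (f i j) t.
  have -> := (dzD i t).2.
  rewrite (dm t).2 Dl yM mulrC mulr_sumr; apply: eq_bigr => j _.
  by rewrite mulrA.
pose s (t : R) := \sum_i z i t * z i t.
have dzz i (t : R) : derivable (fun t => z i t * z i t) t 1.
  exact: (derivableM (dz i t) (dz i t)).
have ds (t : R) := derivable_bigsum (index_enum I) (fun i => dzz i t).
pose N (t : R) := \sum_i \sum_j `|t0 * M i j (a t)|.
have cN : continuous N.
  suff [cN _] : Ck setT 0 N by move=> t; apply: cN; rewrite inE.
  apply: Ck_sum => [|i]; first exact: openT.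
  apply: Ck_sum => [|j]; first exact: openT.
  split => // t _; apply: (@cvg_norm R R^o); apply: cvgMl_tmp.
  by apply: (@continuous_comp _ _ _ a (M i j)); [exact: ca|exact: cM].
have [c _ cmax] := @EVT_max R N 0 1 ler01 (continuous_subspaceT cN).
have s_ge0 t : 0 <= s t by apply: sumr_ge0 => i _; rewrite -expr2 sqr_ge0.
have zs i t : z i t * z i t <= s t.
  rewrite /s (bigD1 i)//= lerDl; apply: sumr_ge0 => j _; by rewrite -expr2 sqr_ge0.
have sC (t : R) : 0 <= t <= 1 -> 'D_1 s t <= 2 * N c * s t.
  move=> t01; rewrite (ds t).2.
  have H1 i : 'D_1 (fun t => z i t * z i t) t <= 2 * (\sum_j `|t0 * M i j (a t)|) * s t.
    rewrite (deriveM (dz i t) (dz i t)) /GRing.scale /= Dz.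
    exact: (quad_sum_le _ (zs i t) (fun j => zs (f i j) t)).
  apply: (le_trans (ler_sum _ (fun i _ => H1 i))).
  rewrite -mulr_suml -mulr_sumr ler_wpM2r// ler_wpM2l//.
  by apply: cmax; rewrite in_itv.
have s0 : s 0 = 0.
  by rewrite /s big1// => i _; rewrite /z /= /a mul0r scale0r add0r y0 mulr0.
have s1 := gronwall (fun t => (ds t).1) sC s0.
move=> i; have := le_trans (zs i 1) s1; rewrite /z /= /a mul1r -expr2.
by move=> h; apply/eqP; rewrite -sqrf_eq0 eq_le h sqr_ge0.
Qed.

(** The unknowns vanish along the real axis, then along vertical lines. *)
Lemma plane_ode0 (I J : finType) (f : I -> J -> I)
    (y : I -> plane R -> R) (A B : I -> J -> plane R -> R) :
  (forall i, Ck setT 1 (y i)) ->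
  (forall i p, 'D_(dirx R) (y i) p = \sum_j A i j p * y (f i j) p) ->
  (forall i p, 'D_(diry R) (y i) p = \sum_j B i j p * y (f i j) p) ->
  (forall i j, continuous (A i j)) -> (forall i j, continuous (B i j)) ->
  (forall i, y i (0, 0) = 0) -> forall i p, y i p = 0.
Proof.
move=> cy yA yB cA cB y0 i [p1 p2].
have dy v j p : derivable (y j) p v by exact: Ck_der (cy j) Logic.I.
have yx j : y j (p1, 0) = 0.
  have -> : ((p1, 0) : plane R) = p1 *: dirx R + (0, 0).
    by congr (_, _); rewrite /= ?addr0 [_ *: _]/GRing.scale /= ?mulr1 ?mulr0.
  exact: (line_ode0 p1 (dy _) yA cA y0).
have -> : ((p1, p2) : plane R) = p2 *: diry R + (p1, 0).
  by congr (_, _); rewrite /= ?addr0 [_ *: _]/GRing.scale /= ?mulr1 ?mulr0 ?add0r.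
exact: (line_ode0 p2 (dy _) yB cB yx).
Qed.

End TodaDerivations.

(** * Frames moved by derivations *)

Section FrameODE.
Variable R : realType.

Lemma preserves_omul_aut (A : 'M[R]_7) :
  (forall x y, ext_mx 1 A *m omul x y = omul (ext_mx 1 A *m x) (ext_mx 1 A *m y)) ->
  oct_aut (ext_mx 1 A).
Proof.
move=> AM; have H (x y : imo R) : dot (A *m x) (A *m y) = dot x y /\
    cross (A *m x) (A *m y) = A *m cross x y.
  have := AM (oct 0 x) (oct 0 y).
  rewrite !ext_mxE !omul_oct !mulr0 !scale0r !addr0 !add0r.
  rewrite ext_mxE mul1r => /oct_inj[/oppr_inj + ->] => ->.
  by split.
apply: ext_aut => [|x y|x y]; [|exact: (H x y).2|exact: (H x y).1].
suff AJ : (J7 R *m A^T *m J7 R) *m A = 1%:M by case/mulmx1_unit: AJ.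
suff -> : J7 R *m A^T *m J7 R *m A = J7 R *m (A^T *m J7 R *m A).
  suff -> : A^T *m J7 R *m A = J7 R by rewrite J7J7.
  have E (x y : imo R) : (x^T *m (A^T *m J7 R *m A *m y)) 0 0 = (x^T *m (J7 R *m y)) 0 0.
    by rewrite -J7E -(H x y).1 J7E trmx_mul !mulmxA.
  apply/matrixP => i j; have := E (mbasis R i) (mbasis R j).
  by rewrite /mbasis trmx_delta -!colE -!rowE !mxE.
by rewrite !mulmxA.
Qed.

Lemma ext_mx0_is_linear : linear (@ext_mx R 0).
Proof. by move=> c X Y; exact: ext_mx_lin. Qed.
HB.instance Definition _ := GRing.isLinear.Build R _ _ _ (@ext_mx R 0) ext_mx0_is_linear.

Lemma ext_mxD (A : 'M[R]_7) : ext_mx 1 A = ext_mx 1 0 + ext_mx 0 A.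
Proof. by apply: oct_ext => a y; rewrite mulmxDl !ext_mxE mul0mx octD mul0r addr0 add0r. Qed.

Lemma mxD_ext_mx (V : normedModType R) (F : V -> 'M[R]_7) x v : mxder F x v ->
  mxder (fun p => ext_mx 1 (F p)) x v /\
  mxD v (fun p => ext_mx 1 (F p)) x = ext_mx 0 (mxD v F x).
Proof.
move=> dF; under [fun p => ext_mx 1 (F p)]eq_fun do rewrite ext_mxD.
have [dL DL] := mxD_lin (@ext_mx R 0) dF.
have [dc Dc] := mxD_cst (ext_mx 1 (0 : 'M[R]_7)) x v.
have [dA DA] := mxD_add dc dL.
by split; [exact: dA|rewrite DA Dc add0r DL].
Qed.

Lemma mxCk_ext_mx (V : normedModType R) (U : set V) k c (F : V -> 'M[R]_7) : open U ->
  mxCk U k F -> mxCk U k (fun p => ext_mx c (F p)).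
Proof.
move=> oU cF.
have E (A : 'M[R]_7) : ext_mx c A = ext_mx c 0 + ext_mx 0 A.
  by apply: oct_ext => a y; rewrite mulmxDl !ext_mxE mul0mx octD mul0r addr0 add0r.
under eq_fun do rewrite E.
by apply: mxCk_add => //; [exact: mxCk_cst|exact: (mxCk_lin (@ext_mx R 0) oU cF)].
Qed.

Lemma mulmx_delta_sum n (X : 'M[R]_n) (a : 'I_n) :
  X *m (delta_mx a 0 : 'cV_n) = \sum_c X c a *: (delta_mx c 0 : 'cV_n).
Proof.
rewrite -colE {1}(matrix_sum_delta (col a X)); apply: eq_bigr => i _.
by rewrite big_ord1 mxE.
Qed.

(** The defect of multiplicativity of the frame solves a homogeneous linear system
and vanishes at the origin. *)
Lemma frame_aut (F A B : plane R -> 'M[R]_7) :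
  mxCk setT 1 F -> mxCk setT 0 A -> mxCk setT 0 B ->
  (forall p, mxD (dirx R) F p = F p *m A p) ->
  (forall p, mxD (diry R) F p = F p *m B p) ->
  (forall p, is_der (ext_mx 0 (A p))) -> (forall p, is_der (ext_mx 0 (B p))) ->
  F (0, 0) = 1%:M -> forall p, oct_aut (ext_mx 1 (F p)).
Proof.
move=> cF cA cB FA FB dA dB F0 p; apply: preserves_omul_aut.
pose F8 p := ext_mx 1 (F p).
have dF8 v z : mxder F8 z v by apply: (mxD_ext_mx _).1; exact: (mxCk_der cF Logic.I).
have DF8 v (M : plane R -> 'M[R]_7) : (forall p, mxD v F p = F p *m M p) ->
    forall z, mxD v F8 z = F8 z *m ext_mx 0 (M z).
  move=> FM z; have dF : mxder F z v by exact: (mxCk_der cF Logic.I).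
  rewrite (mxD_ext_mx dF).2 FM.
  by rewrite /F8 ext_mxM mulr0.
have Dz v (M : plane R -> 'M[R]_7) : (forall p, mxD v F p = F p *m M p) ->
    forall (x : octo R) z, mxder (fun z => F8 z *m x) z v /\
      mxD v (fun z => F8 z *m x) z = F8 z *m (ext_mx 0 (M z) *m x).
  move=> FM x z; have [dc Dc] := mxD_cst x z v; have [d1 D1] := mxD_mul (dF8 v z) dc.
  by split => //; rewrite D1 Dc mulmx0 addr0 (DF8 _ _ FM) mulmxA.
pose Q (x y : octo R) z : octo R := omul (F8 z *m x) (F8 z *m y) - F8 z *m omul x y.
have Ql z (I : Type) (r : seq I) (c : I -> R) (X : I -> octo R) y :
    Q (\sum_(i <- r) c i *: X i) y z = \sum_(i <- r) c i *: Q (X i) y z.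
  elim: r => [|i r IH].
    rewrite !big_nil /Q.
    have -> : omul 0 y = 0 by have := omul_linl (-1) 0 0 y; rewrite scaler0 addr0 scaleN1r addNr.
    rewrite !mulmx0.
    have -> : omul 0 (F8 z *m y) = 0.
      by have := omul_linl (-1) 0 0 (F8 z *m y); rewrite scaler0 addr0 scaleN1r addNr.
    by rewrite subr0.
  rewrite !big_cons -IH /Q omul_linl !mulmxDr -!scalemxAr omul_linl scalerBr.
  by rewrite opprD addrACA.
have Qr z (I : Type) (r : seq I) (c : I -> R) (X : I -> octo R) y :
    Q y (\sum_(i <- r) c i *: X i) z = \sum_(i <- r) c i *: Q y (X i) z.
  elim: r => [|i r IH].
    rewrite !big_nil /Q.
    have -> : omul y 0 = 0 by have := omul_linr (-1) 0 0 y; rewrite scaler0 addr0 scaleN1r addNr.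
    rewrite !mulmx0.
    have -> : omul (F8 z *m y) 0 = 0.
      by have := omul_linr (-1) 0 0 (F8 z *m y); rewrite scaler0 addr0 scaleN1r addNr.
    by rewrite subr0.
  rewrite !big_cons -IH /Q omul_linr !mulmxDr -!scalemxAr omul_linr scalerBr.
  by rewrite opprD addrACA.
have DQ v (M : plane R -> 'M[R]_7) : (forall p, mxD v F p = F p *m M p) ->
    (forall p, is_der (ext_mx 0 (M p))) ->
    forall (x y : octo R) z, mxder (Q x y) z v /\ mxD v (Q x y) z =
      Q (ext_mx 0 (M z) *m x) y z + Q x (ext_mx 0 (M z) *m y) z.
  move=> FM dM x y z.
  have [dx Dx] := Dz v M FM x z; have [dy Dy] := Dz v M FM y z.
  have [dxy Dxy] := Dz v M FM (omul x y) z.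
  have dom : mxder (fun z => omul (F8 z *m x) (F8 z *m y)) z v.
    have [dl _] := mxD_lin (@lmulmx R) dx; have [dm _] := mxD_mul dl dy.
    by move=> i j; have := dm i j; under eq_fun do rewrite -lmulmxE.
  have [dn Dn] := mxD_lin (-%R : {linear octo R -> octo R}) dxy.
  have [dQ DQ] := mxD_add dom dn; split; first exact: dQ.
  rewrite [LHS]DQ mxD_omul// Dn Dx Dy Dxy /Q dM mulmxDr /= opprD addrACA.
  by [].
have cQ x y : mxCk setT 1 (Q x y).
  have cz (w : octo R) : mxCk setT 1 (fun z => F8 z *m w).
    apply: mxCk_mul; [exact: openT| |exact: mxCk_cst].
    exact: (mxCk_ext_mx 1 openT cF).
  apply: mxCk_add; [exact: openT| |].
    under eq_fun do rewrite lmulmxE.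
    apply: mxCk_mul; [exact: openT| |exact: cz].
    exact: (mxCk_lin (@lmulmx R) (openT) (cz x)).
  exact: (mxCk_lin (-%R : {linear octo R -> octo R}) openT (cz _)).
pose y (i : 'I_8 * 'I_8 * 'I_8) z := Q (delta_mx i.1.1 0) (delta_mx i.1.2 0) z i.2 0.
pose f (i : 'I_8 * 'I_8 * 'I_8) (c : 'I_8 + 'I_8) := match c with
  | inl c => (c, i.1.2, i.2) | inr c => (i.1.1, c, i.2) end.
pose m (M : plane R -> 'M[R]_7) (i : 'I_8 * 'I_8 * 'I_8) (c : 'I_8 + 'I_8) z := match c with
  | inl c => ext_mx 0 (M z) c i.1.1 | inr c => ext_mx 0 (M z) c i.1.2 end.
have Dy v (M : plane R -> 'M[R]_7) : (forall p, mxD v F p = F p *m M p) ->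
    (forall p, is_der (ext_mx 0 (M p))) ->
    forall i z, 'D_v (y i) z = \sum_c m M i c z * y (f i c) z.
  move=> FM dM [[a b] k] z; rewrite big_sumType /=.
  transitivity (mxD v (Q (delta_mx a 0) (delta_mx b 0)) z k 0); first by rewrite mxE.
  rewrite (DQ _ _ FM dM _ _ _).2 mxE !mulmx_delta_sum Ql Qr !summxE.
  by congr (_ + _); apply: eq_bigr => c _; rewrite mxE.
have cm (M : plane R -> 'M[R]_7) : mxCk setT 0 M -> forall i c, continuous (m M i c).
  move=> cM i c z; have cE : mxCk setT 0 (fun z => ext_mx 0 (M z)) by apply: mxCk_ext_mx => //; exact: openT.
  by case: c => c; exact: (Ck_cont (cE _ _) Logic.I).
have y0 i : y i (0, 0) = 0.
  by rewrite /y /Q /F8 F0 ext_mx1 !mul1mx subrr mxE.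
have yp := plane_ode0 (fun i => cQ _ _ i.2 0) (Dy _ _ FA dA) (Dy _ _ FB dB)
  (cm A cA) (cm B cB) y0.
move=> u w; apply/esym/eqP; rewrite -subr_eq0; apply/eqP.
have -> : u = \sum_i u i 0 *: delta_mx i 0.
  by rewrite {1}(matrix_sum_delta u); apply: eq_bigr => i _; rewrite big_ord1.
have -> : w = \sum_i w i 0 *: delta_mx i 0.
  by rewrite {1}(matrix_sum_delta w); apply: eq_bigr => i _; rewrite big_ord1.
rewrite -/(F8 p) -/(Q _ _ p) Ql big1// => i _; rewrite Qr big1 ?scaler0// => j _.
suff -> : Q (delta_mx i 0) (delta_mx j 0) p = 0 by rewrite scaler0.
by apply/colP => k; rewrite [LHS](yp (i, j, k) p) mxE.
Qed.

End FrameODE.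

(** * Calculus of the Toda derivations *)

Section TodaCalculus.
Variable R : realType.

Lemma mxD_scale_add (V : normedModType R) m n (f : V -> R) (M : 'M[R]_(m, n))
    (G : V -> 'M[R]_(m, n)) x v : derivable f x v -> mxder G x v ->
  mxder (fun y => f y *: M + G y) x v /\
  mxD v (fun y => f y *: M + G y) x = 'D_v f x *: M + mxD v G x.
Proof.
move=> df dG.
have E : (fun y => f y *: M + G y) = (fun y => (\matrix_(i, j) (f y * M i j)) + G y).
  by apply/funext => y; congr (_ + _); apply/matrixP => i j; rewrite !mxE.
have dM : mxder (fun y => \matrix_(i, j) (f y * M i j)) x v.
  move=> i j; under eq_fun do rewrite mxE.
  have dc : derivable (fun _ : V => M i j) x v by exact: derivable_cst.
  exact: (derivableM df dc).
rewrite E; have [d1 ->] := mxD_add dM dG; split; first exact: d1.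
congr (_ + _); apply/matrixP => i j; rewrite [LHS]mxE [RHS]mxE.
under [X in 'D_v X x]eq_fun do rewrite mxE.
exact: derive_mulr_cst.
Qed.

Lemma mxCk_scale_add (V : normedModType R) m n (U : set V) k (f : V -> R)
    (M : 'M[R]_(m, n)) (G : V -> 'M[R]_(m, n)) : open U -> Ck U k f -> mxCk U k G ->
  mxCk U k (fun y => f y *: M + G y).
Proof.
move=> oU cf cG i j; under eq_fun do rewrite !mxE.
by apply: (Ck_add oU); [apply: (Ck_mul oU); [exact: cf|exact: Ck_cst]|exact: cG].
Qed.

(** Linearity in the parameters reduces derivatives and smoothness to constant
matrices. *)
Lemma pmx_lin (t1 t2 b1 b2 g1 g2 : R) : pmx t1 t2 b1 b2 g1 g2 =
  t1 *: pmx 1 0 0 0 0 0 + (t2 *: pmx 0 1 0 0 0 0 + (b1 *: pmx 0 0 1 0 0 0 +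
  (b2 *: pmx 0 0 0 1 0 0 + (g1 *: pmx 0 0 0 0 1 0 + (g2 *: pmx 0 0 0 0 0 1 + 0))))).
Proof.
apply/matrixP => i j; rewrite !mxE; move: i j.
by elim/ord7_ind; elim/ord7_ind; rewrite /=; ring.
Qed.

Lemma tmx_lin (d1 d2 : R) : tmx d1 d2 = d1 *: tmx 1 0 + (d2 *: tmx 0 1 + 0).
Proof.
apply/matrixP => i j; rewrite !mxE; move: i j.
by elim/ord7_ind; elim/ord7_ind; rewrite /=; ring.
Qed.

Lemma mxD_pmx (V : normedModType R) (t1 t2 b1 b2 g1 g2 : V -> R) x v :
  derivable t1 x v -> derivable t2 x v -> derivable b1 x v -> derivable b2 x v ->
  derivable g1 x v -> derivable g2 x v ->
  let P y := pmx (t1 y) (t2 y) (b1 y) (b2 y) (g1 y) (g2 y) in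
  mxder P x v /\
  mxD v P x = pmx ('D_v t1 x) ('D_v t2 x) ('D_v b1 x) ('D_v b2 x) ('D_v g1 x) ('D_v g2 x).
Proof.
move=> d1 d2 d3 d4 d5 d6 P; rewrite {}/P [X in _ = X]pmx_lin.
under eq_fun do rewrite pmx_lin.
have [D0 E0] := mxD_cst (0 : 'M[R]_7) x v.
have [D6 E6] := mxD_scale_add (pmx 0 0 0 0 0 1) d6 D0.
have [D5 E5] := mxD_scale_add (pmx 0 0 0 0 1 0) d5 D6.
have [D4 E4] := mxD_scale_add (pmx 0 0 0 1 0 0) d4 D5.
have [D3 E3] := mxD_scale_add (pmx 0 0 1 0 0 0) d3 D4.
have [D2 E2] := mxD_scale_add (pmx 0 1 0 0 0 0) d2 D3.
have [D1 E1] := mxD_scale_add (pmx 1 0 0 0 0 0) d1 D2.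
by split; [exact: D1|rewrite E1 E2 E3 E4 E5 E6 E0].
Qed.

Lemma mxD_tmx (V : normedModType R) (d1 d2 : V -> R) x v :
  derivable d1 x v -> derivable d2 x v ->
  mxder (fun y => tmx (d1 y) (d2 y)) x v /\
  mxD v (fun y => tmx (d1 y) (d2 y)) x = tmx ('D_v d1 x) ('D_v d2 x).
Proof.
move=> h1 h2; rewrite [X in _ = X]tmx_lin; under eq_fun do rewrite tmx_lin.
have [D0 E0] := mxD_cst (0 : 'M[R]_7) x v.
have [D2 E2] := mxD_scale_add (tmx 0 1) h2 D0.
have [D1 E1] := mxD_scale_add (tmx 1 0) h1 D2.
by split; [exact: D1|rewrite E1 E2 E0].
Qed.

Lemma mxCk_pmx (V : normedModType R) (U : set V) k (t1 t2 b1 b2 g1 g2 : V -> R) : open U ->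
  Ck U k t1 -> Ck U k t2 -> Ck U k b1 -> Ck U k b2 -> Ck U k g1 -> Ck U k g2 ->
  mxCk U k (fun y => pmx (t1 y) (t2 y) (b1 y) (b2 y) (g1 y) (g2 y)).
Proof.
move=> oU c1 c2 c3 c4 c5 c6; under eq_fun do rewrite pmx_lin.
do 6![apply: mxCk_scale_add => //]; exact: mxCk_cst.
Qed.

Lemma mxCk_tmx (V : normedModType R) (U : set V) k (d1 d2 : V -> R) : open U ->
  Ck U k d1 -> Ck U k d2 -> mxCk U k (fun y => tmx (d1 y) (d2 y)).
Proof.
move=> oU c1 c2; under eq_fun do rewrite tmx_lin.
do 2![apply: mxCk_scale_add => //]; exact: mxCk_cst.
Qed.

Lemma pmx_add (t1 t2 b1 b2 g1 g2 t1' t2' b1' b2' g1' g2' : R) :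
  pmx t1 t2 b1 b2 g1 g2 + pmx t1' t2' b1' b2' g1' g2' =
  pmx (t1 + t1') (t2 + t2') (b1 + b1') (b2 + b2') (g1 + g1') (g2 + g2').
Proof.
apply/matrixP => i j; rewrite !mxE; move: i j.
by elim/ord7_ind; elim/ord7_ind; rewrite /=; ring.
Qed.

End TodaCalculus.

(** * Complex-valued functions on the plane *)

Section ComplexCalculus.
Variable R : realType.
Local Notation C := R[i].

Lemma Ck_id (U : set R) k : Ck U k (id : R -> R).
Proof.
have cid : continuous (id : R -> R) by move=> x; exact: cvg_id.
have cU : {in U, continuous (id : R -> R)} by move=> x _; exact: cid.
case: k => [|k]; first by split.
split; first exact: cU.
move=> v; split => [x _|]; first exact: derivable_id.
have -> : 'D_v (id : R -> R) = fun=> v by apply/funext => x; exact: derive_id.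
exact: Ck_cst.
Qed.

Lemma Ck_fst k : Ck setT k (fst : plane R -> R).
Proof.
have := @Ck_affine R (plane R) R fst fst setT k id.
by apply => [p|//|]; [exact: cvg_fst|exact: Ck_id].
Qed.

Lemma Ck_snd k : Ck setT k (snd : plane R -> R).
Proof.
have := @Ck_affine R (plane R) R snd snd setT k id.
by apply => [p|//|]; [exact: cvg_snd|exact: Ck_id].
Qed.

Lemma derive_fst (v p : plane R) : 'D_v (fst : plane R -> R) p = v.1.
Proof.
have := @derive_affine R (plane R) R fst fst id v p.
by move=> ->//; rewrite derive_id.
Qed.

Lemma derive_snd (v p : plane R) : 'D_v (snd : plane R -> R) p = v.2.
Proof.
have := @derive_affine R (plane R) R snd snd id v p.
by move=> ->//; rewrite derive_id.
Qed.

(** The Cauchy-Riemann equations propagate through the Horner scheme. *)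
Lemma poly_smooth_CR (q : {poly C}) :
  let a p := complex.Re (qval q p) in let b p := complex.Im (qval q p) in
  [/\ forall k, Ck setT k a, forall k, Ck setT k b,
    forall p, 'D_(diry R) a p = - 'D_(dirx R) b p
    & forall p, 'D_(diry R) b p = 'D_(dirx R) a p].
Proof.
elim/poly_ind: q => [|q c [ca cb CR1 CR2]] a b.
  have -> : a = fun=> 0 by apply/funext => p; rewrite /a /qval horner0.
  have -> : b = fun=> 0 by apply/funext => p; rewrite /b /qval horner0.
  by split=> [k|k|p|p]; [exact: Ck_cst|exact: Ck_cst|rewrite !derive_cst oppr0|rewrite !derive_cst].
set a' := fun p => complex.Re (qval q p) in ca CR1 CR2.
set b' := fun p => complex.Im (qval q p) in cb CR1 CR2.
have aE : a = fun p => a' p * p.1 + - (b' p * p.2) + complex.Re c.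
  apply/funext => p; rewrite /a /a' /b' /qval hornerD hornerM hornerX hornerC /zcoord.
  by case: (q.[_]) => u w; case: (c) => c1 c2.
have bE : b = fun p => a' p * p.2 + b' p * p.1 + complex.Im c.
  apply/funext => p; rewrite /b /a' /b' /qval hornerD hornerM hornerX hornerC /zcoord.
  by case: (q.[_]) => u w; case: (c) => c1 c2.
have oT : open (setT : set (plane R)) by exact: openT.
have da v p : derivable a' p v by exact: Ck_der (ca 1%N) Logic.I.
have db v p : derivable b' p v by exact: Ck_der (cb 1%N) Logic.I.
have d1 v p : derivable (fst : plane R -> R) p v by exact: Ck_der (Ck_fst 1) Logic.I.
have d2 v p : derivable (snd : plane R -> R) p v by exact: Ck_der (Ck_snd 1) Logic.I.
have D2 (f g : plane R -> R) (c0 : R) v p : derivable f p v -> derivable g p v ->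
    'D_v (fun p => f p + g p + c0) p = 'D_v f p + 'D_v g p.
  move=> df dg; have dc : derivable (fun _ : plane R => c0) p v by exact: derivable_cst.
  by rewrite (deriveD (derivableD df dg) dc) (deriveD df dg) derive_cst addr0.
have DM (f g : plane R -> R) v p : derivable f p v -> derivable g p v ->
    'D_v (fun p => f p * g p) p = f p * 'D_v g p + g p * 'D_v f p.
  by move=> df dg; rewrite (deriveM df dg).
have DN (f : plane R -> R) v p : derivable f p v -> 'D_v (fun p => - f p) p = - 'D_v f p.
  by move=> df; rewrite (deriveN df).
have dM (f g : plane R -> R) v p : derivable f p v -> derivable g p v ->
    derivable (fun p => f p * g p) p v by move=> df dg; exact: (derivableM df dg).
have dN (f : plane R -> R) v p : derivable f p v -> derivable (fun p => - f p) p v.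
  by move=> df; exact: (derivableN df).
have Da v p : 'D_v a p = a' p * v.1 + p.1 * 'D_v a' p - (b' p * v.2 + p.2 * 'D_v b' p).
  rewrite aE (D2 _ _ _ _ _ (dM _ _ _ _ (da v p) (d1 v p)) (dN _ _ _ (dM _ _ _ _ (db v p) (d2 v p)))).
  by rewrite (DN _ _ _ (dM _ _ _ _ (db v p) (d2 v p))) (DM _ _ _ _ (da v p) (d1 v p))
    (DM _ _ _ _ (db v p) (d2 v p)) derive_fst derive_snd.
have Db v p : 'D_v b p = a' p * v.2 + p.2 * 'D_v a' p + (b' p * v.1 + p.1 * 'D_v b' p).
  rewrite bE (D2 _ _ _ _ _ (dM _ _ _ _ (da v p) (d2 v p)) (dM _ _ _ _ (db v p) (d1 v p))).
  by rewrite (DM _ _ _ _ (da v p) (d2 v p))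
    (DM _ _ _ _ (db v p) (d1 v p)) derive_fst derive_snd.
split=> [k|k|p|p].
- rewrite aE; apply: (Ck_add oT); last exact: Ck_cst.
  apply: (Ck_add oT); first exact: (Ck_mul oT (ca k) (Ck_fst k)).
  exact: (Ck_opp oT (Ck_mul oT (cb k) (Ck_snd k))).
- rewrite bE; apply: (Ck_add oT); last exact: Ck_cst.
  apply: (Ck_add oT); first exact: (Ck_mul oT (ca k) (Ck_snd k)).
  exact: (Ck_mul oT (cb k) (Ck_fst k)).
- rewrite Da Db CR1 CR2 /dirx /diry /=.
  move: ('D__ a' p) ('D__ b' p) (a' p) (b' p) => w x y z; ring.
- rewrite Da Db CR1 CR2 /dirx /diry /=.
  move: ('D__ a' p) ('D__ b' p) (a' p) (b' p) => w x y z; ring.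
Qed.

(** ** Complex matrices as pairs of real ones *)

Definition cpx m n (A B : 'M[R]_(m, n)) : 'M[C]_(m, n) := \matrix_(i, j) (A i j +i* B i j).

Lemma cpx_eta m n (F : 'M[C]_(m, n)) : F = cpx (Re_mx F) (Im_mx F).
Proof. by apply/matrixP => i j; rewrite !mxE; case: (F i j). Qed.

Lemma Re_cpx m n (A B : 'M[R]_(m, n)) : Re_mx (cpx A B) = A.
Proof. by apply/matrixP => i j; rewrite !mxE. Qed.

Lemma Im_cpx m n (A B : 'M[R]_(m, n)) : Im_mx (cpx A B) = B.
Proof. by apply/matrixP => i j; rewrite !mxE. Qed.

Lemma ReD (x y : C) : complex.Re (x + y) = complex.Re x + complex.Re y.
Proof. by case: x y => [a b] [c d]. Qed.
Lemma ImD (x y : C) : complex.Im (x + y) = complex.Im x + complex.Im y.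
Proof. by case: x y => [a b] [c d]. Qed.

Lemma cpxM m n p (A B : 'M[R]_(m, n)) (A' B' : 'M[R]_(n, p)) :
  cpx A B *m cpx A' B' = cpx (A *m A' - B *m B') (A *m B' + B *m A').
Proof.
apply/matrixP => i j; rewrite !mxE.
apply/eqP; rewrite eq_complex /=; apply/andP; split; apply/eqP.
  rewrite (big_morph _ ReD (erefl _)) -sumrB; apply: eq_bigr => k _.
  by rewrite !mxE.
rewrite (big_morph _ ImD (erefl _)) -big_split; apply: eq_bigr => k _.
by rewrite !mxE.
Qed.

Lemma cpxD m n (A B A' B' : 'M[R]_(m, n)) : cpx A B + cpx A' B' = cpx (A + A') (B + B').
Proof. by apply/matrixP => i j; rewrite !mxE. Qed.

Lemma cpx_real m n (A : 'M[R]_(m, n)) : cplx A = cpx A 0.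
Proof. by apply/matrixP => i j; rewrite !mxE. Qed.

Definition mxcD m n (v : plane R) (F : plane R -> 'M[C]_(m, n)) (p : plane R) : 'M[C]_(m, n) :=
  cpx (mxD v (fun p => Re_mx (F p)) p) (mxD v (fun p => Im_mx (F p)) p).

Definition mxcCk m n (k : nat) (F : plane R -> 'M[C]_(m, n)) : Prop :=
  mxCk setT k (fun p => Re_mx (F p)) /\ mxCk setT k (fun p => Im_mx (F p)).

Lemma mxcCk_mul m n l k (F : plane R -> 'M[C]_(m, n)) (G : plane R -> 'M[C]_(n, l)) :
  mxcCk k F -> mxcCk k G -> mxcCk k (fun p => F p *m G p).
Proof.
move=> [F1 F2] [G1 G2].
have oT : open (setT : set (plane R)) by exact: openT.
have FG p : F p *m G p = cpx (Re_mx (F p) *m Re_mx (G p) - Im_mx (F p) *m Im_mx (G p))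
    (Re_mx (F p) *m Im_mx (G p) + Im_mx (F p) *m Re_mx (G p)).
  by rewrite -cpxM -!cpx_eta.
split.
  under eq_fun do rewrite FG Re_cpx.
  apply: (mxCk_add oT); first exact: (mxCk_mul oT F1 G1).
  exact: (mxCk_lin (-%R : {linear 'M[R]_(m, l) -> 'M[R]_(m, l)}) oT (mxCk_mul oT F2 G2)).
under eq_fun do rewrite FG Im_cpx.
apply: (mxCk_add oT); first exact: (mxCk_mul oT F1 G2).
exact: (mxCk_mul oT F2 G1).
Qed.

Lemma mxcD_mul m n l (F : plane R -> 'M[C]_(m, n)) (G : plane R -> 'M[C]_(n, l)) v p :
  mxcCk 1 F -> mxcCk 1 G ->
  mxcD v (fun p => F p *m G p) p = mxcD v F p *m G p + F p *m mxcD v G p.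
Proof.
move=> [F1 F2] [G1 G2].
have f1 := mxCk_der F1 (Logic.I : setT p) (v := v).
have f2 := mxCk_der F2 (Logic.I : setT p) (v := v).
have g1 := mxCk_der G1 (Logic.I : setT p) (v := v).
have g2 := mxCk_der G2 (Logic.I : setT p) (v := v).
have FG p' : F p' *m G p' = cpx (Re_mx (F p') *m Re_mx (G p') - Im_mx (F p') *m Im_mx (G p'))
    (Re_mx (F p') *m Im_mx (G p') + Im_mx (F p') *m Re_mx (G p')).
  by rewrite -cpxM -!cpx_eta.
rewrite {1}/mxcD.
under [X in mxD v X p]eq_fun do rewrite FG Re_cpx.
under [X in cpx _ (mxD v X p)]eq_fun do rewrite FG Im_cpx.
have [a1 A1] := mxD_mul f1 g1; have [a2 A2] := mxD_mul f2 g2.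
have [a3 A3] := mxD_mul f1 g2; have [a4 A4] := mxD_mul f2 g1.
have [a5 A5] := mxD_lin (-%R : {linear 'M[R]_(m, l) -> 'M[R]_(m, l)}) a2.
rewrite (mxD_add a1 a5).2 (mxD_add a3 a4).2 A5 A1 A2 A3 A4 /=.
transitivity (mxcD v F p *m cpx (Re_mx (G p)) (Im_mx (G p)) +
  cpx (Re_mx (F p)) (Im_mx (F p)) *m mxcD v G p); last by rewrite -!cpx_eta.
rewrite /mxcD !cpxM cpxD.
by congr cpx; [rewrite opprD addrACA|rewrite addrACA].
Qed.

Lemma mxcD_cst m n (M : 'M[C]_(m, n)) v p : mxcD v (fun=> M) p = 0.
Proof. by rewrite /mxcD !(mxD_cst _ _ _).2; apply/matrixP => i j; rewrite !mxE. Qed.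

Lemma mxcCk_cst m n k (M : 'M[C]_(m, n)) : mxcCk k (fun=> M).
Proof. by split; exact: mxCk_cst. Qed.

Lemma mxcDE m n (F : plane R -> 'M[C]_(m, n)) v p i j :
  mxcD v F p i j = cderive v (fun p => F p i j) p.
Proof.
rewrite !mxE /cderive; congr (_ +i* _).
  by under [X in 'D_v X p]eq_fun do rewrite mxE.
by under [X in 'D_v X p]eq_fun do rewrite mxE.
Qed.

Lemma sqr_i : ('i : C) * 'i = -1.
Proof. by rewrite -expr2 sqr_i. Qed.

Lemma mxcD_dirx m n (F : plane R -> 'M[C]_(m, n)) p :
  mxcD (dirx R) F p = mx_dz F p + mx_dzbar F p.
Proof.
apply/matrixP => i j; rewrite mxcDE !mxE /dz /dzbar.
by move: (cderive _ _ p) (cderive _ _ p) => a b; field.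
Qed.

Lemma mxcD_diry m n (F : plane R -> 'M[C]_(m, n)) p :
  mxcD (diry R) F p = 'i *: (mx_dz F p - mx_dzbar F p).
Proof.
apply/matrixP => i j; rewrite mxcDE !mxE /dz /dzbar.
move: (cderive _ _ p) (cderive _ _ p) => a b.
transitivity (- ('i * 'i) * b); first by rewrite sqr_i opprK mul1r.
by field.
Qed.

End ComplexCalculus.

(** * The weight basis *)

Section WeightBasis.
Variable R : realType.
Local Notation C := R[i].

Lemma sub_col7 (u v : seq R) : col7 u - col7 v = col7 (linS (-1) v u).
Proof. by rewrite -lin_col7 scaleN1r addrC. Qed.

(** Real and imaginary parts of the weight basis, cleared of its factors
[1 / sqrt 2], which therefore disappear from the identities below. *)
Definition ebR : 'M[R]_7 := mx7
  [:: [:: 0; 0; 0; 1; 0; 0; 0];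
      [:: 0; 1; 0; 0; 0; 1; 0];
      [:: 0; 0; 0; 0; 0; 0; 0];
      [:: 0; 0; 1; 0; 1; 0; 0];
      [:: 0; 0; 0; 0; 0; 0; 0];
      [:: -1; 0; 0; 0; 0; 0; -1];
      [:: 0; 0; 0; 0; 0; 0; 0]].
Definition ebI : 'M[R]_7 := mx7
  [:: [:: 0; 0; 0; 0; 0; 0; 0];
      [:: 0; 0; 0; 0; 0; 0; 0];
      [:: 0; 1; 0; 0; 0; -1; 0];
      [:: 0; 0; 0; 0; 0; 0; 0];
      [:: 0; 0; -1; 0; 1; 0; 0];
      [:: 0; 0; 0; 0; 0; 0; 0];
      [:: -1; 0; 0; 0; 0; 0; 1]].
Definition eb := cpx ebR ebI.

Definition ccoef (n : 'I_7) : R := if n == 3%:R then 1 else (Num.sqrt 2)^-1.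

Lemma crossjl : cross (mbasis C 1) (mbasis C 3%:R) = - mbasis C 5%:R.
Proof. by apply/colP => i; rewrite crossE /cross_coords !mxE; elim/ord7_ind: i; rewrite /=; ring. Qed.
Lemma crosskl : cross (mbasis C 2%:R) (mbasis C 3%:R) = - mbasis C 6%:R.
Proof. by apply/colP => i; rewrite crossE /cross_coords !mxE; elim/ord7_ind: i; rewrite /=; ring. Qed.
Lemma crossil : cross (mbasis C 0) (mbasis C 3%:R) = - mbasis C 4%:R.
Proof. by apply/colP => i; rewrite crossE /cross_coords !mxE; elim/ord7_ind: i; rewrite /=; ring. Qed.

Lemma ebasisE : ebasis R = eb *m diagC ccoef.
Proof.
apply/matrixP => i j; rewrite mul_mx_diag !mxE /evec crossjl crosskl crossil.
move: i j; elim/ord7_ind; elim/ord7_ind; rewrite /ccoef /= !mxE /=;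
  rewrite ?mulr1 ?mulr0 ?addr0 ?oppr0 ?subr0 ?add0r ?sub0r ?mulr0 ?mulrN ?mulr1; apply/eqP; rewrite eq_complex /= ;
  apply/andP; split; apply/eqP; ring.
Qed.

Definition ebinvR : 'M[R]_7 := mx7
  [:: [:: 0; 0; 0; 0; 0; - 2^-1; 0];
      [:: 0; 2^-1; 0; 0; 0; 0; 0];
      [:: 0; 0; 0; 2^-1; 0; 0; 0];
      [:: 1; 0; 0; 0; 0; 0; 0];
      [:: 0; 0; 0; 2^-1; 0; 0; 0];
      [:: 0; 2^-1; 0; 0; 0; 0; 0];
      [:: 0; 0; 0; 0; 0; - 2^-1; 0]].
Definition ebinvI : 'M[R]_7 := mx7
  [:: [:: 0; 0; 0; 0; 0; 0; 2^-1];
      [:: 0; 0; - 2^-1; 0; 0; 0; 0];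
      [:: 0; 0; 0; 0; 2^-1; 0; 0];
      [:: 0; 0; 0; 0; 0; 0; 0];
      [:: 0; 0; 0; 0; - 2^-1; 0; 0];
      [:: 0; 0; 2^-1; 0; 0; 0; 0];
      [:: 0; 0; 0; 0; 0; 0; - 2^-1]].

Lemma eb_unit : eb \in unitmx.
Proof.
suff : eb *m cpx ebinvR ebinvI = 1%:M by case/mulmx1_unit.
rewrite cpxM.
have -> : ebR *m ebinvR - ebI *m ebinvI = 1%:M.
  apply: mulmx_ext => x; rewrite mulmxBl -!mulmxA mul1mx (col7_eta x).
  set xs := [:: x _ _; _; _; _; _; _; _].
  rewrite /ebR /ebI /ebinvR /ebinvI !(mx7_col7, sub_col7) /xs; apply: col7_eq.
  by cbv [rowS nth linS]; congr [:: _; _; _; _; _; _; _]; field.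
have -> : ebR *m ebinvI + ebI *m ebinvR = 0.
  apply: mulmx_ext => x; rewrite mulmxDl -!mulmxA mul0mx (col7_eta x).
  set xs := [:: x _ _; _; _; _; _; _; _].
  rewrite /ebR /ebI /ebinvR /ebinvI !(mx7_col7, add_col7) /xs.
  transitivity (col7 (nseq 7 0 : seq R)); last by apply/colP; elim/ord7_ind; rewrite !mxE.
  apply: col7_eq.
  by cbv [rowS nth linS nseq ncons iter]; congr [:: _; _; _; _; _; _; _]; field.
apply/matrixP => i j; rewrite !mxE.
by case: (i == j).
Qed.

Section Higgs.
Variables t1 t2 b1 b2 g1 g2 : R.

(** Real and imaginary parts of the sum of the Higgs field and its adjoint in the
rescaled weight basis, where the factors [sqrt 2] become [1] or [2]. *)
Definition higgsR : 'M[R]_7 := mx7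
  [:: [:: 0; t1; 0; 0; 0; g1; 0];
      [:: t1; 0; b1; 0; 0; 0; g1];
      [:: 0; b1; 0; t2; 0; 0; 0];
      [:: 0; 0; 2 * t2; 0; 2 * t2; 0; 0];
      [:: 0; 0; 0; t2; 0; b1; 0];
      [:: g1; 0; 0; 0; b1; 0; t1];
      [:: 0; g1; 0; 0; 0; t1; 0]].
Definition higgsI : 'M[R]_7 := mx7
  [:: [:: 0; - t2; 0; 0; 0; g2; 0];
      [:: t2; 0; - b2; 0; 0; 0; g2];
      [:: 0; b2; 0; t1; 0; 0; 0];
      [:: 0; 0; - 2 * t1; 0; 2 * t1; 0; 0];
      [:: 0; 0; 0; - t1; 0; - b2; 0];
      [:: - g2; 0; 0; 0; b2; 0; - t2];
      [:: 0; - g2; 0; 0; 0; t2; 0]].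

Lemma eb_higgs : eb *m cpx higgsR higgsI = cplx (pmx t1 t2 b1 b2 g1 g2) *m eb.
Proof.
rewrite cpx_real !cpxM !mul0mx subr0 addr0; congr cpx; apply: mulmx_ext => x.
  rewrite mulmxBl -!mulmxA (col7_eta x); set xs := [:: x _ _; _; _; _; _; _; _].
  rewrite /ebR /ebI /higgsR /higgsI /pmx !(mx7_col7, sub_col7) /xs; apply: col7_eq.
  by cbv [rowS nth linS]; congr [:: _; _; _; _; _; _; _]; ring.
rewrite mulmxDl -!mulmxA (col7_eta x); set xs := [:: x _ _; _; _; _; _; _; _].
rewrite /ebR /ebI /higgsR /higgsI /pmx !(mx7_col7, add_col7) /xs; apply: col7_eq.
by cbv [rowS nth linS]; congr [:: _; _; _; _; _; _; _]; ring.
Qed.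

(** The weights of [tmx d1 d2], divided by [sqrt(-1)]. *)
Definition wt (d1 d2 : R) : seq R := [:: d1; d2; d1 - d2; 0; d2 - d1; - d2; - d1].

Lemma eb_weights d1 d2 :
  eb *m cpx 0 (diag_mx (\row_i (wt d1 d2)`_i)) = cplx (tmx d1 d2) *m eb.
Proof.
rewrite cpx_real !cpxM !mul0mx !mulmx0 sub0r !addr0 subr0; congr cpx.
  apply/matrixP => i j; rewrite mxE mul_mx_diag 2!mxE /ebI /ebR [RHS]mxE sum7.
  rewrite /tmx !mxE; move: i j.
  by elim/ord7_ind; elim/ord7_ind; rewrite /=; ring.
apply/matrixP => i j; rewrite mul_mx_diag 2!mxE /ebI /ebR [RHS]mxE sum7.
rewrite /tmx !mxE; move: i j.
by elim/ord7_ind; elim/ord7_ind; rewrite /=; ring.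
Qed.

End Higgs.

(** The shape of the Higgs field in the unitary weight frame. *)
Definition Phi (t b g : C) : 'M[C]_7 :=
  let a := - 'i * (Num.sqrt 2)%:C * t in
  \matrix_(m, n) nth 0 (nth [::]
    [:: [:: 0; 0; 0; 0; 0; g; 0];
        [:: t; 0; 0; 0; 0; 0; g];
        [:: 0; b; 0; 0; 0; 0; 0];
        [:: 0; 0; a; 0; 0; 0; 0];
        [:: 0; 0; 0; a; 0; 0; 0];
        [:: 0; 0; 0; 0; b; 0; 0];
        [:: 0; 0; 0; 0; 0; t; 0]] m) n.

Lemma Phi_higgs t1 t2 b1 b2 g1 g2 :
  let P := Phi (t1 +i* t2) (b1 +i* b2) (g1 +i* g2) in
  diagC ccoef *m (P + (map_mx (@conjc R) P)^T) =
  cpx (higgsR t1 t2 b1 g1) (higgsI t1 t2 b2 g2) *m diagC ccoef.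
Proof.
set s := Num.sqrt (2 : R); set c := s^-1.
have s0 : s != 0 by rewrite sqrtr_eq0 -ltNge ltr0n.
have ss : s * s = 2 by rewrite -expr2 sqr_sqrtr.
have sE : s = 2 * c by rewrite /c -ss mulfK.
have cc (x : R) : 2 * (c * c) * x = x by rewrite mulrA -sE mulfV// mul1r.
move=> P; apply/matrixP => i j; rewrite mul_diag_mx mul_mx_diag !mxE.
have := cc t1; have := cc t2.
move=> ct2 ct1; rewrite /ccoef -/s -/c sE; clear P ss s0 cc sE; clearbody c; clear s.
move: i j; elim/ord7_ind; elim/ord7_ind; rewrite /=;
  apply/eqP; rewrite eq_complex /=; apply/andP; split; apply/eqP; first [by ring | by lra].
Qed.

End WeightBasis.

(** * The structure equations of the Toda frame *)

Section DiagonalMatrices.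
Variable R : realType.
Local Notation C := R[i].

Definition dg (d : 'I_7 -> R) : 'M[R]_7 := diag_mx (\row_n d n).

Lemma diagCE (d : 'I_7 -> R) : diagC d = cpx (dg d) 0.
Proof.
apply/matrixP => i j; rewrite !mxE.
by case: (i == j).
Qed.

Lemma dgM (d d' : 'I_7 -> R) : dg d *m dg d' = dg (fun n => d n * d' n).
Proof. by rewrite /dg mulmx_diag; congr diag_mx; apply/rowP => j; rewrite !mxE. Qed.

Lemma diagCM (d d' : 'I_7 -> R) : diagC d *m diagC d' = diagC (fun n => d n * d' n).
Proof. by rewrite !diagCE cpxM dgM !mul0mx !mulmx0 subr0 addr0. Qed.

Lemma diagC1 : diagC (fun=> 1 : R) = 1%:M.
Proof.
by apply/matrixP => i j; rewrite !mxE.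
Qed.

Lemma diagCV (d d' : 'I_7 -> R) : (forall n, d n * d' n = 1) ->
  diagC d \in unitmx /\ invmx (diagC d) = diagC d'.
Proof.
move=> dd'; have E : diagC d *m diagC d' = 1%:M.
  by rewrite diagCM -diagC1; congr diagC; apply/funext => n; rewrite dd'.
have [ud _] := mulmx1_unit E; split => //.
by rewrite -[LHS]mulmx1 -E mulKmx.
Qed.

Lemma Re_diagC (d : 'I_7 -> R) : Re_mx (diagC d) = dg d.
Proof. by rewrite diagCE Re_cpx. Qed.
Lemma Im_diagC (d : 'I_7 -> R) : Im_mx (diagC d) = 0.
Proof. by rewrite diagCE Im_cpx. Qed.

Lemma mxD_dg (d : 'I_7 -> plane R -> R) v p :
  mxD v (fun p => dg (d^~ p)) p = dg (fun n => 'D_v (d n) p).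
Proof.
apply/matrixP => i j; rewrite !mxE.
under [X in 'D_v X p]eq_fun do rewrite !mxE.
have [->|ij] := eqVneq i j; first by [].
by rewrite derive_cst.
Qed.

Lemma mxcD_diagC (d : 'I_7 -> plane R -> R) v p :
  mxcD v (fun p => diagC (d^~ p)) p = diagC (fun n => 'D_v (d n) p).
Proof.
rewrite /mxcD.
under [X in mxD v X p]eq_fun do rewrite Re_diagC.
under [X in cpx _ (mxD v X p)]eq_fun do rewrite Im_diagC.
by rewrite mxD_dg (mxD_cst _ _ _).2 diagCE.
Qed.

Lemma mxcCk_diagC k (d : 'I_7 -> plane R -> R) : (forall n, Ck setT k (d n)) ->
  mxcCk k (fun p => diagC (d^~ p)).
Proof.
move=> cd; split; last by under eq_fun do rewrite Im_diagC; exact: mxCk_cst.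
under eq_fun do rewrite Re_diagC.
move=> i j; under eq_fun do rewrite !mxE.
by have [->|ij] := eqVneq i j; [exact: cd|exact: Ck_cst].
Qed.

Lemma mx_dzE m n (F : plane R -> 'M[C]_(m, n)) p :
  mx_dz F p = 2^-1 *: (mxcD (dirx R) F p - 'i *: mxcD (diry R) F p).
Proof. by apply/matrixP => i j; rewrite [LHS]mxE /dz -!mxcDE;
  move: (mxcD _ F p) (mxcD _ F p) => A B; rewrite !mxE mulrC. Qed.

Lemma scale_i_cpx m n (A B : 'M[R]_(m, n)) : 'i *: cpx A B = cpx (- B) A.
Proof.
apply/matrixP => i j; rewrite !mxE.
by apply/eqP; rewrite eq_complex /=; apply/andP; split; apply/eqP; ring.
Qed.

Lemma scale_half_cpx m n (A B : 'M[R]_(m, n)) : 2^-1 *: cpx A B = cpx (2^-1 *: A) (2^-1 *: B).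
Proof.
apply/matrixP => i j; rewrite !mxE.
have -> : (2^-1 : C) = (2^-1 : R)%:C.
  apply: (mulfI (_ : (2 : C) != 0)); first by rewrite pnatr_eq0.
  rewrite mulfV ?pnatr_eq0//.
  by apply/eqP; rewrite eq_complex /=; apply/andP; split; apply/eqP; field.
by apply/eqP; rewrite eq_complex /=; apply/andP; split; apply/eqP; ring.
Qed.

Lemma dz_diag_comb (e a b : 'I_7 -> R) :
  2^-1 *: (diagC e *m diagC a - 'i *: (diagC e *m diagC b)) =
  diagC e *m cpx (dg (fun n => 2^-1 * a n)) (dg (fun n => - (2^-1 * b n))).
Proof.
rewrite !diagCM !diagCE scale_i_cpx cpxM !mul0mx subr0 addr0.
have -> (A B B' : 'M[R]_7) : cpx A 0 - cpx B B' = cpx (A - B) (- B').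
  by apply/matrixP => i j; rewrite !mxE; apply/eqP; rewrite eq_complex /= add0r !eqxx.
rewrite scale_half_cpx oppr0 subr0 !dgM; congr cpx; apply/matrixP => i j; rewrite !mxE.
  by case: (i == j); rewrite ?mulr1n ?mulr0n ?mulr0// mulrCA.
by case: (i == j); rewrite ?mulr1n ?mulr0n ?oppr0 ?mulr0// !mulrN mulrCA.
Qed.

Lemma conn_diag (e a b : 'I_7 -> R) :
  'i *: cpx (dg a) (dg (fun n => - b n)) *m diagC e - diagC e *m diagC b =
  diagC e *m cpx 0 (dg a).
Proof.
rewrite scale_i_cpx !diagCE.
have -> : - dg (fun n => - b n) = dg b.
  by apply/matrixP => i j; rewrite !mxE; case: (i == j); rewrite ?mulr1n ?mulr0n ?oppr0 ?opprK.
rewrite !cpxM !mul0mx !mulmx0 subr0 addr0 add0r addr0 !subr0 !dgM.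
have -> (A B A' B' : 'M[R]_7) : cpx A B - cpx A' B' = cpx (A - A') (B - B').
  by apply/matrixP => i j; rewrite !mxE.
congr cpx; apply/matrixP => i j; rewrite !mxE.
  by case: (i == j); rewrite ?mulr1n ?mulr0n ?subrr// mulrC subrr.
by case: (i == j); rewrite ?mulr1n ?mulr0n ?subr0// mulrC.
Qed.

Definition dagger (A : 'M[C]_7) : 'M[C]_7 := (map_mx (@conjc R) A)^T.

Lemma daggerM A B : dagger (A *m B) = dagger B *m dagger A.
Proof. by rewrite /dagger map_mxM trmx_mul. Qed.

Lemma dagger_diagC d : dagger (diagC d) = diagC d.
Proof.
apply/matrixP => i j; rewrite !mxE eq_sym.
have [->|ij] := eqVneq i j; last by rewrite !mulr0n rmorph0.
by rewrite !mulr1n; apply/eqP; rewrite eq_complex /= oppr0 !eqxx.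
Qed.

Lemma dagger_i (A : 'M[C]_7) : dagger ('i *: A) = - 'i *: dagger A.
Proof. by apply/matrixP => i j; rewrite !mxE; case: (A j i) => a b;
  apply/eqP; rewrite eq_complex /=; apply/andP; split; apply/eqP; ring. Qed.

End DiagonalMatrices.

Section TodaFrame.
Variable R : realType.
Local Notation C := R[i].
Variables (q : {poly C}) (u1 u2 : plane R -> R) (psi : plane R -> 'M[C]_7).
Hypothesis su1 : smooth u1.
Hypothesis su2 : smooth u2.
Hypothesis hpsi : parallel_translation q u1 u2 psi.

Let du1 v p : derivable u1 p v. Proof. exact: (Ck_der (su1 1) Logic.I). Qed.
Let du2 v p : derivable u2 p v. Proof. exact: (Ck_der (su2 1) Logic.I). Qed.
Let oT : open (setT : set (plane R)). Proof. exact: openT. Qed.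

(** The logarithms of the entries of [H] are the weights of the seven-dimensional
representation, as linear forms in [u1] and [u2]. *)
Definition walpha : seq R := [:: -1; -1; 0; 0; 0; 1; 1].
Definition wbeta : seq R := [:: -1; 1; -2; 0; 2; -1; 1].
Definition hw (n : 'I_7) (p : plane R) : R := walpha`_n * u1 p + wbeta`_n * u2 p.

Lemma Hcoef_hw p n : Hcoef u1 u2 p n = expR (hw n p).
Proof.
rewrite /Hcoef /rfun /sfun /hw -!expRD -!expRN; move: n; elim/ord7_ind => /=;
  first [by congr expR; ring | by rewrite -[LHS]expR0; congr expR; ring].
Qed.

Definition ehw (a : R) (p : plane R) (n : 'I_7) : R := expR (a * hw n p).

Lemma ehwM a b c p : a + b = c -> diagC (ehw a p) *m diagC (ehw b p) = diagC (ehw c p).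
Proof.
move=> <-; rewrite diagCM; congr diagC; apply/funext => n.
by rewrite /ehw -expRD mulrDl.
Qed.

Lemma ehw0 p : diagC (ehw 0 p) = 1%:M.
Proof.
by rewrite -diagC1; congr diagC; apply/funext => n; rewrite /ehw mul0r expR0.
Qed.

Lemma HmxE p : Hmx u1 u2 p = diagC (ehw 1 p).
Proof. by congr diagC; apply/funext => n; rewrite Hcoef_hw /ehw mul1r. Qed.

Lemma HsqrtE p : Hsqrt u1 u2 p = diagC (ehw 2^-1 p).
Proof.
congr diagC; apply/funext => n; rewrite Hcoef_hw /ehw.
have -> : expR (hw n p) = expR (2^-1 * hw n p) ^+ 2.
  by rewrite expr2 -expRD -mulrDl -div1r -splitr mul1r.
by rewrite sqrtr_sqr ger0_norm// expR_ge0.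
Qed.

Lemma expOmegaE p : expOmega u1 u2 p = diagC (ehw (- 2^-1) p).
Proof.
congr diagC; apply/funext => n; rewrite /ehw /Omega Hcoef_hw expRK.
by rewrite mulNr mulrC mulNr.
Qed.

Lemma invHmx p : invmx (Hmx u1 u2 p) = diagC (ehw (-1) p).
Proof.
rewrite HmxE; apply: (diagCV _).2 => n.
by rewrite /ehw -expRD -mulrDl subrr mul0r expR0.
Qed.

Lemma invHsqrt p : invmx (Hsqrt u1 u2 p) = expOmega u1 u2 p.
Proof.
rewrite HsqrtE expOmegaE; apply: (diagCV _).2 => n.
by rewrite /ehw -expRD -mulrDl subrr mul0r expR0.
Qed.

Lemma Ck_hw n k : Ck setT k (hw n).
Proof.
by apply: (Ck_add oT); apply: (Ck_mul oT); first [exact: Ck_cst|exact: su1|exact: su2].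
Qed.

Lemma derive_mull_cst (V : normedModType R) (f : V -> R) (c : R) x v : derivable f x v ->
  derivable (fun y => c * f y) x v /\ 'D_v (fun y => c * f y) x = c * 'D_v f x.
Proof.
move=> df; have dc : derivable (fun _ : V => c) x v by exact: derivable_cst.
split; first exact: (derivableM dc df).
under [X in 'D_v X x]eq_fun do rewrite mulrC.
by rewrite derive_mulr_cst// mulrC.
Qed.

Lemma derive_hw n v p : 'D_v (hw n) p = walpha`_n * 'D_v u1 p + wbeta`_n * 'D_v u2 p.
Proof.
have [d1 <-] := derive_mull_cst walpha`_n (@du1 v p).
have [d2 <-] := derive_mull_cst wbeta`_n (@du2 v p).
exact: (deriveD d1 d2).
Qed.

Lemma derive_expRc (f : plane R -> R) c v p : derivable f p v ->
  'D_v (fun p => expR (c * f p)) p = expR (c * f p) * (c * 'D_v f p).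
Proof.
move=> df; have [dc Dc] := derive_mull_cst c df.
have [_ ->] := @derive_comp1 R (plane R) expR (fun p => c * f p) p v dc
  (@derivable_expR R (c * f p)).
by rewrite (@derive_val _ _ _ _ _ _ _ (is_derive_expR (c * f p))) Dc.
Qed.

Lemma derive_ehw a v p n : 'D_v (fun p => ehw a p n) p = ehw a p n * (a * 'D_v (hw n) p).
Proof. by apply: derive_expRc; exact: (Ck_der (Ck_hw n 1) Logic.I). Qed.

Lemma mxcD_ehw a v p :
  mxcD v (fun p => diagC (ehw a p)) p = diagC (ehw a p) *m diagC (fun n => a * 'D_v (hw n) p).
Proof.
rewrite diagCM -/(fun p => diagC ((fun n p => ehw a p n)^~ p)).
rewrite (mxcD_diagC (fun n p => ehw a p n)); congr diagC; apply/funext => n.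
exact: derive_ehw.
Qed.

Lemma mxcCk_ehw a k : mxcCk k (fun p => diagC (ehw a p)).
Proof.
apply: (mxcCk_diagC (d := fun n p => ehw a p n)) => n.
by apply: (Ck_expR oT); apply: (Ck_mul oT); [exact: Ck_cst|exact: Ck_hw].
Qed.

Definition tco (p : plane R) : R := Num.sqrt 3 * expR (u2 p).
Definition bco (p : plane R) : R := Num.sqrt 5 * expR (2^-1 * (u1 p - 3 * u2 p)).
Definition gco (p : plane R) : C := (expR (- u1 p))%:C * qval q p.

Definition PhiH p := Phi (tco p)%:C (bco p)%:C (gco p).

(** Conjugation by [e^Omega] multiplies each entry of the Higgs field by the
exponential of half a difference of weights. *)
Lemma PhiHE p : diagC (ehw (- 2^-1) p) *m PhiH p = phi q p *m diagC (ehw (- 2^-1) p).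
Proof.
have s6 : Num.sqrt (6 : R) = Num.sqrt 2 * Num.sqrt 3.
  by rewrite -sqrtrM ?ler0n// -natrM.
apply/matrixP => i j; rewrite mul_diag_mx mul_mx_diag !mxE s6.
rewrite /gco /tco /bco /ehw /hw; move: (Num.sqrt 2) (Num.sqrt 3) (Num.sqrt 5) (qval q p) => s2 s3 s5 [z1 z2].
have K (x y z : R) : x + y = z -> expR x * expR y = expR z by move=> <-; rewrite expRD.
have e32 : expR (- 2^-1 * (-1 * u1 p + 1 * u2 p)) * expR (u2 p) = expR (- 2^-1 * (-1 * u1 p + -1 * u2 p)).
  by apply: K; field.
have e21 : expR (- 2^-1 * (0 * u1 p + -2 * u2 p)) * expR (2^-1 * (u1 p - 3 * u2 p)) =
    expR (- 2^-1 * (-1 * u1 p + 1 * u2 p)) by apply: K; field.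
have e10 : expR (- 2^-1 * (0 * u1 p + 0 * u2 p)) * expR (u2 p) =
    expR (- 2^-1 * (0 * u1 p + -2 * u2 p)) by apply: K; field.
have e01 : expR (- 2^-1 * (0 * u1 p + 2 * u2 p)) * expR (u2 p) =
    expR (- 2^-1 * (0 * u1 p + 0 * u2 p)) by apply: K; field.
have e12 : expR (- 2^-1 * (1 * u1 p + -1 * u2 p)) * expR (2^-1 * (u1 p - 3 * u2 p)) =
    expR (- 2^-1 * (0 * u1 p + 2 * u2 p)) by apply: K; field.
have e23 : expR (- 2^-1 * (1 * u1 p + 1 * u2 p)) * expR (u2 p) =
    expR (- 2^-1 * (1 * u1 p + -1 * u2 p)) by apply: K; field.
have g1 : expR (- 2^-1 * (-1 * u1 p + -1 * u2 p)) * expR (- u1 p) =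
    expR (- 2^-1 * (1 * u1 p + -1 * u2 p)) by apply: K; field.
have g2 : expR (- 2^-1 * (-1 * u1 p + 1 * u2 p)) * expR (- u1 p) =
    expR (- 2^-1 * (1 * u1 p + 1 * u2 p)) by apply: K; field.
rewrite !mul0r in e21 e10 e01 e12.
move: i j; elim/ord7_ind; elim/ord7_ind; rewrite /= ?mulr0 ?mul0r//;
  apply/eqP; rewrite eq_complex /=; apply/andP; split; apply/eqP;
  first [by ring | by rewrite -e32; ring | by rewrite -e21; ring | by rewrite -e10; ring
    | by rewrite -e01; ring | by rewrite -e12; ring | by rewrite -e23; ring
    | by rewrite -g1; ring | by rewrite -g2; ring].
Qed.

Lemma phi_adjE p : phi_adj q u1 u2 p =
  diagC (ehw (-1) p) *m dagger (phi q p) *m diagC (ehw 1 p).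
Proof. by rewrite /phi_adj invHmx HmxE. Qed.

Lemma phiE p : phi q p = diagC (ehw (- 2^-1) p) *m PhiH p *m diagC (ehw 2^-1 p).
Proof. by rewrite PhiHE -mulmxA (ehwM (c := 0)) ?addNr// ehw0 mulmx1. Qed.

Lemma adj_PhiH p : diagC (ehw (- 2^-1) p) *m dagger (PhiH p) =
  phi_adj q u1 u2 p *m diagC (ehw (- 2^-1) p).
Proof.
rewrite phi_adjE phiE !daggerM !dagger_diagC -!mulmxA.
rewrite [diagC (ehw 1 p) *m _](ehwM (c := 2^-1)); last by field.
rewrite [diagC (ehw (- 2^-1) p) *m diagC (ehw 2^-1 p)](ehwM (c := 0)) ?addNr// ehw0 mulmx1.
by rewrite mulmxA (ehwM (c := - 2^-1))//; field.
Qed.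

(** The Toda frame in the weight basis. *)
Definition Nmx p := transl u1 u2 psi p *m expOmega u1 u2 p.

Lemma mxcCk_psi k : mxcCk k psi.
Proof.
have [spsi _ _ _ _] := hpsi; split=> i j; under eq_fun do rewrite mxE.
  exact: (spsi i j).1.
exact: (spsi i j).2.
Qed.

Lemma mxcCk_Nmx k : mxcCk k Nmx.
Proof.
apply: mxcCk_mul; first by apply: mxcCk_mul; [exact: mxcCk_cst|exact: mxcCk_psi].
by have := mxcCk_ehw (- 2^-1) k; congr mxcCk; apply/funext => p; rewrite expOmegaE.
Qed.

Lemma mxcD_Nmx v p (X Y : 'M[C]_7) :
  mxcD v psi p = psi p *m X ->
  X *m expOmega u1 u2 p - diagC (ehw (- 2^-1) p) *m diagC (fun n => 2^-1 * 'D_v (hw n) p) =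
    expOmega u1 u2 p *m Y ->
  mxcD v Nmx p = Nmx p *m Y.
Proof.
move=> DX XY; rewrite /Nmx.
have cT : mxcCk 1 (transl u1 u2 psi) by apply: mxcCk_mul; [exact: mxcCk_cst|exact: mxcCk_psi].
have cE : mxcCk 1 (expOmega u1 u2).
  by have := mxcCk_ehw (- 2^-1) 1; congr mxcCk; apply/funext => p'; rewrite expOmegaE.
rewrite (mxcD_mul v p cT cE) /transl.
rewrite (mxcD_mul v p (mxcCk_cst 1 (Hsqrt u1 u2 (origin R))) (mxcCk_psi 1)).
rewrite mxcD_cst mul0mx add0r DX -!mulmxA -!mulmxDr -XY; congr (_ *m (_ *m _)).
have -> : mxcD v (expOmega u1 u2) p = mxcD v (fun p => diagC (ehw (- 2^-1) p)) p.
  by congr (mxcD v _ p); apply/funext => p'; rewrite expOmegaE.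
rewrite mxcD_ehw; congr (_ + _); rewrite -mulmxN; congr (_ *m _).
apply/matrixP => i j; rewrite !mxE.
case: (i == j); rewrite ?mulr1n ?mulr0n ?oppr0//.
by apply/eqP; rewrite eq_complex /= mulNr oppr0 !eqxx.
Qed.

Lemma HdzH p : invmx (Hmx u1 u2 p) *m mx_dz (Hmx u1 u2) p =
  cpx (dg (fun n => 2^-1 * 'D_(dirx R) (hw n) p)) (dg (fun n => - (2^-1 * 'D_(diry R) (hw n) p))).
Proof.
have E : Hmx u1 u2 = fun p => diagC (ehw 1 p) by apply/funext => p'; rewrite HmxE.
rewrite invHmx mx_dzE E !mxcD_ehw dz_diag_comb mulmxA (ehwM (c := 0)) ?addNr// ehw0 mul1mx.
by congr (cpx (dg _) (dg _)); apply/funext => n; rewrite mul1r.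
Qed.

(** The connection of the unitary frame has a torus part, which comes from
differentiating [H] and [e^Omega]: only the purely imaginary half of the derivative
of [log H] survives. *)
Definition xd1 p := - (2^-1 * 'D_(diry R) (hw 0) p).
Definition xd2 p := - (2^-1 * 'D_(diry R) (hw 1) p).
Definition yd1 p := 2^-1 * 'D_(dirx R) (hw 0) p.
Definition yd2 p := 2^-1 * 'D_(dirx R) (hw 1) p.

Lemma wt_hw c v p n : c * 'D_v (hw n) p = (wt (c * 'D_v (hw 0) p) (c * 'D_v (hw 1) p))`_n.
Proof. by rewrite /wt !derive_hw; move: n; elim/ord7_ind => /=; ring. Qed.

Definition gr p := expR (- u1 p) * complex.Re (qval q p).
Definition gi p := expR (- u1 p) * complex.Im (qval q p).

Lemma gcoE p : gco p = gr p +i* gi p.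
Proof.
rewrite /gco /gr /gi; case: (qval q p) => a b.
by apply/eqP; rewrite eq_complex /=; apply/andP; split; apply/eqP; ring.
Qed.

Lemma Phi_i p : 'i *: PhiH p = Phi (0 +i* tco p) (0 +i* bco p) (- gi p +i* gr p).
Proof.
rewrite /PhiH gcoE; apply/matrixP => i j; rewrite !mxE.
move: i j; elim/ord7_ind; elim/ord7_ind; rewrite /= ?mulr0//;
  apply/eqP; rewrite eq_complex /=; apply/andP; split; apply/eqP; ring.
Qed.

Definition Xmx p := PhiH p + dagger (PhiH p) +
  cpx 0 (diag_mx (\row_n (wt (xd1 p) (xd2 p))`_n)).
Definition Ymx p := 'i *: PhiH p + dagger ('i *: PhiH p) +
  cpx 0 (diag_mx (\row_n (wt (yd1 p) (yd2 p))`_n)).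

Definition Ax p := pmx (tco p) 0 (bco p) 0 (gr p) (gi p) + tmx (xd1 p) (xd2 p).
Definition Ay p := pmx 0 (tco p) 0 (bco p) (- gi p) (gr p) + tmx (yd1 p) (yd2 p).

(** The coefficients of the linear system are real in the multiplication basis. *)
Lemma ebasis_conn (P : 'M[C]_7) t1 t2 b1 b2 g1 g2 d1 d2 :
  P = Phi (t1 +i* t2) (b1 +i* b2) (g1 +i* g2) ->
  ebasis R *m (P + dagger P + cpx 0 (diag_mx (\row_n (wt d1 d2)`_n))) =
  cplx (pmx t1 t2 b1 b2 g1 g2 + tmx d1 d2) *m ebasis R.
Proof.
move=> ->; rewrite ebasisE -!mulmxA mulmxDr Phi_higgs.
have -> : diagC (ccoef R) *m cpx 0 (diag_mx (\row_n (wt d1 d2)`_n)) =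
    cpx 0 (diag_mx (\row_n (wt d1 d2)`_n)) *m diagC (ccoef R).
  rewrite diagCE !cpxM !mul0mx !mulmx0 !subr0 !add0r ?addr0; congr cpx.
  by rewrite /dg !mulmx_diag; congr diag_mx; apply/rowP => j; rewrite !mxE mulrC.
rewrite mulmxDr !mulmxA eb_higgs eb_weights -!mulmxDl; congr (_ *m _ *m _).
by apply/matrixP => i j; rewrite !mxE rmorphD.
Qed.

Lemma mxcD_psi_x p : mxcD (dirx R) psi p = psi p *m
  (phi q p + phi_adj q u1 u2 p + invmx (Hmx u1 u2 p) *m mx_dz (Hmx u1 u2) p).
Proof.
have [_ up psiz psizb _] := hpsi.
by rewrite mxcD_dirx addrAC mulmxDr -psiz -psizb !(mulKVmx (up p)).
Qed.

Lemma mxcD_psi_y p : mxcD (diry R) psi p = psi p *m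
  ('i *: (phi q p - phi_adj q u1 u2 p + invmx (Hmx u1 u2 p) *m mx_dz (Hmx u1 u2) p)).
Proof.
have [_ up psiz psizb _] := hpsi.
have E : mx_dz psi p - mx_dzbar psi p = psi p *m
    (phi q p - phi_adj q u1 u2 p + invmx (Hmx u1 u2 p) *m mx_dz (Hmx u1 u2) p).
  by rewrite addrAC mulmxBr -psiz -psizb !(mulKVmx (up p)).
by rewrite mxcD_diry E scalemxAr.
Qed.

Lemma mxcD_Nmx_x p : mxcD (dirx R) Nmx p = Nmx p *m Xmx p.
Proof.
apply: (mxcD_Nmx (mxcD_psi_x p)); rewrite HdzH expOmegaE /Xmx !mulmxDr !mulmxDl.
rewrite -PhiHE -adj_PhiH -addrA; congr (_ + _).
have -> : cpx 0 (diag_mx (\row_n (wt (xd1 p) (xd2 p))`_n)) =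
    cpx 0 (dg (fun n => - (2^-1 * 'D_(diry R) (hw n) p))).
  congr (cpx _ (diag_mx _)); apply/rowP => n; rewrite !mxE /xd1 /xd2.
  by rewrite -!mulNr -wt_hw.
rewrite !diagCE !cpxM !mul0mx !mulmx0 ?subr0 ?addr0 ?add0r !dgM.
apply/matrixP => i j; rewrite !mxE.
case: (i == j); rewrite ?mulr1n ?mulr0n; last by apply/eqP; rewrite eq_complex /= !subr0 !eqxx.
by apply/eqP; rewrite eq_complex /=; apply/andP; split; apply/eqP; ring.
Qed.

Lemma mxcD_Nmx_y p : mxcD (diry R) Nmx p = Nmx p *m Ymx p.
Proof.
apply: (mxcD_Nmx (mxcD_psi_y p)); rewrite HdzH expOmegaE /Ymx.
have -> : 'i *: PhiH p + dagger ('i *: PhiH p) = 'i *: (PhiH p - dagger (PhiH p)).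
  by rewrite dagger_i scaleNr scalerBr.
rewrite scalerDr mulmxDl mulmxDr -scalemxAl mulmxBl -PhiHE -adj_PhiH -mulmxBr.
rewrite -scalemxAr -addrA; congr (_ + _).
have -> : cpx 0 (diag_mx (\row_n (wt (yd1 p) (yd2 p))`_n)) =
    cpx 0 (dg (fun n => 2^-1 * 'D_(dirx R) (hw n) p)).
  by congr (cpx _ (diag_mx _)); apply/rowP => n; rewrite !mxE /yd1 /yd2 -wt_hw.
exact: conn_diag.
Qed.

Definition Gmx p := from_e (Nmx p).

Lemma ebasis_unit : ebasis R \in unitmx.
Proof.
rewrite ebasisE unitmx_mul eb_unit /=.
apply: (@diagCV R (ccoef R) (fun n => (ccoef R n)^-1) _).1 => n.
rewrite mulfV// /ccoef; case: ifP => _; first exact: oner_neq0.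
by rewrite invr_eq0 sqrtr_eq0 -ltNge ltr0n.
Qed.

Lemma mxcCk_Gmx k : mxcCk k Gmx.
Proof.
apply: mxcCk_mul; last exact: mxcCk_cst.
by apply: mxcCk_mul; [exact: mxcCk_cst|exact: mxcCk_Nmx].
Qed.

Lemma mul_conj_unit n (E N A : 'M[C]_n) : E \in unitmx ->
  E *m (N *m (invmx E *m (A *m E))) *m invmx E = E *m N *m invmx E *m A.
Proof. by move=> uE; rewrite !mulmxA mulmxK. Qed.

Lemma mxcD_from_e v p (Y : 'M[C]_7) (A : 'M[R]_7) : mxcD v Nmx p = Nmx p *m Y ->
  ebasis R *m Y = cplx A *m ebasis R -> mxcD v Gmx p = Gmx p *m cplx A.
Proof.
move=> DN YA; rewrite /Gmx /from_e.
have cN : mxcCk 1 (fun p => ebasis R *m Nmx p).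
  by apply: mxcCk_mul; [exact: mxcCk_cst|exact: mxcCk_Nmx].
rewrite (mxcD_mul v p cN (mxcCk_cst 1 (invmx (ebasis R)))) mxcD_cst mulmx0 addr0.
rewrite (mxcD_mul v p (mxcCk_cst 1 (ebasis R)) (mxcCk_Nmx 1)) mxcD_cst mul0mx add0r DN.
have -> : Y = invmx (ebasis R) *m (cplx A *m ebasis R).
  by rewrite -YA mulKmx// ebasis_unit.
exact: (mul_conj_unit _ _ ebasis_unit).
Qed.

Lemma mxcD_Gmx_x p : mxcD (dirx R) Gmx p = Gmx p *m cplx (Ax p).
Proof.
apply: (mxcD_from_e (mxcD_Nmx_x p)); apply: ebasis_conn.
by rewrite /PhiH gcoE.
Qed.

Lemma mxcD_Gmx_y p : mxcD (diry R) Gmx p = Gmx p *m cplx (Ay p).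
Proof. by apply: (mxcD_from_e (mxcD_Nmx_y p)); apply: ebasis_conn; exact: Phi_i. Qed.

Lemma Gmx0 : Gmx (0, 0) = 1%:M.
Proof.
have [_ _ _ _ p0] := hpsi.
rewrite /Gmx /from_e /Nmx /transl p0 mulmx1 HsqrtE expOmegaE.
by rewrite (ehwM (c := 0)) ?subrr// ehw0 mulmx1 mulmxV// ebasis_unit.
Qed.

Definition Fmx p := Re_mx (Gmx p).

Lemma ReIm_mxD (v p : plane R) (A : 'M[R]_7) : mxcD v Gmx p = Gmx p *m cplx A ->
  mxD v Fmx p = Fmx p *m A /\
  mxD v (fun p => Im_mx (Gmx p)) p = Im_mx (Gmx p) *m A.
Proof.
have E0 (G : 'M[C]_7) : G *m cplx A = cpx (Re_mx G *m A) (Im_mx G *m A).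
  by rewrite {1}[G]cpx_eta cpx_real cpxM !mulmx0 subr0 add0r.
rewrite E0 => E.
by have := congr1 (@Re_mx _ _ _) E; have := congr1 (@Im_mx _ _ _) E; rewrite !Re_cpx !Im_cpx.
Qed.

Lemma Ck_tco k : Ck setT k tco.
Proof. by apply: (Ck_mul oT); [exact: Ck_cst|apply: (Ck_expR oT); exact: su2]. Qed.

Lemma Ck_bco k : Ck setT k bco.
Proof.
apply: (Ck_mul oT); first exact: Ck_cst.
apply: (Ck_expR oT); apply: (Ck_mul oT); first exact: Ck_cst.
apply: (Ck_add oT); first exact: su1.
by apply: (Ck_opp oT); apply: (Ck_mul oT); [exact: Ck_cst|exact: su2].
Qed.

Lemma Ck_gr k : Ck setT k gr.
Proof.
have [ca _ _ _] := poly_smooth_CR q.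
by apply: (Ck_mul oT); [apply: (Ck_expR oT); apply: (Ck_opp oT); exact: su1|exact: ca].
Qed.

Lemma Ck_gi k : Ck setT k gi.
Proof.
have [_ cb _ _] := poly_smooth_CR q.
by apply: (Ck_mul oT); [apply: (Ck_expR oT); apply: (Ck_opp oT); exact: su1|exact: cb].
Qed.

Lemma Ck_Dhw c v n k : Ck setT k (fun p => c * 'D_v (hw n) p).
Proof. by apply: (Ck_mul oT); [exact: Ck_cst|apply: Ck_D; exact: Ck_hw]. Qed.

Lemma mxCk_Ax k : mxCk setT k Ax.
Proof.
apply: (mxCk_add oT).
  apply: (mxCk_pmx oT); first [exact: Ck_tco|exact: Ck_bco|exact: Ck_gr|exact: Ck_gi|exact: Ck_cst].
by apply: (mxCk_tmx oT); apply: (Ck_opp oT); exact: Ck_Dhw.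
Qed.

Lemma mxCk_Ay k : mxCk setT k Ay.
Proof.
apply: (mxCk_add oT).
  apply: (mxCk_pmx oT); first [exact: Ck_tco|exact: Ck_bco|exact: Ck_gr|exact: Ck_cst
    |exact: (Ck_opp oT (Ck_gi k))].
by apply: (mxCk_tmx oT); exact: Ck_Dhw.
Qed.

Lemma conn_der t1 t2 b1 b2 g1 g2 d1 d2 :
  is_der (ext_mx 0 (pmx t1 t2 b1 b2 g1 g2 + tmx d1 d2 : 'M[R]_7)).
Proof.
rewrite -[pmx _ _ _ _ _ _]scale1r ext_mx_lin; apply: is_der_lin; [exact: pmx_der|exact: tmx_der].
Qed.

(** The coefficients being real, the imaginary part of the frame solves the same
homogeneous linear system, and it vanishes at the origin. *)
Lemma Gmx_real p : Gmx p = cplx (Fmx p).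
Proof.
rewrite {1}[Gmx p]cpx_eta cpx_real; congr cpx.
pose y (i : 'I_7 * 'I_7) p := Im_mx (Gmx p) i.1 i.2.
pose m (A : plane R -> 'M[R]_7) (i : 'I_7 * 'I_7) (c : 'I_7) p := A p c i.2.
have Dy v A : (forall p, mxcD v Gmx p = Gmx p *m cplx (A p)) ->
    forall i p, 'D_v (y i) p = \sum_c m A i c p * y (i.1, c) p.
  move=> DG i p'; transitivity (mxD v (fun p => Im_mx (Gmx p)) p' i.1 i.2); first by rewrite mxE.
  rewrite (ReIm_mxD (DG p')).2 mxE; apply: eq_bigr => c _; exact: mulrC.
have cm (A : plane R -> 'M[R]_7) : mxCk setT 0 A -> forall i c, continuous (m A i c).
  by move=> cA i c z; exact: (Ck_cont (cA _ _) Logic.I).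
have y0 i : y i (0, 0) = 0.
  rewrite /y Gmx0 mxE; rewrite mxE; by case: (_ == _).
have yp := plane_ode0 (fun i => (mxcCk_Gmx 1).2 i.1 i.2) (Dy _ _ mxcD_Gmx_x) (Dy _ _ mxcD_Gmx_y)
  (cm _ (mxCk_Ax 0)) (cm _ (mxCk_Ay 0)) y0.
by apply/matrixP => i j; rewrite [LHS](yp (i, j) p) mxE.
Qed.

Lemma Fmx_aut p : oct_aut (ext_mx 1 (Fmx p)).
Proof.
apply: (frame_aut (mxcCk_Gmx 1).1 (mxCk_Ax 0) (mxCk_Ay 0)).
- by move=> z; exact: (ReIm_mxD (mxcD_Gmx_x z)).1.
- by move=> z; exact: (ReIm_mxD (mxcD_Gmx_y z)).1.
- by move=> z; exact: conn_der.
- by move=> z; exact: conn_der.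
- rewrite /Fmx Gmx0; apply/matrixP => i j; rewrite !mxE; by case: (_ == _).
Qed.

End TodaFrame.

(** * Harmonicity *)

Section TodaHarmonic.
Variable R : realType.
Local Notation C := R[i].
Variables (q : {poly C}) (u1 u2 : plane R -> R) (psi : plane R -> 'M[C]_7).
Hypothesis su1 : smooth u1.
Hypothesis su2 : smooth u2.
Hypothesis hpsi : parallel_translation q u1 u2 psi.
Variable Fhat : plane R -> G2 R.
Hypothesis hF : is_toda_frame u1 u2 psi Fhat.

Let oT : open (setT : set (plane R)). Proof. exact: openT. Qed.
Local Notation F := (Fmx u1 u2 psi).

Lemma cplx_inj m n (A B : 'M[R]_(m, n)) : cplx A = cplx B -> A = B.
Proof. by move=> /(congr1 (@Re_mx R m n)); rewrite !cpx_real !Re_cpx. Qed.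

Lemma im_Fhat p : im_mx (G2mx (Fhat p)) = F p.
Proof. by apply: cplx_inj; rewrite hF -(Gmx_real su1 su2 hpsi). Qed.

Lemma FhatE p : G2mx (Fhat p) = ext_mx 1 (F p).
Proof. by rewrite (autE (G2P (Fhat p))) im_Fhat. Qed.

Lemma FhatE_fun : G2fun Fhat = fun p => ext_mx 1 (F p).
Proof. by apply/funext => p; rewrite /G2fun FhatE. Qed.

Lemma Fhat_smooth i j k : Ck setT k (fun p => G2mx (Fhat p) i j).
Proof.
have := mxCk_ext_mx 1 oT (mxcCk_Gmx su1 su2 hpsi k).1.
by move=> /(_ i j); congr (Ck _ _ _); apply/funext => p; rewrite FhatE.
Qed.

Lemma vel_Fhat v (A : plane R -> 'M[R]_7) :
  (forall p, mxcD v (Gmx u1 u2 psi) p = Gmx u1 u2 psi p *m cplx (A p)) ->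
  vel Fhat v = fun p => ext_mx 0 (A p).
Proof.
move=> DG; apply/funext => p; rewrite /vel FhatE_fun.
have dF : mxder F p v by exact: mxCk_der (mxcCk_Gmx su1 su2 hpsi 1).1 Logic.I.
rewrite (mxD_ext_mx dF).2 (ReIm_mxD (DG p)).1.
have -> : ext_mx 0 (F p *m A p) = G2mx (Fhat p) *m ext_mx 0 (A p).
  by rewrite FhatE ext_mxM mulr0.
by rewrite mulKmx// G2unit.
Qed.

Definition vel_x := vel_Fhat (mxcD_Gmx_x su1 su2 hpsi).
Definition vel_y := vel_Fhat (mxcD_Gmx_y su1 su2 hpsi).

Lemma ext_mx0D (A B : 'M[R]_7) : ext_mx 0 (A + B) = ext_mx 0 A + ext_mx 0 B.
Proof. by have := ext_mx_lin 1 A B; rewrite !scale1r. Qed.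

Lemma bracket_ext (A B : 'M[R]_7) : bracket (ext_mx 0 (A + B)) (ext_mx 0 A) =
  ext_mx 0 (B *m A - A *m B).
Proof.
have sub (X Y : 'M[R]_7) : ext_mx 0 (X - Y) = ext_mx 0 X - ext_mx 0 Y.
  by have := ext_mx_lin (-1) Y X; rewrite !scaleN1r addrC => ->; rewrite addrC.
rewrite /bracket !ext_mxM mulr0 -sub mulmxDl mulmxDr opprD addrACA subrr add0r//.
Qed.

Section Tension.
Variable h : {vspace 'M[R]_8}.
Hypothesis Th : (lieT R <= h)%VS.
Hypothesis hK : (h <= lieK R)%VS.

(** The torus part of the connection is in [lieT], hence vertical, and the rest is
orthogonal to [lieK], hence horizontal. *)
Lemma proj_conn (t1 t2 b1 b2 g1 g2 d1 d2 : R) :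
  proj_orth h (ext_mx 0 (pmx t1 t2 b1 b2 g1 g2 + tmx d1 d2)) =
  ext_mx 0 (pmx t1 t2 b1 b2 g1 g2).
Proof.
rewrite ext_mx0D; apply: (proj_orth_uniq hK); last exact: (subvP Th _ (tmx_lieT d1 d2)).
exact: (orth_sub hK (pmx_orth _ _ _ _ _ _)).
Qed.

Lemma tension_term (t1 t2 b1 b2 g1 g2 d1 d2 : plane R -> R) v p :
  derivable t1 p v -> derivable t2 p v -> derivable b1 p v -> derivable b2 p v ->
  derivable g1 p v -> derivable g2 p v -> derivable d1 p v -> derivable d2 p v ->
  let X p := ext_mx 0 (pmx (t1 p) (t2 p) (b1 p) (b2 p) (g1 p) (g2 p) + tmx (d1 p) (d2 p)) in
  let a := d2 p - d1 p in let b := d1 p - 2 * d2 p in let c := d1 p + d2 p in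
  proj_orth h (mxD v X p) + bracket (X p) (proj_orth h (X p)) =
  ext_mx 0 (pmx ('D_v t1 p - a * t2 p) ('D_v t2 p + a * t1 p)
                ('D_v b1 p - b * b2 p) ('D_v b2 p + b * b1 p)
                ('D_v g1 p - c * g2 p) ('D_v g2 p + c * g1 p)).
Proof.
move=> dt1 dt2 db1 db2 dg1 dg2 dd1 dd2 X a b c.
have [dP DP] := mxD_pmx dt1 dt2 db1 db2 dg1 dg2.
have [dT DT] := mxD_tmx dd1 dd2.
have [dS DS] := mxD_add dP dT.
have [_ DX] := mxD_lin (@ext_mx R 0) dS.
have -> : mxD v X p = ext_mx 0 (pmx ('D_v t1 p) ('D_v t2 p) ('D_v b1 p) ('D_v b2 p)
    ('D_v g1 p) ('D_v g2 p) + tmx ('D_v d1 p) ('D_v d2 p)).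
  by rewrite -DP -DT -DS -DX.
rewrite /X !proj_conn bracket_ext bracket_tmx_pmx -ext_mx0D pmx_add.
by rewrite !mulNr -!/a -!/b -!/c.
Qed.

Let du1 v p : derivable u1 p v. Proof. exact: (Ck_der (su1 1) Logic.I). Qed.
Let du2 v p : derivable u2 p v. Proof. exact: (Ck_der (su2 1) Logic.I). Qed.

Lemma derive_tco v p : 'D_v (tco u2) p = tco u2 p * 'D_v u2 p.
Proof.
rewrite /tco; have E : (fun p => expR (u2 p)) = (fun p => expR (1 * u2 p)).
  by apply/funext => p'; rewrite mul1r.
have de : derivable (fun p => expR (u2 p)) p v.
  by exact: (Ck_der (Ck_expR oT (su2 1)) Logic.I).
rewrite (derive_mull_cst _ de).2 E derive_expRc; last exact: du2.
by rewrite !mul1r mulrA.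
Qed.

Lemma derive_bco v p :
  'D_v (bco u1 u2) p = bco u1 u2 p * (2^-1 * ('D_v u1 p - 3 * 'D_v u2 p)).
Proof.
have cf : Ck setT 1 (fun p => u1 p - 3 * u2 p).
  apply: (Ck_add oT); first exact: su1.
  by apply: (Ck_opp oT); apply: (Ck_mul oT); [exact: Ck_cst|exact: su2].
have df : derivable (fun p => u1 p - 3 * u2 p) p v by exact: (Ck_der cf Logic.I).
have de : derivable (fun p => expR (2^-1 * (u1 p - 3 * u2 p))) p v.
  have ce := Ck_expR oT (Ck_mul oT (Ck_cst setT 1 (2^-1 : R)) cf).
  by exact: (Ck_der ce Logic.I).
rewrite /bco (derive_mull_cst _ de).2 derive_expRc//.
have -> : 'D_v (fun p => u1 p - 3 * u2 p) p = 'D_v u1 p - 3 * 'D_v u2 p.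
  have [d3 D3] := derive_mull_cst 3 (@du2 v p).
  by rewrite -D3; exact: (deriveB (@du1 v p) d3).
by rewrite !mulrA.
Qed.

Lemma derive_gamma (a : plane R -> R) v p : derivable a p v ->
  'D_v (fun p => expR (- u1 p) * a p) p = expR (- u1 p) * ('D_v a p - a p * 'D_v u1 p).
Proof.
move=> da; have E : (fun p => expR (- u1 p)) = (fun p => expR (-1 * u1 p)).
  by apply/funext => p'; rewrite mulN1r.
have de : derivable (fun p => expR (- u1 p)) p v.
  by exact: (Ck_der (Ck_expR oT (Ck_opp oT (su1 1))) Logic.I).
have De : 'D_v (fun p => expR (- u1 p)) p = expR (- u1 p) * (- 1 * 'D_v u1 p).
  by rewrite E derive_expRc; [rewrite !mulN1r|exact: du1].
rewrite (deriveM de da) De /GRing.scale /=.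
move: (expR _) ('D_v a p) (a p) ('D_v u1 p) => e x y z; ring.
Qed.

(** The functions [t] and [b] are exponentials whose logarithmic derivatives cancel
the rotations by the torus part; for [g] there remain the derivatives of the
polynomial, which cancel by the Cauchy-Riemann equations. *)
Lemma tension_Fhat z : tension h Fhat z = 0.
Proof.
rewrite /tension vel_x vel_y /Ax /Ay.
have dt v : derivable (tco u2) z v by exact: (Ck_der (Ck_tco su2 1) Logic.I).
have db v : derivable (bco u1 u2) z v by exact: (Ck_der (Ck_bco su1 su2 1) Logic.I).
have dr v : derivable (gr q u1) z v by exact: (Ck_der (Ck_gr q su1 1) Logic.I).
have di v : derivable (gi q u1) z v by exact: (Ck_der (Ck_gi q su1 1) Logic.I).
have dn v : derivable (fun p => - gi q u1 p) z v by exact: (derivableN (di v)).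
have dc v : derivable (fun _ : plane R => (0 : R)) z v by exact: derivable_cst.
have Dc v : 'D_v (fun _ : plane R => (0 : R)) z = 0 by exact: derive_cst.
have dw c v v' n : derivable (fun p => c * 'D_v (hw u1 u2 n) p) z v'.
  by exact: (Ck_der (Ck_Dhw su1 su2 c v n 1) Logic.I).
have dxn n v : derivable (fun p => - (2^-1 * 'D_(diry R) (hw u1 u2 n) p)) z v.
  by exact: (derivableN (dw _ _ _ _)).
have -> := tension_term (dt (dirx R)) (dc _) (db _) (dc _) (dr _) (di _) (dxn 0 _) (dxn 1 _).
have -> := tension_term (dc (diry R)) (dt _) (dc _) (db _) (dn _) (dr _) (dw _ _ _ 0) (dw _ _ _ 1).
rewrite -ext_mx0D pmx_add -[RHS](ext_mx0 R); congr ext_mx.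
have [ca cb CR1 CR2] := poly_smooth_CR q.
have da v : derivable (fun p => complex.Re (qval q p)) z v by exact: (Ck_der (ca 1%N) Logic.I).
have dbb v : derivable (fun p => complex.Im (qval q p)) z v by exact: (Ck_der (cb 1%N) Logic.I).
have Dn v : 'D_v (fun p => - gi q u1 p) z = - 'D_v (gi q u1) z by exact: (deriveN (di v)).
have Dr v : 'D_v (gr q u1) z = _ := derive_gamma (da v).
have Di v : 'D_v (gi q u1) z = _ := derive_gamma (dbb v).
rewrite !Dn !Dr !Di !derive_tco !derive_bco !Dc CR1 CR2.
rewrite !(derive_hw su1 su2) /gr /gi /=.
move: (expR (- u1 z)) (tco u2 z) (bco u1 u2 z) (complex.Re _) (complex.Im _)
  ('D_(dirx R) u1 z) ('D_(diry R) u1 z) ('D_(dirx R) u2 z) ('D_(diry R) u2 z)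
  ('D_(dirx R) (fun p => complex.Re (qval q p)) z)
  ('D_(dirx R) (fun p => complex.Im (qval q p)) z).
move=> e t b x y a1 a2 a3 a4 a5 a6.
transitivity (pmx 0 0 0 0 0 0 : 'M[R]_7).
  by congr pmx; field.
by apply/matrixP; elim/ord7_ind; elim/ord7_ind; rewrite !mxE /= ?oppr0 ?addr0 ?mulr0.
Qed.

End Tension.

Lemma harmonic_FT : harmonic_map (lieT R) (fun z => qproj (@groupT R) (Fhat z)).
Proof.
apply: (harmonic_of_tension (isotropyT R)); first exact: Fhat_smooth.
by apply: tension_Fhat; [exact: subvv|exact: lieT_sub_lieK].
Qed.

Lemma harmonic_FK : harmonic_map (lieK R) (fun z => qproj (@groupK R) (Fhat z)).
Proof.
apply: (harmonic_of_tension (isotropyK R)); first exact: Fhat_smooth.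
by apply: tension_Fhat; [exact: lieT_sub_lieK|exact: subvv].
Qed.

End TodaHarmonic.

(** * The model spaces *)

Section ModelSpaces.
Variable R : realType.
Local Notation mb := (@mbasis R).
Local Notation V7 := (imo R).
Implicit Types (g k : G2 R) (U : {vspace imo R}).

Lemma actv_dot g x y : dot (actv g x) (actv g y) = dot x y.
Proof. exact: aut_dot (G2P g). Qed.

Lemma actv_cross g x y : cross (actv g x) (actv g y) = actv g (cross x y).
Proof. exact: aut_cross (G2P g). Qed.

Lemma actVD g U U' : (actV g U + actV g U')%VS = actV g (U + U').
Proof. by rewrite /actV limgD. Qed.

Lemma actV_line g x : actV g <[x]>%VS = <[actv g x]>%VS.
Proof. by rewrite /actV limg_line lfunE. Qed.

Lemma actV_span g (X : seq V7) : actV g <<X>>%VS = <<map (actv g) X>>%VS.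
Proof. by rewrite /actV limg_span; congr (<<_>>%VS); apply: eq_map => x; rewrite lfunE. Qed.

Lemma dim_actV_le g U : (\dim (actV g U) <= \dim U)%N.
Proof. by rewrite -(limg_ker_dim (linfun (mulmx (im_mx (G2mx g)))) U) leq_addl. Qed.

Lemma mspan_disj (s s' : seq 'I_7) : (forall i, i \in s -> i \notin s') ->
  orthogonal_spaces (mspan R s) (mspan R s').
Proof.
move=> ss' v w /mem_mspan vs /mem_mspan ws; rewrite dot_sum big1// => i _.
have [is_|/vs ->] := boolP (i \in s); last by rewrite mulr0 mul0r.
by rewrite ws ?mulr0// ss'.
Qed.

Lemma actV_orth g U U' : orthogonal_spaces U U' ->
  orthogonal_spaces (actV g U) (actV g U').
Proof.
move=> UU' v w /mem_actV[v' vU ->] /mem_actV[w' wU ->].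
by rewrite actv_dot UU'.
Qed.

Lemma mspan_pos (s : seq 'I_7) : (forall i, i \in s -> (i < 3)%N) -> pos_def (mspan R s).
Proof.
move=> s3 v /mem_mspan vs v0; rewrite dot_sum.
have E i : eps R i * v i 0 * v i 0 = v i 0 ^+ 2.
  have [is_|/vs ->] := boolP (i \in s); last by rewrite !mulr0 expr0n.
  by rewrite /eps s3// mul1r.
under eq_bigr do rewrite E.
rewrite lt_neqAle sumr_ge0 ?andbT; last by move=> i _; exact: sqr_ge0.
rewrite eq_sym psumr_neq0; last by move=> i _; exact: sqr_ge0.
have [i vi] : exists i, v i 0 != 0.
  apply/existsP; apply: contraNT v0 => /existsPn vN0.
  by apply/eqP/colP => i; rewrite mxE; apply/eqP; move: (vN0 i); rewrite negbK.
by apply/hasP; exists i; rewrite ?mem_index_enum//= lt_neqAle sqr_ge0 eq_sym sqrf_eq0 vi.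
Qed.

Lemma mspan_neg (s : seq 'I_7) : (forall i, i \in s -> (3 <= i)%N) -> neg_def (mspan R s).
Proof.
move=> s3 v /mem_mspan vs v0; rewrite dot_sum.
have E i : eps R i * v i 0 * v i 0 = - (v i 0 ^+ 2).
  have [is_|/vs ->] := boolP (i \in s); last by rewrite !mulr0 expr0n oppr0.
  by rewrite /eps ltnNge s3//= mulN1r mulNr.
under eq_bigr do rewrite E.
rewrite sumrN oppr_lt0 lt_neqAle sumr_ge0 ?andbT; last by move=> i _; exact: sqr_ge0.
rewrite eq_sym psumr_neq0; last by move=> i _; exact: sqr_ge0.
have [i vi] : exists i, v i 0 != 0.
  apply/existsP; apply: contraNT v0 => /existsPn vN0.
  by apply/eqP/colP => i; rewrite mxE; apply/eqP; move: (vN0 i); rewrite negbK.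
by apply/hasP; exists i; rewrite ?mem_index_enum//= lt_neqAle sqr_ge0 eq_sym sqrf_eq0 vi.
Qed.

Lemma actv_eq0 g v : (actv g v == 0) = (v == 0).
Proof.
apply/eqP/eqP => [E|->]; last exact: mulmx0.
by rewrite -(actvK g v) E; exact: mulmx0.
Qed.

Lemma actV_pos g U : pos_def U -> pos_def (actV g U).
Proof. by move=> pU v /mem_actV[u uU ->]; rewrite actv_eq0 actv_dot; exact: pU. Qed.

Lemma actV_neg g U : neg_def U -> neg_def (actV g U).
Proof. by move=> pU v /mem_actV[u uU ->]; rewrite actv_eq0 actv_dot; exact: pU. Qed.

Lemma actV_cross_stable g x U : cross_stable x U -> cross_stable (actv g x) (actV g U).
Proof.
by move=> xU v /mem_actV[u uU ->]; rewrite actv_cross mem_actVE; exact: xU.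
Qed.

Lemma mspan1 i : mspan R [:: i] = <[mb i]>%VS.
Proof. by rewrite /mspan /= span_seq1. Qed.

Lemma ImH_split : (<[mb 0%R]> + mspan R [:: 1; 2%:R])%VS = ImH R.
Proof. by rewrite /ImH /mspan /= [RHS]span_cons. Qed.

Lemma full_split : (<[mb 0%R]> + mspan R [:: 1; 2%:R] + mspan R [:: 3%:R; 4%:R]
  + mspan R [:: 5%:R; 6%:R])%VS = fullv.
Proof.
rewrite -mspan1 /mspan -!span_cat /=; apply/vspaceP => v; rewrite memvf.
by apply/(mem_mspan [:: 0; 1; 2%:R; 3%:R; 4%:R; 5%:R; 6%:R]); elim/ord7_ind.
Qed.

Lemma actV_full g : (<[actv g (mb 0%R)]> + actV g (mspan R [:: 1; 2%:R])
  + actV g (mspan R [:: 3%:R; 4%:R]) + actV g (mspan R [:: 5%:R; 6%:R]))%VS = fullv.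
Proof.
rewrite -actV_line !actVD full_split; apply/vspaceP => v; rewrite memvf.
have -> : v = actv g (actv (G2inv g) v).
  have -> : actv g (actv (G2inv g) v) = actv (G2mul g (G2inv g)) v by rewrite actvM.
  have -> : G2mul g (G2inv g) = G2one R by apply: G2_eq; rewrite /= mulmxV// G2unit.
  by rewrite actv1.
by rewrite mem_actVE memvf.
Qed.

(** The dimensions are bounded above and their sum is at least that of the span. *)
Lemma dims_full (V : vectType R) (A B C D : {vspace V}) :
  (\dim A <= 1)%N -> (\dim B <= 2)%N -> (\dim C <= 2)%N -> (\dim D <= 2)%N ->
  \dim (A + B + C + D) = 7%N ->
  [/\ \dim A = 1%N, \dim B = 2%N, \dim C = 2%N & \dim D = 2%N].
Proof.
move=> a b c d full.
have := (dimv_add_leqif (A + B + C) D).1; have := (dimv_add_leqif (A + B) C).1.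
by have := (dimv_add_leqif A B).1; rewrite full => h1 h2 h3; split; lia.
Qed.

Lemma dim_flag g :
  [/\ \dim <[actv g (mb 0%R)]> = 1%N, \dim (actV g (mspan R [:: 1; 2%:R])) = 2%N,
      \dim (actV g (mspan R [:: 3%:R; 4%:R])) = 2%N
    & \dim (actV g (mspan R [:: 5%:R; 6%:R])) = 2%N].
Proof.
have le2 i j : (\dim (actV g (mspan R [:: i; j])) <= 2)%N.
  exact: leq_trans (dim_actV_le _ _) (dim_span _).
have le1 : (\dim <[actv g (mb 0%R)]> <= 1)%N by rewrite dim_vline leq_b1.
apply: dims_full le1 (le2 _ _) (le2 _ _) (le2 _ _) _.
by rewrite actV_full dimvf.
Qed.

(** Automorphisms preserve all the defining conditions, so the imaginary quaternions
are enough; there the cross product is that of Euclidean space, and any vector is the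
product of two vectors orthogonal to it. *)
Lemma spaceX_actV g : spaceX (actV g (ImH R)).
Proof.
split.
- have [d1 d2 d3 d4] := dim_flag g.
  have full := actV_full g; rewrite -actV_line actVD ImH_split in full.
  have := congr1 (fun W => \dim W) full; rewrite dimvf /dim /= => {}full.
  have h1 := (dimv_add_leqif (actV g (ImH R) + actV g (mspan R [:: 3%:R; 4%:R]))
    (actV g (mspan R [:: 5%:R; 6%:R]))).1.
  have h2 := (dimv_add_leqif (actV g (ImH R)) (actV g (mspan R [:: 3%:R; 4%:R]))).1.
  have h3 : (\dim (actV g (ImH R)) <= 3)%N.
    exact: leq_trans (dim_actV_le _ _) (dim_span _).
  rewrite d4 in h1; rewrite d3 in h2; rewrite full in h1; lia.
- by apply: actV_pos; apply: mspan_pos => i; rewrite !inE => /or3P[] /eqP ->.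
- move=> z; split.
    move=> /mem_actV[w /mem_ImH wH ->].
    suff [x [y [xH yH ->]]] : exists x y, [/\ x \in ImH R, y \in ImH R & w = cross x y].
      by exists (actv g x), (actv g y); rewrite !mem_actVE actv_cross.
    have mH (a b c : R) : col7 [:: a; b; c; 0; 0; 0; 0] \in ImH R.
      by apply/mem_ImH; elim/ord7_ind; rewrite // mxE.
    have wE : w = col7 [:: w 0 0; w 1 0; w 2%:R 0; 0; 0; 0; 0].
      by rewrite {1}(col7_eta w) (wH 3%:R isT) (wH 4%:R isT) (wH 5%:R isT) (wH 6%:R isT).
    move: (w 0 0) (w 1 0) (w 2%:R 0) wE => a b c ->.
    have [ab|ab] := eqVneq (a ^+ 2 + b ^+ 2) 0.
      have [a0 b0] : a = 0 /\ b = 0.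
        move/eqP: ab; rewrite paddr_eq0 ?sqr_ge0// !sqrf_eq0 => /andP[/eqP -> /eqP ->]//.
      exists (col7 [:: 1; 0; 0; 0; 0; 0; 0]), (col7 [:: 0; c; 0; 0; 0; 0; 0]).
      split; [exact: mH|exact: mH|]; rewrite cross_col7 a0 b0; apply: col7_eq.
      by cbv [crossS nth]; congr [:: _; _; _; _; _; _; _]; ring.
    set s := a ^+ 2 + b ^+ 2 in ab.
    (* a vector [x] orthogonal to [w], and the product of [w] and [x] divided by
       the square norm of [x] *)
    exists (col7 [:: - b; a; 0; 0; 0; 0; 0]),
      (col7 [:: - (c * a) / s; - (c * b) / s; 1; 0; 0; 0; 0]).
    split; [exact: mH|exact: mH|]; rewrite cross_col7; apply: col7_eq.
    by cbv [crossS nth]; congr [:: _; _; _; _; _; _; _]; rewrite /s; field.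
  move=> [x [y [/mem_actV[u /mem_ImH uH ->] /mem_actV[w /mem_ImH wH ->] ->]]].
  rewrite actv_cross mem_actVE; apply/mem_ImH => i i3.
  rewrite crossE /cross_coords !mxE; move: i3.
  by elim/ord7_ind: i => // _; rewrite /= ?(uH 3%:R isT, wH 3%:R isT) ?(uH 4%:R isT, wH 4%:R isT)
    ?(uH 5%:R isT, wH 5%:R isT) ?(uH 6%:R isT, wH 6%:R isT); ring.
Qed.

(** As for [spaceX_actV], the conditions are checked at the base point. *)
Lemma spaceY_actq g : spaceY (actq g (p0 R)).
Proof.
have [d1 d2 d3 d4] := dim_flag g.
have stab (i j : 'I_7) : (i, j) \in [:: (1, 2%:R); (3%:R, 4%:R); (5%:R, 6%:R)] ->
    cross_stable (mb 0) (mspan R [:: i; j]).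
  rewrite !inE => H v /mem_mspan vs; apply/mem_mspan => l.
  rewrite crossE /cross_coords !mxE; move: vs l.
  by case/or3P: H => /eqP[-> ->] vs; elim/ord7_ind => //= _;
    (try rewrite (vs 0 isT)); (try rewrite (vs 1 isT)); (try rewrite (vs 2%:R isT));
    (try rewrite (vs 3%:R isT)); (try rewrite (vs 4%:R isT)); (try rewrite (vs 5%:R isT));
    (try rewrite (vs 6%:R isT)); ring.
have line : <[actv g (mb 0%R)]>%VS = actV g (mspan R [:: 0]) by rewrite mspan1 actV_line.
split; first by rewrite /S24 /= actv_dot dot_mbl /mbasis mxE /eps /= !mulr1.
split; first split => //.
  split; [apply: actV_pos|apply: actV_neg|apply: actV_neg].
  - by apply: mspan_pos => i; rewrite !inE => /orP[] /eqP ->.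
  - by apply: mspan_neg => i; rewrite !inE => /orP[] /eqP ->.
  - by apply: mspan_neg => i; rewrite !inE => /orP[] /eqP ->.
split; first by split; apply: actV_cross_stable; apply: stab; rewrite !inE eqxx ?orbT.
split.
  by rewrite line; split; apply: actV_orth; apply: mspan_disj => i; rewrite !inE => /eqP ->.
split.
  by split; apply: actV_orth; apply: mspan_disj => i; rewrite !inE => /orP[] /eqP ->.
split; first exact: actV_full.
have full := actV_full g; rewrite directvE /= full dimvf /dim /=.
by rewrite d1 d2 d3 d4.
Qed.

(** ** The maps of the diagram *)

Lemma qproj_qrepr (H : set (G2 R)) (c : quot H) : qproj H (qrepr c) = c.
Proof.
rewrite /qrepr; case: c => C' /= hC; case: cid => g /= E.
rewrite /qproj; move: (ex_intro _ _ _); rewrite -E => e.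
by congr exist; exact: Prop_irrelevance.
Qed.

Lemma qrepr_coset (H : set (G2 R)) h g : isotropy H h ->
  exists2 k, H k & qrepr (qproj H g) = G2mul g k.
Proof.
move=> iH; exists (G2mul (G2inv g) (qrepr (qproj H g))).
  by apply: (qproj_eq iH); rewrite qproj_qrepr.
by apply: G2_eq; rewrite /= mulmxA mulmxV ?mul1mx// G2unit.
Qed.

Lemma betaX_qproj g : betaX (qproj (@groupK R) g) = actV g (ImH R).
Proof.
rewrite /betaX; have [k kK ->] := qrepr_coset g (isotropyK R).
by rewrite actVM kK.
Qed.

Lemma betaY_qproj g : betaY (qproj (@groupT R) g) = actq g (p0 R).
Proof.
rewrite /betaY; have [k + ->] := qrepr_coset g (isotropyT R).
move=> kT; transitivity (actq g (actq k (p0 R))); first by rewrite /= actvM !actVM.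
by rewrite (kT : actq k (p0 R) = p0 R).
Qed.

Lemma ImH_eigen (v : V7) : v \in ImH R <-> J7 R *m v = v.
Proof.
rewrite mem_ImH; split=> [vH|Jv i i3].
  apply/colP => i; rewrite mul_diag_mx !mxE /eps; case: ltnP => [_|/vH ->]; first by rewrite mul1r.
  by rewrite mulr0.
have /colP/(_ i) := Jv; rewrite mul_diag_mx !mxE /eps ltnNge i3 /= mulN1r => E.
lra.
Qed.

(** An orthogonal element of the split group commutes with the signature matrix,
whose fixed space is the imaginary quaternions. *)
Lemma ortho_stabilizes_ImH k : (im_mx (G2mx k))^T *m im_mx (G2mx k) = 1%:M ->
  actV k (ImH R) = ImH R.
Proof.
set M := im_mx _ => MM.
have MJ : M^T *m J7 R *m M = J7 R := aut_ortho (G2P k).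
have MM' : M *m M^T = 1%:M by exact: mulmx1C.
have JM : J7 R *m M = M *m J7 R by rewrite -{2}MJ !mulmxA MM' mul1mx.
have JMT : J7 R *m M^T = M^T *m J7 R.
  have -> : J7 R *m M^T = M^T *m (M *m J7 R) *m M^T by rewrite !mulmxA MM mul1mx.
  by rewrite -JM -!mulmxA MM' mulmx1.
apply/vspaceP => v; apply/mem_actV/idP.
  move=> [u /ImH_eigen Ju ->]; apply/ImH_eigen.
  by rewrite /actv -/M mulmxA JM -mulmxA Ju.
move=> /ImH_eigen Jv; exists (M^T *m v); last by rewrite /actv -/M mulmxA MM' mul1mx.
by apply/ImH_eigen; rewrite mulmxA JMT -mulmxA Jv.
Qed.

Lemma actV_ImH_span g : actV g (ImH R) =
  <<[:: actv g (mb 0%R); actv g (mb 1%R); actv g (mb 2%:R)]>>%VS.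
Proof. exact: actV_span. Qed.

Lemma gram_entry (K X : 'M[R]_7) a b :
  ((K *m mb a)^T *m X *m (K *m mb b)) 0 0 = (K^T *m X *m K) a b.
Proof.
have -> : (K *m mb a)^T *m X *m (K *m mb b) =
    delta_mx 0 a *m (K^T *m X *m K *m delta_mx b 0).
  by rewrite trmx_mul trmx_delta !mulmxA.
by rewrite -colE -rowE [LHS]mxE [LHS]mxE.
Qed.

(** Two frames that are orthonormal for the inner product of a coset differ by an
orthogonal automorphism, which preserves the imaginary quaternions. *)
Lemma m30_iotaK (c : quot (@groupK R)) : m30 (iotaK c) = betaX c.
Proof.
set g := qrepr c; set S := im_mx (G2mx g).
have uS : S \in unitmx := im_mx_unit (G2P g).
rewrite /m30; case: xgetP => [V -> [k /= [kA ->]]|].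
  rewrite -actV_ImH_span /betaX -/g.
  have kE : k = G2mul g (G2mul (G2inv g) k).
    by apply: G2_eq; rewrite /= mulmxA mulmxV ?mul1mx// G2unit.
  rewrite kE actVM ortho_stabilizes_ImH//.
  rewrite /= (im_mx_aut (autV (G2P g)) (G2P k)) im_mx_autV; last exact: G2P.
  apply/matrixP => a b; rewrite trmx_mul !mulmxA -[X in (X *m _) a b]mulmxA -gram_entry.
  by rewrite (kA a b) mxE.
move=> /(_ (betaX c)) []; exists g => /=; split; last by rewrite -actV_ImH_span.
move=> a b; rewrite gram_entry /iotaK -/g -/S !mulmxA -trmx_mul mulVmx// trmx1 mul1mx.
by rewrite mulVmx// mxE.
Qed.

Lemma piX_actq g : piX (actq g (p0 R)) = actV g (ImH R).
Proof. by rewrite /= -actV_line actVD ImH_split. Qed.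

Lemma mem_cross_span U U' x y : x \in U -> y \in U' -> cross x y \in cross_span U U'.
Proof.
move=> /coord_vbasis -> /coord_vbasis ->.
have S (I : Type) (r : seq I) (c : I -> R) (X : I -> V7) z :
    cross (\sum_(i <- r) c i *: X i) z = \sum_(i <- r) c i *: cross (X i) z.
  by elim: r => [|i r IH]; rewrite ?big_nil ?cross0l// !big_cons cross_linl IH.
have S' (I : Type) (r : seq I) (c : I -> R) (X : I -> V7) z :
    cross z (\sum_(i <- r) c i *: X i) = \sum_(i <- r) c i *: cross z (X i).
  by elim: r => [|i r IH]; rewrite ?big_nil ?cross0r// !big_cons cross_linr IH.
rewrite S; apply: memv_suml => i _; rewrite S'; apply/memvZ/memv_suml => j _; apply: memvZ.
by apply: memv_span; apply/allpairsP; exists ((vbasis U)`_i, (vbasis U')`_j); split => //=;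
  apply: mem_nth; rewrite size_tuple.
Qed.

Lemma cross_span_actV g :
  cross_span (actV g (mspan R [:: 1; 2%:R])) (actV g (mspan R [:: 3%:R; 4%:R])) =
  actV g (mspan R [:: 5%:R; 6%:R]).
Proof.
apply/eqP; rewrite eqEsubv; apply/andP; split.
  apply/span_subvP => z /allpairsP[[x y] /= [/vbasis_mem xU /vbasis_mem yU ->]].
  move/mem_actV: xU => [u /mem_mspan us ->]; move/mem_actV: yU => [w /mem_mspan ws ->].
  rewrite actv_cross mem_actVE; apply/mem_mspan => i; rewrite crossE /cross_coords !mxE.
  by elim/ord7_ind: i => //= _;
    rewrite ?(us 0 isT, us 3%:R isT, us 4%:R isT, us 5%:R isT, us 6%:R isT)
      ?(ws 0 isT, ws 1 isT, ws 2%:R isT, ws 5%:R isT, ws 6%:R isT); ring.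
have m (s : seq 'I_7) i : i \in s -> mb i \in mspan R s.
  by move=> is_; apply/memv_span/mapP; exists i.
have cr (i j : 'I_7) : i \in [:: 1; 2%:R] -> j \in [:: 3%:R; 4%:R] ->
    actv g (cross (mb i) (mb j)) \in
    cross_span (actV g (mspan R [:: 1; 2%:R])) (actV g (mspan R [:: 3%:R; 4%:R])).
  by move=> i_ j_; rewrite -actv_cross; apply: mem_cross_span; rewrite mem_actVE; exact: m.
have c5 : mb 5%:R = - cross (mb 1) (mb 3%:R).
  by apply/colP => i; rewrite mxE crossE /cross_coords !mxE; elim/ord7_ind: i; rewrite /=; ring.
have c6 : mb 6%:R = - cross (mb 2%:R) (mb 3%:R).
  by apply/colP => i; rewrite mxE crossE /cross_coords !mxE; elim/ord7_ind: i; rewrite /=; ring.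
have aN x : actv g (- x) = - actv g x by exact: mulmxN.
rewrite actV_span; apply/span_subvP => z; rewrite !inE => /orP[] /eqP ->.
  by rewrite c5 aN memvN; apply: cr; rewrite !inE eqxx.
by rewrite c6 aN memvN; apply: cr; rewrite !inE eqxx.
Qed.

End ModelSpaces.

(** * The diagram *)

Section Diagram.
Variable R : realType.
Local Notation C := R[i].
Local Notation mb := (@mbasis R).
Variables (q : {poly C}) (u1 u2 : plane R -> R) (psi : plane R -> 'M[C]_7).
Hypothesis su1 : smooth u1.
Hypothesis su2 : smooth u2.
Hypothesis hpsi : parallel_translation q u1 u2 psi.
Local Notation F := (Fmx u1 u2 psi).

Let oT : open (setT : set (plane R)). Proof. exact: openT. Qed.

Definition toda_frame p : G2 R := exist _ _ (Fmx_aut su1 su2 hpsi p).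

Lemma toda_frameP : is_toda_frame u1 u2 psi toda_frame.
Proof. by move=> p; rewrite /toda_frame /= im_ext_mx -(Gmx_real su1 su2 hpsi). Qed.

Lemma cplxM m n l (A : 'M[R]_(m, n)) (B : 'M[R]_(n, l)) : cplx (A *m B) = cplx A *m cplx B.
Proof. by rewrite !cpx_real cpxM !mul0mx !mulmx0 subr0 addr0. Qed.

Lemma cplx_mbasis a : cplx (mb a) = mbasis C a.
Proof. by apply/matrixP => i j; rewrite !mxE; case: (_ && _). Qed.

Lemma cplxZ m n (c : R) (A : 'M[R]_(m, n)) : cplx (c *: A) = c%:C *: cplx A.
Proof. by apply/matrixP => i j; rewrite !mxE rmorphM. Qed.

Lemma cplxD m n (A B : 'M[R]_(m, n)) : cplx (A + B) = cplx A + cplx B.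
Proof. by apply/matrixP => i j; rewrite !mxE rmorphD. Qed.

Lemma from_e_ebasis (A : 'M[C]_7) : from_e A *m ebasis R = ebasis R *m A.
Proof. exact: mulmxKV (ebasis_unit R) _. Qed.

Lemma from_eM (A B : 'M[C]_7) : from_e A *m from_e B = from_e (A *m B).
Proof. by rewrite {2}/from_e !mulmxA from_e_ebasis /from_e mulmxA. Qed.

Lemma ebasis_col3 : ebasis R *m delta_mx 3%:R 0 = mbasis C 0.
Proof. by rewrite -colE; apply/colP => i; rewrite [LHS]mxE [LHS]mxE /evec /=. Qed.

Lemma expOmega_fix p : expOmega u1 u2 p *m delta_mx 3%:R 0 = delta_mx 3%:R 0 :> 'cV[C]_7.
Proof.
rewrite (expOmegaE u1 u2); apply/colP => i; rewrite mul_diag_mx !mxE.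
have [->|i3] := eqVneq i 3%:R; last by rewrite mulr0.
by rewrite /ehw /hw /= !mul0r addr0 mulr0 expR0 mulr1.
Qed.

(** The weight of [e_0] is zero, so [e^Omega] fixes this vector. *)
Lemma nu_vector p : ebasis R *m transl u1 u2 psi p *m delta_mx 3%:R 0 = cplx (F p *m mb 0).
Proof.
rewrite cplxM -(Gmx_real su1 su2 hpsi) cplx_mbasis -ebasis_col3 [RHS]mulmxA.
by rewrite from_e_ebasis /Nmx -!mulmxA expOmega_fix.
Qed.

Lemma is_nuP nu : is_nu u1 u2 psi nu <-> forall p, nu p = F p *m mb 0.
Proof.
split=> H p; last by rewrite H nu_vector.
by apply: cplx_inj; rewrite H nu_vector.
Qed.

(** Since [H^(-1/2) = e^Omega], the unitary frame at [z] is moved by the Toda frame. *)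
Lemma from_e_wvec p a : from_e (transl u1 u2 psi p) *m wvec u1 u2 p a = cplx (F p *m mb a).
Proof.
rewrite cplxM -(Gmx_real su1 su2 hpsi) cplx_mbasis /wvec mulmxA (invHsqrt u1 u2).
by rewrite from_eM.
Qed.

Variable Fhat : plane R -> G2 R.
Hypothesis hF : is_toda_frame u1 u2 psi Fhat.
Let imF p : im_mx (G2mx (Fhat p)) = F p := im_Fhat su1 su2 hpsi hF p.

Lemma geometric_mapP f : is_geometric_map u1 u2 psi f <-> forall p, f p = actV (Fhat p) (ImH R).
Proof.
have E p (c1 c2 c3 : R) : from_e (transl u1 u2 psi p) *m
    (c1%:C *: wvec u1 u2 p 0 + c2%:C *: wvec u1 u2 p 1 + c3%:C *: wvec u1 u2 p 2%:R) =
    cplx (actv (Fhat p) (c1 *: mb 0 + c2 *: mb 1 + c3 *: mb 2%:R)).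
  rewrite !mulmxDr -!scalemxAr !from_e_wvec /actv imF !mulmxDr -!scalemxAr.
  by rewrite !cplxD !cplxZ.
have mH (c1 c2 c3 : R) : c1 *: mb 0 + c2 *: mb 1 + c3 *: mb 2%:R \in ImH R.
  by apply/mem_ImH; elim/ord7_ind; rewrite // !mxE /= !mulr0 !addr0.
have Hm (u : imo R) : u \in ImH R -> u = u 0 0 *: mb 0 + u 1 0 *: mb 1 + u 2%:R 0 *: mb 2%:R.
  move=> /mem_ImH uH; apply/colP; elim/ord7_ind; rewrite !mxE /= ?mulr0 ?mulr1 ?addr0 ?add0r//;
  exact: uH.
split=> [gf p|fE p x].
  apply/vspaceP => v; apply/idP/mem_actV.
    move=> vf; have [|c1 [c2 [c3]]] := (gf p (cplx v)).1; first by exists v.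
    rewrite E => /cplx_inj ->; exists (c1 *: mb 0 + c2 *: mb 1 + c3 *: mb 2%:R) => //.
  move=> [u /Hm uE ->]; have [|w wf] := (gf p (cplx (actv (Fhat p) u))).2.
    by exists (u 0 0), (u 1 0), (u 2%:R 0); rewrite E -uE.
  by move=> /cplx_inj ->.
rewrite fE; split.
  move=> [v /mem_actV[u /Hm uE ->] ->].
  by exists (u 0 0), (u 1 0), (u 2%:R 0); rewrite E -uE.
move=> [c1 [c2 [c3 ->]]]; rewrite E; eexists; last by [].
by rewrite mem_actVE; exact: mH.
Qed.

(** ** The harmonic map sequence *)

Lemma mxcD_cpx m n (A B : plane R -> 'M[R]_(m, n)) v p :
  mxcD v (fun p => cpx (A p) (B p)) p = cpx (mxD v A p) (mxD v B p).
Proof.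
rewrite /mxcD; under [X in mxD v X p]eq_fun do rewrite Re_cpx.
by under [X in cpx _ (mxD v X p)]eq_fun do rewrite Im_cpx.
Qed.

Lemma mx_dz_cpx m n (A B : plane R -> 'M[R]_(m, n)) p :
  mx_dz (fun p => cpx (A p) (B p)) p =
  cpx (2^-1 *: (mxD (dirx R) A p + mxD (diry R) B p))
      (2^-1 *: (mxD (dirx R) B p - mxD (diry R) A p)).
Proof.
rewrite mx_dzE !mxcD_cpx scale_i_cpx -scale_half_cpx; congr (_ *: _).
by apply/matrixP => i j; rewrite !mxE; apply/eqP; rewrite eq_complex /= opprK !eqxx.
Qed.

Lemma mxD_scaled_frame (t : plane R -> R) (A : plane R -> 'M[R]_7) v p (x : imo R) :
  derivable t p v -> (forall p, mxcD v (Gmx u1 u2 psi) p = Gmx u1 u2 psi p *m cplx (A p)) ->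
  mxD v (fun p => t p *: (F p *m x)) p = F p *m ('D_v t p *: x + t p *: (A p *m x)).
Proof.
move=> dt DG; have dF : mxder F p v by exact: mxCk_der (mxcCk_Gmx su1 su2 hpsi 1).1 Logic.I.
have [dx Dx] := mxD_cst x p v; have [dy Dy] := mxD_mul dF dx.
have [dz Dz] : mxder (fun p => t p *: (F p *m x)) p v /\
    mxD v (fun p => t p *: (F p *m x)) p = 'D_v t p *: (F p *m x) + t p *: mxD v (fun p => F p *m x) p.
  split=> [i j|].
    under eq_fun do rewrite mxE; exact: (derivableM dt (dy i j)).
  apply/matrixP => i j.
  have DE : mxD v (fun p => F p *m x) p i j = 'D_v (fun p => (F p *m x) i j) p by rewrite mxE.
  rewrite [LHS]mxE [RHS]mxE [X in _ = X + _]mxE [X in _ = _ + X]mxE DE.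
  under [X in 'D_v X p = _]eq_fun do rewrite mxE.
  by rewrite (deriveM dt (dy i j)) addrC /GRing.scale /= [(_ *m _) i j * _]mulrC.
rewrite Dz Dy Dx mulmx0 addr0 (ReIm_mxD (DG p)).1 mulmxDr -!scalemxAr.
by rewrite -mulmxA.
Qed.

Local Notation t := (tco u2).
Local Notation b := (bco u1 u2).

Lemma mx7_mbasis rows (a : 'I_7) : mx7 rows *m mb a = \col_i (nth [::] rows i)`_a :> imo R.
Proof. by rewrite /mbasis -colE; apply/colP => i; rewrite !mxE. Qed.

Lemma pmx_mb0 t1 t2 b1 b2 g1 g2 d1 d2 :
  (pmx t1 t2 b1 b2 g1 g2 + tmx d1 d2) *m mb 0 = (2 * t2) *: mb 3%:R + (2 * t1) *: mb 4%:R.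
Proof.
by rewrite mulmxDl !mx7_mbasis; apply/colP => i; rewrite !mxE; elim/ord7_ind: i; rewrite /=; ring.
Qed.

Lemma pmx_mb3 t1 t2 b1 b2 g1 g2 d1 d2 : (pmx t1 t2 b1 b2 g1 g2 + tmx d1 d2) *m mb 3%:R =
  (2 * t2) *: mb 0 + b1 *: mb 1 + b2 *: mb 2%:R + (d1 - d2) *: mb 4%:R.
Proof.
by rewrite mulmxDl !mx7_mbasis; apply/colP => i; rewrite !mxE; elim/ord7_ind: i; rewrite /=; ring.
Qed.

Lemma pmx_mb4 t1 t2 b1 b2 g1 g2 d1 d2 : (pmx t1 t2 b1 b2 g1 g2 + tmx d1 d2) *m mb 4%:R =
  (2 * t1) *: mb 0 + b2 *: mb 1 + (- b1) *: mb 2%:R + (d2 - d1) *: mb 3%:R.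
Proof.
by rewrite mulmxDl !mx7_mbasis; apply/colP => i; rewrite !mxE; elim/ord7_ind: i; rewrite /=; ring.
Qed.

(** The Higgs field maps [e_0] to a multiple of [e_(-1)]. *)
Lemma mulmx_comb (M : 'M[R]_7) (d t a b c e : R) (y x0 x1 x2 x3 : imo R) :
  M *m (d *: y + t *: (a *: x0 + b *: x1 + c *: x2 + e *: x3)) =
  d *: (M *m y) + t *: (a *: (M *m x0) + b *: (M *m x1) + c *: (M *m x2) + e *: (M *m x3)).
Proof. by rewrite !mulmxDr -!scalemxAr !mulmxDr -!scalemxAr. Qed.

Lemma nu1E nu p : (forall p, nu p = F p *m mb 0) ->
  nu1 nu p = cpx (t p *: (F p *m mb 4%:R)) (- t p *: (F p *m mb 3%:R)).
Proof.
move=> nuE; rewrite /nu1.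
have -> : (fun p => cplx (nu p)) = (fun p => cpx (1 *: (F p *m mb 0)) 0).
  by apply/funext => p'; rewrite nuE cpx_real scale1r.
have d1 v : derivable (fun _ : plane R => (1 : R)) p v by exact: derivable_cst.
have D1 v : 'D_v (fun _ : plane R => (1 : R)) p = 0 by exact: derive_cst.
rewrite mx_dz_cpx !(mxD_cst _ _ _).2 addr0 sub0r.
rewrite (mxD_scaled_frame _ (d1 _) (mxcD_Gmx_x su1 su2 hpsi)).
rewrite (mxD_scaled_frame _ (d1 _) (mxcD_Gmx_y su1 su2 hpsi)).
rewrite !D1 !scale0r !add0r !scale1r /Ax /Ay !pmx_mb0 !mulr0 !scale0r addr0 add0r.
rewrite -!scalemxAr; move: (F p *m _) (F p *m _) => x y.
by congr cpx; apply/colP => i; rewrite !mxE; field.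
Qed.

(** Twice the [z]-derivative of [u2]: one half comes from the coefficient of [nu1]
and one half from the torus part of the connection. *)
Definition nuk p : C := ('D_(dirx R) u2 p) +i* (- 'D_(diry R) u2 p).

(** The Higgs field maps [e_(-1)] to a multiple of [e_(-2)]; the first component
comes from the coefficient of [nu1] and from the torus part of the connection. *)
Lemma nu1_dz nu p : (forall p, nu p = F p *m mb 0) ->
  mx_dz (nu1 nu) p = nuk p *: nu1 nu p +
    cpx (- (t p * b p) *: (F p *m mb 2%:R)) (- (t p * b p) *: (F p *m mb 1)).
Proof.
move=> nuE; have -> : nu1 nu = fun p => cpx (t p *: (F p *m mb 4%:R)) (- t p *: (F p *m mb 3%:R)).
  by apply/funext => p'; exact: nu1E.
have dt v : derivable t p v by exact: (Ck_der (Ck_tco su2 1) Logic.I).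
have dn v : derivable (fun p => - t p) p v by exact: (derivableN (dt v)).
have Dn v : 'D_v (fun p => - t p) p = - 'D_v t p by exact: (deriveN (dt v)).
rewrite mx_dz_cpx.
rewrite !(mxD_scaled_frame _ (dt _) (mxcD_Gmx_x su1 su2 hpsi)).
rewrite !(mxD_scaled_frame _ (dt _) (mxcD_Gmx_y su1 su2 hpsi)).
rewrite !(mxD_scaled_frame _ (dn _) (mxcD_Gmx_x su1 su2 hpsi)).
rewrite !(mxD_scaled_frame _ (dn _) (mxcD_Gmx_y su1 su2 hpsi)).
rewrite !Dn !(derive_tco su2).
have -> (A B A' B' : imo R) : nuk p *: cpx A B + cpx A' B' =
    cpx ('D_(dirx R) u2 p *: A + 'D_(diry R) u2 p *: B + A')
        ('D_(dirx R) u2 p *: B - 'D_(diry R) u2 p *: A + B').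
  apply/matrixP => i j; rewrite !mxE /nuk.
  by apply/eqP; rewrite eq_complex /=; apply/andP; split; apply/eqP; ring.
rewrite /Ax /Ay !pmx_mb3 !pmx_mb4 !mulmx_comb /xd1 /xd2 /yd1 /yd2 !(derive_hw su1 su2) /=.
move: (F p *m mb 0) (F p *m mb 1) (F p *m mb 2%:R) (F p *m mb 3%:R) (F p *m mb 4%:R).
move: (t p) (b p) ('D_(dirx R) u1 p) ('D_(diry R) u1 p) ('D_(dirx R) u2 p) ('D_(diry R) u2 p).
move=> t0 b0 a1 a2 a3 a4 f0 f1 f2 f3 f4.
by congr cpx; apply/colP => i; rewrite !mxE; field.
Qed.

Lemma dot_cpx (x y z w : imo R) :
  dot (cpx x y) (cpx z w) = (dot x z - dot y w) +i* (dot x w + dot y z).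
Proof.
rewrite !dotE !mxE.
by apply/eqP; rewrite eq_complex /=; apply/andP; split; apply/eqP; ring.
Qed.

Lemma tco_neq0 p : t p != 0.
Proof. by rewrite mulf_neq0 ?gt_eqF ?expR_gt0// sqrtr_gt0 ltr0n. Qed.

Lemma bco_neq0 p : b p != 0.
Proof. by rewrite mulf_neq0 ?gt_eqF ?expR_gt0// sqrtr_gt0 ltr0n. Qed.

(** The images of [e_(-1)] and [e_(-2)] are orthogonal for the Hermitian form, which
leaves the second component. *)
Lemma nu2E nu p : (forall p, nu p = F p *m mb 0) ->
  nu2 nu p = cpx (- (t p * b p) *: (F p *m mb 2%:R)) (- (t p * b p) *: (F p *m mb 1)).
Proof.
move=> nuE; rewrite /nu2 nu1_dz//; set w := cpx _ _; set n1 := nu1 nu p.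
have nb : map_mx (@conjc R) n1 = cpx (t p *: (F p *m mb 4%:R)) (t p *: (F p *m mb 3%:R)).
  rewrite /n1 nu1E// scaleNr.
  have -> (A B : imo R) : map_mx (@conjc R) (cpx A (- B)) = cpx A B by apply/matrixP => i j; rewrite !mxE /= opprK.
  by [].
have Fdot x y : dot (F p *m x) (F p *m y) = dot x y.
  by rewrite -imF (aut_dot _ _ (G2P (Fhat p))).
have sdot (c d : R) x y : dot (c *: (F p *m x)) (d *: (F p *m y)) = c * d * dot x y.
  have := dot_linl c (F p *m x) 0 (d *: (F p *m y)); rewrite dot0l !addr0 => ->.
  have := dot_linr d (F p *m y) 0 (F p *m x); rewrite dot0r !addr0 => ->.
  by rewrite Fdot mulrA.
have wn : dot w (map_mx (@conjc R) n1) = 0.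
  rewrite nb /w dot_cpx !sdot !dot_mbl /mbasis !mxE /= !mulr0 !subr0 addr0.
  by apply/eqP; rewrite eq_complex /= !eqxx.
have nn : dot n1 (map_mx (@conjc R) n1) != 0.
  rewrite nb /n1 nu1E// dot_cpx !sdot !dot_mbl /mbasis !mxE /= /eps /= !mulr0 !addr0.
  rewrite eq_complex /= negb_and; apply/orP; left.
  have -> : t p * t p * (-1 * 1) - - t p * t p * (-1 * 1) = - 2 * (t p * t p) by ring.
  by rewrite mulf_neq0 ?oppr_eq0 ?pnatr_eq0// mulf_neq0 ?tco_neq0.
rewrite dot_linl wn addr0 mulfK//.
by rewrite addrAC subrr add0r.
Qed.

Lemma span_scale (V : vectType R) (c d : R) (x y : V) : c != 0 -> d != 0 ->
  (<<[:: c *: x; d *: y]>> = <<[:: x; y]>>)%VS.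
Proof.
move=> c0 d0; rewrite !span_cons !span_nil !addv0; congr (_ + _)%VS.
  apply/eqP; rewrite eqEsubv -!memvE memvZ ?memv_line//=.
  by rewrite -{1}[x](scalerK c0) memvZ// memv_line.
apply/eqP; rewrite eqEsubv -!memvE memvZ ?memv_line//=.
by rewrite -{1}[y](scalerK d0) memvZ// memv_line.
Qed.

Lemma span_swap (V : vectType R) (x y : V) : (<<[:: x; y]>> = <<[:: y; x]>>)%VS.
Proof. by rewrite !span_cons !span_nil !addv0 addvC. Qed.

(** The first two terms of the harmonic sequence are multiples of the images of
[e_(-1)] and [e_(-2)], whose real and imaginary parts span two of the planes of the
base point. *)
Lemma geometric_liftE nu p : (forall p, nu p = F p *m mb 0) ->
  geometric_lift nu p = actq (Fhat p) (p0 R).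
Proof.
move=> nuE; rewrite /geometric_lift nu1E// nu2E// !Re_cpx !Im_cpx.
have t0 := tco_neq0 p; have b0 := bco_neq0 p.
have tb0 : - (t p * b p) != 0 by rewrite oppr_eq0 mulf_neq0.
have nt0 : - t p != 0 by rewrite oppr_eq0.
rewrite !span_scale// span_swap [X in cross_span _ X]span_swap [X in (_, _, X, _)]span_swap.
have aF x : F p *m x = actv (Fhat p) x by rewrite /actv imF.
have E (i j : 'I_7) : (<<[:: F p *m mb i; F p *m mb j]>>)%VS = actV (Fhat p) (mspan R [:: i; j]).
  by rewrite actV_span /= -!aF.
by rewrite !E cross_span_actV nuE aF.
Qed.

End Diagram.

Theorem theorem3p13 (R : realType) (q : {poly R[i]}) (hq : q != 0)
    (u1 u2 : plane R -> R)
    (hu : toda_solution q u1 u2) (hcomplete : complete_solution q u1 u2)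
    (psi : plane R -> 'M[R[i]]_7) (hpsi : parallel_translation q u1 u2 psi) :
  (exists (nu : plane R -> imo R) (Fhat : plane R -> G2 R)
          (f : plane R -> {vspace imo R}),
     [/\ is_nu u1 u2 psi nu, is_toda_frame u1 u2 psi Fhat
       & is_geometric_map u1 u2 psi f]) /\
  forall (nu : plane R -> imo R) (Fhat : plane R -> G2 R)
         (f : plane R -> {vspace imo R}),
    is_nu u1 u2 psi nu -> is_toda_frame u1 u2 psi Fhat ->
    is_geometric_map u1 u2 psi f ->
    let FT := fun z => qproj (@groupT R) (Fhat z) in
    let FK := fun z => qproj (@groupK R) (Fhat z) in
    let Gnu := geometric_lift nu in
    (forall z, [/\ S24 (nu z), spaceX (f z) & spaceY (Gnu z)]) /\
    (harmonic_map (lieT R) FT /\ harmonic_map (lieK R) FK) /\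
    [/\ forall z, betaY (FT z) = Gnu z,
        forall z, betaX (FK z) = f z,
        forall z, piX (Gnu z) = f z,
        forall z, piS (Gnu z) = nu z
      & forall z, m30 (iotaK (FK z)) = betaX (FK z)].
Proof.
have [su1 su2 _ _] := hu; split.
  exists (fun p => Fmx u1 u2 psi p *m mbasis R 0), (toda_frame su1 su2 hpsi),
    (fun p => actV (toda_frame su1 su2 hpsi p) (ImH R)).
  have hF := toda_frameP su1 su2 hpsi; split; first exact/(is_nuP su1 su2 hpsi).
    exact: hF.
  exact/(geometric_mapP su1 su2 hpsi hF).
move=> nu Fhat f /(is_nuP su1 su2 hpsi) nuE hF /(geometric_mapP su1 su2 hpsi hF) fE FT FK Gnu.
have GE z : Gnu z = actq (Fhat z) (p0 R) := geometric_liftE su1 su2 hpsi hF z nuE.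
split=> [z|].
  rewrite GE fE; split; [|exact: spaceX_actV|exact: spaceY_actq].
  by rewrite -[nu z]/(piS (Gnu z)) GE; have [] := spaceY_actq (Fhat z).
split; first by split; [exact: (harmonic_FT su1 su2 hpsi hF)|exact: (harmonic_FK su1 su2 hpsi hF)].
split=> z.
- by rewrite betaY_qproj GE.
- by rewrite betaX_qproj fE.
- by rewrite GE fE piX_actq.
- by [].
- exact: m30_iotaK.
Qed.
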